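(* Let $W=(W^1,\dots,W^d)$ be a standard $d$-dimensional Brownian motion, let $0\le s<t$ and $h:=t-s$. Let $W_{s,t}$ be the path increment, $H_{s,t}$ the (rescaled) space-time Lévy area, $K_{s,t}$ the (rescaled) space-time-time Lévy area and $L_{s,t}=(L_{s,t}^{ij})$ the space-space-time Lévy area of $W$ over $[s,t]$. Then for all $i,j\in\{1,\dots,d\}$, almost surely, $$\mathbb{E}\big[L_{s,t}^{ij}\,\big|\,W_{s,t},H_{s,t}\big]=\tfrac{3}{5}h\,H_{s,t}^iH_{s,t}^j+\tfrac{1}{30}h^2\delta_{ij},$$ $$\mathbb{E}\big[L_{s,t}^{ij}\,\big|\,W_{s,t},H_{s,t},K_{s,t}\big]=\tfrac{3}{5}h\,H_{s,t}^iH_{s,t}^j-\tfrac12 h\big(W_{s,t}^iK_{s,t}^j+K_{s,t}^iW_{s,t}^j\big)+\tfrac{60}{7}h\,K_{s,t}^iK_{s,t}^j+\tfrac{3}{140}h^2\delta_{ij},$$ where $\delta_{ij}$ is the Kronecker delta.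
   Context: Notation: $W_{s,u}:=W_u-W_s$, and $\circ\,dW$ denotes Stratonovich integration. $$H_{s,t}:=\frac1h\int_s^t\Big(W_{s,u}-\frac{u-s}{h}W_{s,t}\Big)du,\qquad K_{s,t}:=\frac{1}{h^2}\int_s^t\Big(W_{s,u}-\frac{u-s}{h}W_{s,t}\Big)\Big(\tfrac12h-(u-s)\Big)du .$$ The space-space-time Lévy area is the $d\times d$ matrix with entries $$L_{s,t}^{ij}:=\frac1{12}\bigg(\int_s^t\!\int_s^u W_{s,v}^i\circ dW_v^j\,du+\int_s^t\!\int_s^u W_{s,v}^j\circ dW_v^i\,du-2\int_s^t\!\Big(\int_s^u W_{s,v}^i\,dv\Big)\circ dW_u^j-2\int_s^t\!\Big(\int_s^u W_{s,v}^j\,dv\Big)\circ dW_u^i$$ $$\qquad+\int_s^t\!\Big(\int_s^u (v-s)\,dW_v^i\Big)\circ dW_u^j+\int_s^t\!\Big(\int_s^u (v-s)\,dW_v^j\Big)\circ dW_u^i\bigg).$$ *)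

(* Defs.v *)
From HB Require Import structures.
From mathcomp Require Import all_boot all_order all_algebra.
From mathcomp Require Import all_classical all_reals all_analysis.
Import Order.TTheory GRing.Theory Num.Theory.
Import numFieldNormedType.Exports.

Set Implicit Arguments.
Unset Strict Implicit.
Unset Printing Implicit Defensive.

Local Open Scope classical_set_scope.
Local Open Scope ring_scope.

Definition sigma_family (d : measure_display) (T : Type)
    (S : measurableType d) (I : Type) (D : set I) (X : I -> T -> S) :
    set (set T) :=
  <<s \bigcup_(i in D) preimage_set_system setT (X i) measurable >>.

(* Each [F i] is meant to be a sigma-algebra: since [F i] then contains
   [setT], the product rule over all of [I] contains the one over every
   subfamily. *)
Definition mutually_independent (d : measure_display) (T : measurableType d)
    (R : realType) (P : probability T R) (I : finType)
    (F : I -> set (set T)) : Prop :=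
  forall E : I -> set T, (forall i, F i (E i)) ->
    P (\bigcap_(i in [set: I]) E i) = (\prod_(i : I) P (E i))%E.

(* Processes are indexed by all of [R]; only times in [0, +oo[ matter.  The
   second parameter of [normal_prob] is the standard deviation. *)
Definition brownian_motion1 (d : measure_display) (T : measurableType d)
    (R : realType) (P : probability T R) (B : R -> {RV P >-> R}) : Prop :=
  [/\ {ae P, forall w, B 0 w = 0},
      (forall w, {within `[0, +oo[, continuous (fun u => B u w)}),
      (forall (n : nat) (t : nat -> R), 0 <= t 0%N ->
        (forall k, (k < n)%N -> t k < t k.+1) ->
        mutually_independent P (fun k : 'I_n =>
          preimage_set_system setT
            (fun w => B (t k.+1) w - B (t k) w) measurable)) &
      (forall a b : R, 0 <= a -> a < b -> forall A : set R, measurable A ->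
        P ((fun w => B b w - B a w) @^-1` A)
        = normal_prob 0 (Num.sqrt (b - a)) A)].

Definition brownian_motion (d : measure_display) (T : measurableType d)
    (R : realType) (P : probability T R) (n : nat)
    (W : 'I_n -> R -> {RV P >-> R}) : Prop :=
  (forall i, brownian_motion1 (W i)) /\
  mutually_independent P
    (fun i => sigma_family `[0, +oo[ (fun u w => W i u w)).

(* A partition a = p_0 < ... < p_n = b is encoded as in [itv_partition], by
   the list of its points other than [a]; thus its points are those of
   [a :: p].  [lim_partitions P a b S Z]: [S p] tends to [Z] in probability as
   the mesh of the partition [p] of [a, b] tends to 0. *)
Definition lim_partitions (d : measure_display) (T : measurableType d)
    (R : realType) (P : probability T R) (a b : R) (S : seq R -> T -> R)
    (Z : T -> R) : Prop :=
  forall eps eta : R, 0 < eps -> 0 < eta -> exists2 delta : R, 0 < delta &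
    forall p : seq R, itv_partition a b p ->
      (forall k, (k < size p)%N ->
        nth b (a :: p) k.+1 - nth b (a :: p) k < delta) ->
      (P [set w | (eps <= `|S p w - Z w|)%R] <= eta%:E)%E.

Definition ito_sum (T : Type) (R : realType) (X Y : R -> T -> R) (a b : R)
    (p : seq R) (w : T) : R :=
  let x := nth b (a :: p) in
  \sum_(0 <= k < size p) X (x k) w * (Y (x k.+1) w - Y (x k) w).

Definition stratonovich_sum (T : Type) (R : realType) (X Y : R -> T -> R)
    (a b : R) (p : seq R) (w : T) : R :=
  let x := nth b (a :: p) in
  \sum_(0 <= k < size p)
    (X (x k) w + X (x k.+1) w) / 2 * (Y (x k.+1) w - Y (x k) w).

(* [Z] is a version of the Ito, resp. Stratonovich, integral of [X] against [Y]
   over [a, b], as the limit in probability of left-endpoint, resp.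
   trapezoidal, sums.  For continuous semimartingales [X] and [Y] these are the
   usual integrals. *)
Definition is_ito (d : measure_display) (T : measurableType d)
    (R : realType) (P : probability T R) (X Y : R -> T -> R) (a b : R)
    (Z : T -> R) : Prop :=
  lim_partitions P a b (ito_sum X Y a b) Z.

Definition is_stratonovich (d : measure_display) (T : measurableType d)
    (R : realType) (P : probability T R) (X Y : R -> T -> R) (a b : R)
    (Z : T -> R) : Prop :=
  lim_partitions P a b (stratonovich_sum X Y a b) Z.

(* [A] is a continuous version, indexed by u in [a, b], of the integral
   process over [a, u]. *)
Definition is_ito_process (d : measure_display) (T : measurableType d)
    (R : realType) (P : probability T R) (X Y : R -> T -> R) (a b : R)
    (A : R -> {RV P >-> R}) : Prop :=
  (forall u, a <= u <= b -> is_ito P X Y a u (A u)) /\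
  (forall w, {within `[a, b], continuous (fun u => A u w)}).

Definition is_stratonovich_process (d : measure_display)
    (T : measurableType d) (R : realType) (P : probability T R)
    (X Y : R -> T -> R) (a b : R) (A : R -> {RV P >-> R}) : Prop :=
  (forall u, a <= u <= b -> is_stratonovich P X Y a u (A u)) /\
  (forall w, {within `[a, b], continuous (fun u => A u w)}).

Section levy_areas.
Context (d : measure_display) (T : measurableType d) (R : realType)
  (P : probability T R) (n : nat) (W : 'I_n -> R -> {RV P >-> R}) (s t : R).

Local Notation h := (t - s).
Local Notation mu := (@lebesgue_measure R).

Definition increment (a b : R) (i : 'I_n) (w : T) : R := W i b w - W i a w.

Definition st_levy_area (i : 'I_n) (w : T) : R :=
  h^-1 * \int[mu]_(u in `[s, t])
    (increment s u i w - (u - s) / h * increment s t i w).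

Definition stt_levy_area (i : 'I_n) (w : T) : R :=
  (h ^+ 2)^-1 * \int[mu]_(u in `[s, t])
    ((increment s u i w - (u - s) / h * increment s t i w)
     * (h / 2 - (u - s))).

(* Stochastic integrals are determined only up to null sets, so the area is
   described by the relation "[L] is a version of the area". *)
Definition is_sst_levy_area (L : 'I_n -> 'I_n -> {RV P >-> R}) : Prop :=
  exists (A : 'I_n -> 'I_n -> R -> {RV P >-> R})
    (B : 'I_n -> 'I_n -> {RV P >-> R})
    (C : 'I_n -> R -> {RV P >-> R})
    (D : 'I_n -> 'I_n -> {RV P >-> R}),
  [/\ (forall i j, is_stratonovich_process
        (fun v w => increment s v i w) (fun v w => W j v w) s t (A i j)),
      (forall i j, is_stratonovich P
        (fun u w => \int[mu]_(v in `[s, u]) increment s v i w)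
        (fun u w => W j u w) s t (B i j)),
      (forall i, is_ito_process
        (fun v _ => v - s) (fun v w => W i v w) s t (C i)),
      (forall i j, is_stratonovich P
        (fun u w => C i u w) (fun u w => W j u w) s t (D i j)) &
      (forall i j, {ae P, forall w, L i j w = 12^-1 *
        ( \int[mu]_(u in `[s, t]) A i j u w + \int[mu]_(u in `[s, t]) A j i u w
          - 2 * B i j w - 2 * B j i w
          + D i j w + D j i w )})].

End levy_areas.

(* [Y] is a version of the conditional expectation E[X | G]; in particular [X]
   is required to be integrable. *)
Definition is_cond_expectation (d : measure_display) (T : measurableType d)
    (R : realType) (P : probability T R) (G : set (set T)) (X Y : T -> R) :
    Prop :=
  [/\ G `<=` measurable,
      P.-integrable setT (EFin \o X),
      (forall B : set R, measurable B -> G (Y @^-1` B)),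
      P.-integrable setT (EFin \o Y) &
      (forall A, G A ->
        \int[P]_(w in A) (Y w)%:E = \int[P]_(w in A) (X w)%:E)%E].

(* Main.v *)
(* Write x for the path W - W_s on [s, t] and h = t - s. Integration by parts
   turns 12 L^ij almost surely into
     h x^i_t x^j_t - 3 (x^j_t I^i + x^i_t I^j) + 6 J,
   with I^i and J the integrals over [s, t] of x^i and x^i x^j, and I^i is
   h H^i + h x^i_t / 2, so only the conditional mean of J matters.

   W_st, H and K are the pairings of dW with the first three Legendre
   polynomials. Projecting the indicator of [s, u] onto their span decomposes
   x_u into a combination of W_st, H, K and a Gaussian rest independent of
   them, which gives E[J | W_st, H, K]. Rather than conditioning, one shows
   E[(L - Y) F] = 0 for F a product of smooth bounded functions of the
   coordinates of W_st, H, K, by Gaussian integration by parts. This is done on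
   a uniform grid with n cells, where discrete Legendre polynomials keep the
   projection exact; fourth moments bounded uniformly in n allow n to tend to
   infinity. Logistic functions converging to indicators of half-lines and a
   pi-lambda argument then replace F by the indicator of any event of the
   sigma-algebra. For the conditioning on W_st, H alone, the test functions do
   not involve K and the same integration by parts gives E[K^i W_st^j F] = 0 and
   E[K^i K^j F] = delta_ij h / 720 E[F]. *)

Require Import Defs.
From HB Require Import structures.
From mathcomp Require Import all_boot all_order all_algebra.
From mathcomp Require Import all_classical all_reals all_analysis.
From mathcomp Require Import measurable_realfun ring lra.
Import Order.TTheory GRing.Theory Num.Theory.
Import numFieldNormedType.Exports.

Set Implicit Arguments.
Unset Strict Implicit.
Unset Printing Implicit Defensive.

Local Open Scope classical_set_scope.
Local Open Scope ring_scope.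

(** * Moments and Stein's identity for the normal law *)

(** The constants come from [gram_lim]. Put Q = J / h. Then L^ij = (h/2) Q - (h/4) (H^i W^j + W^i
    H^j) - (h/6) W^i W^j, and the conditional mean of Q given W, H, K is the quadratic form with
    matrix [gram_lim] plus 3/70 h delta_ij, where 3/70 h is the time average of the variance of the
    Gaussian rest. The entries 1/3 and 1/2 cancel the terms in W W and W H; the entries 6/5, -1,
    120/7 and the number 3/70, halved, are 3/5, -1/2, 60/7 and 3/140. Without K, 60/7 times 1/720 is
    1/84, and 3/140 + 1/84 = 1/30. The stochastic integrals are only limits in probability, and some
    of them, taken singly, are not limits path by path; symmetry in i and j makes their sums
    telescope. Gaussian integration by parts stands in for the independence of uncorrelated Gaussian
    variables: it needs one normal coordinate independent of the others, and orthogonality of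
    coefficients kills every derivative of the test function. Orthogonality must therefore be exact
    on each grid, since otherwise errors containing these derivatives would remain. *)

Section real_integrable.
Context d (T : measurableType d) (R : realType).
Variable mu : {measure set T -> \bar R}.
Implicit Types f g : T -> R.

Lemma RintegrableZ k f : mu.-integrable setT (EFin \o f) ->
  mu.-integrable setT (EFin \o (fun x => k * f x)).
Proof.
move=> fi; rewrite (_ : EFin \o _ = fun x => (k%:E * (EFin \o f) x)%E)//.
exact: integrableZl.
Qed.

Lemma RintegrableD f g : mu.-integrable setT (EFin \o f) ->
  mu.-integrable setT (EFin \o g) ->
  mu.-integrable setT (EFin \o (fun x => f x + g x)).
Proof. by move=> fi gi; exact: (integrableD measurableT fi gi). Qed.

Lemma RintegrableB f g : mu.-integrable setT (EFin \o f) ->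
  mu.-integrable setT (EFin \o g) ->
  mu.-integrable setT (EFin \o (fun x => f x - g x)).
Proof. by move=> fi gi; exact: (integrableB measurableT fi gi). Qed.

Lemma Rintegrable_sum (I : Type) (r : seq I) (Q : pred I) (f : I -> T -> R) :
  (forall i, Q i -> mu.-integrable setT (EFin \o f i)) ->
  mu.-integrable setT (EFin \o (fun x => \sum_(i <- r | Q i) f i x)).
Proof.
move=> fi.
rewrite (_ : EFin \o _ = fun x => (\sum_(i <- r | Q i) (EFin \o f i) x)%E).
  exact: integrable_sum.
by apply/funext => x /=; rewrite sumEFin.
Qed.

Lemma le_Rintegrable f g : measurable_fun setT f ->
  (forall x, `|f x| <= g x) -> mu.-integrable setT (EFin \o g) ->
  mu.-integrable setT (EFin \o f).
Proof.
move=> mf fg gi; apply: (le_integrable _ _ _ gi) => //.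
  exact/measurable_EFinP.
by move=> x _; rewrite /= lee_fin (le_trans (fg x))// ler_norm.
Qed.

Lemma RintegrableM_bounded C f g : mu.-integrable setT (EFin \o f) ->
  measurable_fun setT g -> (forall x, `|g x| <= C) ->
  mu.-integrable setT (EFin \o (fun x => f x * g x)).
Proof.
move=> fi mg gC; have mf : measurable_fun setT f.
  exact/measurable_EFinP/(measurable_int _ fi).
have fi' : mu.-integrable setT (EFin \o (fun x => C * `|f x|)).
  exact/RintegrableZ/integrable_norm.
apply: le_Rintegrable fi'; first exact: measurable_funM.
by move=> x; rewrite normrM mulrC ler_wpM2r.
Qed.

Lemma Rintegral_sum (I : Type) (r : seq I) (Q : pred I) (f : I -> T -> R) :
  (forall i, Q i -> mu.-integrable setT (EFin \o f i)) ->
  \int[mu]_x (\sum_(i <- r | Q i) f i x) = \sum_(i <- r | Q i) \int[mu]_x f i x.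
Proof.
move=> fi; elim: r => [|i r IH].
  under eq_Rintegral do rewrite big_nil.
  by rewrite big_nil Rintegral_cst// mul0r.
rewrite big_cons; case: ifPn => Qi.
  rewrite -IH -RintegralD//; [|exact: fi|exact: Rintegrable_sum].
  by apply: eq_Rintegral => x _; rewrite big_cons Qi.
by rewrite -IH; apply: eq_Rintegral => x _; rewrite big_cons (negbTE Qi).
Qed.

End real_integrable.

Section normal_integral.
Context (R : realType) (s : R).
Local Notation mu := (@lebesgue_measure R).
Local Notation N := (normal_prob 0 s).

(** The Radon-Nikodym derivative of the normal law and its density have the same integral over every
    measurable set, hence agree almost everywhere; change of variables holds for the former. *)
Lemma ge0_integral_normal_prob (f : R -> \bar R) :
  (forall x, 0 <= f x)%E -> measurable_fun setT f ->
  (\int[N]_x f x = \int[mu]_x (f x * (normal_pdf 0 s x)%:E))%E.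
Proof.
move=> f0 mf.
have dom := normal_prob_dominates 0 s.
rewrite -(Radon_Nikodym_SigmaFinite.change_of_variables dom f0)//.
have mg := measurable_int _ (Radon_Nikodym_SigmaFinite.f_integrable dom).
have mp : measurable_fun setT (EFin \o normal_pdf 0 s).
  by apply/measurable_EFinP; exact: measurable_normal_pdf.
apply: ae_eq_integral => //.
- exact: emeasurable_funM.
- exact: emeasurable_funM.
apply: ae_eqe_mul2l => /=.
apply: integral_ae_eq => //.
- exact: Radon_Nikodym_SigmaFinite.f_integrable.
- by move=> E _ mE; rewrite -Radon_Nikodym_SigmaFinite.f_integral.
Qed.

Lemma integrable_normal_prob (f : R -> R) : measurable_fun setT f ->
  mu.-integrable setT (fun x => (f x * normal_pdf 0 s x)%:E) ->
  N.-integrable setT (EFin \o f).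
Proof.
move=> mf /integrableP[_ fi]; apply/integrableP; split.
  exact/measurable_EFinP.
rewrite ge0_integral_normal_prob//; last first.
  by apply: measurableT_comp => //; exact/measurable_EFinP.
move: fi; under eq_integral do
  rewrite /= normrM (ger0_norm (normal_pdf_ge0 _ _ _)) EFinM.
by [].
Qed.

Lemma Rintegral_normal_prob (f : R -> R) : N.-integrable setT (EFin \o f) ->
  \int[N]_x f x = \int[mu]_x (f x * normal_pdf 0 s x).
Proof.
move=> fi; rewrite /Rintegral; congr fine.
have mf := measurable_int _ fi.
rewrite [LHS]integralE ge0_integral_normal_prob//; last exact: measurable_funepos.
rewrite ge0_integral_normal_prob//; last exact: measurable_funeneg.
rewrite [RHS]integralE; congr (_ - _)%E; apply: eq_integral => x _.
- rewrite !funeposE -!EFin_max /=.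
  by rewrite -EFinM; congr EFin; rewrite maxr_pMl ?normal_pdf_ge0// mul0r.
- rewrite !funenegE -!EFinN -!EFin_max /=.
  rewrite -EFinM; congr EFin; rewrite maxr_pMl ?normal_pdf_ge0// mul0r.
  by rewrite mulNr.
Qed.

End normal_integral.

Lemma Rdominated_convergence {d} {T : measurableType d} {R : realType}
    (mu : {measure set T -> \bar R}) (f_ : nat -> T -> R) (f g : T -> R) :
  (forall n, measurable_fun setT (f_ n)) ->
  (forall x, f_ ^~ x @ \oo --> f x) ->
  mu.-integrable setT (EFin \o g) ->
  (forall n x, `|f_ n x| <= g x) ->
  mu.-integrable setT (EFin \o f) /\
  \int[mu]_x f_ n x @[n --> \oo] --> \int[mu]_x f x.
Proof.
move=> mf_ f_f ig f_g.
have mf : measurable_fun setT f.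
  apply/measurable_EFinP.
  apply: (emeasurable_fun_cvg (fun n => EFin \o f_ n)) => [n|x _].
    exact/measurable_EFinP.
  by apply/cvg_EFin; [exact: nearW|exact: f_f].
have [||||| i1 _ i2] := @dominated_convergence _ _ _ mu _ (@measurableT _ T)
  (fun n => EFin \o f_ n) (EFin \o f) (EFin \o g).
- by move=> n; exact/measurable_EFinP.
- exact/measurable_EFinP.
- by apply: aeW => x _ /=; apply/cvg_EFin; [exact: nearW|exact: f_f].
- by [].
- by apply: aeW => x n _ /=; rewrite lee_fin.
- split => //.
  apply/fine_cvg; rewrite fineK//; exact: integrable_fin_num.
Qed.

Section normal_moments.
Context (R : realType) (s : R) (s0 : 0 < s).
Local Notation mu := (@lebesgue_measure R).
Local Notation N := (normal_prob 0 s).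
Local Notation p := (normal_pdf 0 s).

(* With [y = 3/8 (x/s)^2], [x^4 = 64/9 s^4 y^2] and [y^2 <= 4 e^y]; the
   constant 58 >= 2 * 256/9 is crude. *)
Lemma normal_pdf_pow4 x : x ^+ 4 * p x <= 58 * s ^+ 4 * normal_pdf 0 (2 * s) x.
Proof.
rewrite !normal_pdfE ?mulf_neq0 ?pnatr_eq0 ?gt_eqF//.
have -> : normal_peak (2 * s) = normal_peak s / 2.
  rewrite /normal_peak (_ : (2 * s) ^+ 2 * pi *+ 2 = 2 ^+ 2 * (s ^+ 2 * pi *+ 2)).
    by rewrite sqrtrM ?sqr_ge0// sqrtr_sqr ger0_norm// invfM mulrC.
  by ring.
have -> : normal_fun 0 s x = normal_fun 0 (2 * s) x * expR (- (3 / 8 * (x / s) ^+ 2)).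
  rewrite /normal_fun -expRD; congr expR; rewrite !subr0.
  by field; rewrite gt_eqF.
set y := 3 / 8 * (x / s) ^+ 2.
have y0 : 0 <= y by rewrite mulr_ge0 ?sqr_ge0.
have xE : x ^+ 4 = 64 / 9 * s ^+ 4 * y ^+ 2.
  by rewrite /y; field; rewrite gt_eqF.
have ye : y ^+ 2 <= 4 * expR y.
  have : 1 + y / 2 <= expR (y / 2) by exact: expR_ge1Dx.
  have -> : expR y = expR (y / 2) ^+ 2 by rewrite -expRM_natl; congr expR; field.
  have := expR_gt0 (y / 2); nra.
have -> : 58 * s ^+ 4 * (normal_peak s / 2 * normal_fun 0 (2 * s) x) =
  (29 * s ^+ 4) * (normal_peak s * normal_fun 0 (2 * s) x) by field.
rewrite [leLHS](_ : _ = (x ^+ 4 * expR (- y)) * (normal_peak s * normal_fun 0 (2 * s) x)); last by ring.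
apply: ler_wpM2r; first by rewrite mulr_ge0 ?normal_peak_ge0 ?normal_fun_ge0.
rewrite expRN ler_pdivrMr ?expR_gt0// xE.
have := exprn_ge0 4 (ltW s0); have := expR_gt0 y.
move: ye; nra.
Qed.

(** By [normal_pdf_pow4] the density with standard deviation [2 * s] dominates [x ^+ 4 * p x], so
    growth of order four reduces to the integrability of two densities. *)
Lemma integrable_pow4_normal_pdf k (f : R -> R) : measurable_fun setT f ->
  (forall x, `|f x| <= k * (1 + x ^+ 4)) -> 
  mu.-integrable setT (fun x => (f x * p x)%:E).
Proof.
move=> mf fk.
have mp := measurable_normal_pdf 0 s.
have ig : mu.-integrable setT (EFin \o
   (fun x => `|k| * p x + `|k| * (58 * s ^+ 4) * normal_pdf 0 (2 * s) x)).
  rewrite (_ : EFin \o _ = (fun x => `|k|%:E * (p x)%:E)%E \+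
      (fun x => (`|k| * (58 * s ^+ 4))%:E * (normal_pdf 0 (2 * s) x)%:E)%E)//.
  by apply: integrableD => //; apply: integrableZl => //; exact: integrable_normal_pdf.
apply: (le_integrable _ _ _ ig) => //.
  by apply/measurable_EFinP; exact: measurable_funM.
move=> x _; rewrite /= lee_fin normrM (ger0_norm (normal_pdf_ge0 _ _ _)).
rewrite [leRHS]ger0_norm; last first.
  by rewrite addr_ge0// !mulr_ge0 ?exprn_ge0 ?normal_pdf_ge0// ltW.
apply: (@le_trans _ _ (`|k| * (1 + x ^+ 4) * p x)).
  apply: ler_wpM2r; first exact: normal_pdf_ge0.
  apply: (le_trans (fk x)); apply: ler_wpM2r; last exact: ler_norm.
  by rewrite addr_ge0// exprn_even_ge0.
have := normal_pdf_pow4 x; have := normr_ge0 k; nra.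
Qed.

Lemma integrable_normal_pow4 k (f : R -> R) : measurable_fun setT f ->
  (forall x, `|f x| <= k * (1 + x ^+ 4)) -> N.-integrable setT (EFin \o f).
Proof.
move=> mf fk; apply: integrable_normal_prob => //.
exact: integrable_pow4_normal_pdf fk.
Qed.

Lemma Rintegral_normal_pow4 : \int[N]_x (x ^+ 4) <= 58 * s ^+ 4.
Proof.
have m4 : measurable_fun setT (fun x : R => x ^+ 4) by exact: exprn_measurable.
have b4 (x : R) : `|x ^+ 4| <= 1 * (1 + x ^+ 4).
  by rewrite mul1r ger0_norm ?lerDr// exprn_even_ge0.
have -> : 58 * s ^+ 4 = \int[mu]_x (58 * s ^+ 4 * normal_pdf 0 (2 * s) x).
  rewrite RintegralZl//; last exact: integrable_normal_pdf.
  by rewrite /Rintegral integral_normal_pdf mulr1.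
rewrite Rintegral_normal_prob; last exact: integrable_normal_pow4 b4.
apply: le_Rintegral => //; last first.
- by move=> x _; exact: normal_pdf_pow4.
- rewrite (_ : EFin \o _ = (fun x => (58 * s ^+ 4)%:E * (normal_pdf 0 (2 * s) x)%:E)%E)//.
  by apply: integrableZl => //; exact: integrable_normal_pdf.
- exact: integrable_pow4_normal_pdf b4.
Qed.

End normal_moments.

Section stein.
Context (R : realType) (s : R) (s0 : 0 < s).
Local Notation mu := (@lebesgue_measure R).
Local Notation N := (normal_prob 0 s).
Local Notation p := (normal_pdf 0 s).

Lemma is_derive_normal_pdf (x : R) : is_derive x (1:R) p (- (x / s ^+ 2) * p x).
Proof.
rewrite normal_pdfE ?gt_eqF//.
rewrite (_ : - (x / s ^+ 2) * _ = normal_peak s *: (normal_fun 0 s x *: - (x / s ^+ 2))); last first.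
  by rewrite /GRing.scale/=; ring.
apply: is_deriveZ.
rewrite /normal_fun.
have -> : (fun x => expR (- (x - 0) ^+ 2 / (s ^+ 2 *+ 2))) =
   expR \o ((- (2 * s ^+ 2)^-1) \*: (@id R ^+ 2)).
  apply/funext => y /=; congr expR; rewrite /GRing.scale/= !fctE subr0.
  by field; rewrite gt_eqF.
have h : is_derive x (1:R) ((- (2 * s ^+ 2)^-1) \*: (@id R ^+ 2)) (- (x / s ^+ 2)).
  apply: is_derive_eq; rewrite /GRing.scale/= expr1; field; rewrite gt_eqF//.
apply: is_derive_eq; congr (_ * _); congr expR; rewrite /GRing.scale/= !fctE subr0.
rewrite [LHS](_ : _ = - (2 * s ^+ 2)^-1 * x ^+ 2)//.
by field; rewrite gt_eqF.
Qed.

(** Since [p' = - (x / s ^+ 2) * p], the function [- s ^+ 2 * (g * p)] is a primitive of the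
    difference of the two integrands. Its values at [- n.+1] and [n.+1] tend to 0, and dominated
    convergence carries the integrals between these points to the whole line. *)
Lemma stein_normal (C : R) (g g' : R -> R) :
  (forall x, is_derive x (1:R) g (g' x)) -> continuous g' ->
  (forall x, `|g x| <= C * (1 + `|x|)) ->
  (forall x, `|g' x| <= C * (1 + `|x|)) ->
  \int[N]_x (x * g x) = s ^+ 2 * \int[N]_x g' x.
Proof.
move=> dg cg' bg bg'.
have C0 : 0 <= C by have := le_trans (normr_ge0 _) (bg 0); rewrite normr0 addr0 mulr1.
have cg : continuous g.
  by move=> x; apply: differentiable_continuous; apply/derivable1_diffP; exact: ex_derive.
have mg : measurable_fun setT g by exact: continuous_measurable_fun.
have mg' : measurable_fun setT g' by exact: continuous_measurable_fun.
have b1 x : `|x * g x| <= (4 * C) * (1 + x ^+ 4).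
  rewrite normrM; have := bg x; have := normr_ge0 x; have := normr_ge0 (g x).
  have : x ^+ 4 = `|x| ^+ 4 by rewrite -normrX ger0_norm// exprn_even_ge0.
  move=> ->; set a := `|x|; set b := `|g x| => b0 a0 ba.
  apply: (le_trans (ler_wpM2l a0 ba)); rewrite mulrCA [4 * _]mulrC -mulrA ler_wpM2l//.
  have := sqr_ge0 (a ^+ 2 - 1); have := sqr_ge0 (a - 1); nra.
have b2 x : `|g' x| <= (4 * C) * (1 + x ^+ 4).
  have := bg' x; have := normr_ge0 x.
  have : x ^+ 4 = `|x| ^+ 4 by rewrite -normrX ger0_norm// exprn_even_ge0.
  move=> ->; set a := `|x|; set b := `|g' x| => a0 ba.
  apply: (le_trans ba); rewrite [4 * _]mulrC -mulrA ler_wpM2l//.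
  have := sqr_ge0 (a ^+ 2 - 1); have := sqr_ge0 (a - 1); nra.
have mx : measurable_fun setT (fun x : R => x * g x) by exact: measurable_funM.
rewrite Rintegral_normal_prob; last exact: (integrable_normal_pow4 s0 mx b1).
rewrite Rintegral_normal_prob; last exact: (integrable_normal_pow4 s0 mg' b2).
have i1 := integrable_pow4_normal_pdf s0 mx b1.
have i2 := integrable_pow4_normal_pdf s0 mg' b2.
rewrite -RintegralZl//.
apply/eqP; rewrite -subr_eq0 -RintegralB//; last exact: RintegrableZ.
pose f x := x * g x * p x - s ^+ 2 * (g' x * p x).
pose G x := - s ^+ 2 * (g x * p x).
have cp : continuous p by apply: continuous_normal_pdf; rewrite gt_eqF.
have dG (x : R) : is_derive x (1:R) G (f x).
  have dp := is_derive_normal_pdf x.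
  have dgx := dg x.
  rewrite (_ : f x = - s ^+ 2 *: (g x *: (- (x / s ^+ 2) * p x) + p x *: g' x)); last first.
    by rewrite /f /GRing.scale/=; field; rewrite gt_eqF.
  exact: is_deriveZ.
have cf : continuous f.
  move=> x; apply: cvgB.
    by apply: cvgM; [apply: cvgM; [exact: cvg_id|exact: cg]|exact: cp].
  by apply: cvgM; [exact: cvg_cst|apply: cvgM; [exact: cg'|exact: cp]].
have mf : measurable_fun setT f by exact: continuous_measurable_fun.
have if_ : mu.-integrable setT (EFin \o f).
  by apply: RintegrableB => //; exact: RintegrableZ.
have FTC n : \int[mu]_x (f \_ `[- n.+1%:R, n.+1%:R]) x = G n.+1%:R - G (- n.+1%:R).
  rewrite -Rintegral_mkcond /Rintegral (@continuous_FTC2 _ f G)//.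
  - by rewrite gtrN.
  - exact: continuous_subspaceT.
  - split; first by move=> x _; exact: ex_derive.
    + apply: cvg_at_right_filter.
      by apply: differentiable_continuous; apply/derivable1_diffP; exact: ex_derive.
    + apply: cvg_at_left_filter.
      by apply: differentiable_continuous; apply/derivable1_diffP; exact: ex_derive.
  - by move=> x _; rewrite derive1E derive_val.
have [] := @Rdominated_convergence _ _ _ mu (fun n => f \_ `[- n.+1%:R, n.+1%:R]) f (fun x => `|f x|).
- move=> n; apply/(measurable_restrictT _ _).1 => //.
  exact: measurable_funTS.
- move=> x; apply: cvg_near_cst; exists (Num.bound `|x|) => // n /= xn.
  rewrite patchE mem_set//= in_itv/= -ler_norml.
  by rewrite ltW// (lt_le_trans (archi_boundP (normr_ge0 x)))// ler_nat leqW.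
- exact: integrable_norm.
- move=> n x; rewrite patchE; case: ifP => //; by rewrite normr0.
move=> _; under eq_fun do rewrite FTC.
move=> h1; apply/eqP.
apply: (cvg_unique _ h1) => //.
(* Chosen so that [|G x| <= K / 2 / |x|] for [|x| >= 1], by [normal_pdf_pow4], the peak of the wider
   density and [a * (1 + a) <= 2 * a ^+ 4]; the two endpoints together then give [K / n.+1]. *)
pose K := 2 * (s ^+ 2 * C * 2 * (58 * s ^+ 4 * normal_peak (2 * s))).
have bG (x : R) : 1 <= `|x| -> `|G x| <= K / 2 / `|x|.
  move=> x1; rewrite ler_pdivlMr ?(lt_le_trans ltr01)//.
  have -> : `|G x| = s ^+ 2 * (`|g x| * p x).
    by rewrite /G !normrM normrN (ger0_norm (sqr_ge0 s)) (ger0_norm (normal_pdf_ge0 _ _ _)).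
  have := normal_pdf_pow4 s0 x; have := bg x.
  have : x ^+ 4 = `|x| ^+ 4 by rewrite -normrX ger0_norm// exprn_even_ge0.
  move=> -> ; set a := `|x| in x1 *.
  have := normal_pdf_ub 0 x (_ : 2 * s != 0); rewrite mulf_neq0 ?gt_eqF// => /(_ isT).
  have := normal_pdf_ge0 0 s x; have := normal_peak_ge0 (2 * s).
  set q := normal_pdf 0 (2 * s) x; set pk := normal_peak _; set P := p x.
  set b := `|g x| => pk0 P0 qp ba aP.
  have a4 : a * (1 + a) <= 2 * a ^+ 4.
    have a2 : 1 <= a ^+ 2 by nra.
    have a3 : a ^+ 2 <= a ^+ 4 by rewrite (_ : a ^+ 4 = a ^+ 2 * a ^+ 2); [nra|ring].
    nra.
  have -> : K / 2 = s ^+ 2 * (C * (2 * (58 * s ^+ 4 * pk))) by rewrite /K -/pk; field.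
  have -> : s ^+ 2 * (b * P) * a = s ^+ 2 * (b * P * a) by ring.
  apply: ler_wpM2l; first exact: sqr_ge0.
  have a0 : 0 <= a by rewrite (le_trans ler01).
  apply: (@le_trans _ _ (C * (1 + a) * P * a)).
    by rewrite !ler_wpM2r.
  rewrite -!mulrA ler_wpM2l//.
  apply: (@le_trans _ _ (2 * (a ^+ 4 * P))).
    rewrite [leLHS](_ : _ = P * (a * (1 + a))) ?[leRHS](_ : _ = P * (2 * a ^+ 4)); try ring.
    exact: ler_wpM2l.
  apply: ler_wpM2l => //; apply: (le_trans aP); rewrite !mulrA; apply: ler_wpM2l => //.
  by rewrite !mulr_ge0 ?exprn_ge0 ?ltW.
apply/cvgr0Pnorm_le => e e0; near=> n.
apply: (@le_trans _ _ (K * n.+1%:R^-1)).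
  rewrite (_ : K * _ = K / 2 / n.+1%:R + K / 2 / n.+1%:R); last by rewrite -mulrDl -splitr.
  apply: (le_trans (ler_normB _ _)); apply: lerD.
    by have := bG n.+1%:R; rewrite normr_nat ler1n; exact.
  by have := bG (- n.+1%:R); rewrite normrN normr_nat ler1n; exact.
near: n; have : K * n.+1%:R^-1 @[n --> \oo] --> K * 0.
  by apply: cvgMr; exact: cvg_harmonic.
rewrite mulr0 => /cvgr0Pnorm_le/(_ e e0); apply: filterS => n.
exact/le_trans/ler_norm.
Unshelve. all: by end_near. Qed.

End stein.

Section independent_pair.
Context d d' (T : measurableType d) (S : measurableType d') (R : realType).
Variables (P : probability T R) (X : {mfun T >-> R}) (Y : {mfun T >-> S}).
Variable mu : probability R R.
Hypothesis lawX : forall A, measurable A -> P (X @^-1` A) = mu A.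
Hypothesis indXY : forall A B, measurable A -> measurable B ->
  P (X @^-1` A `&` Y @^-1` B) = (P (X @^-1` A) * P (Y @^-1` B))%E.

Let XY (w : T) : R * S := (X w, Y w).
Let mXY : measurable_fun setT XY. Proof. exact: measurable_fun_pair. Qed.
HB.instance Definition _ := isMeasurableFun.Build _ _ _ _ XY mXY.

(** Independence makes the joint law the product of the marginals, by uniqueness on rectangles.
    Fubini is used with the integral in [x] innermost, so that one-dimensional identities apply with
    [y] frozen. *)
Lemma indep_Rintegral (f : R * S -> R) : measurable_fun setT f ->
  P.-integrable setT (EFin \o (fun w => f (X w, Y w))) ->
  \int[P]_w f (X w, Y w) =
  fine (\int[distribution P Y]_y (\int[mu]_x (f (x, y))%:E))%E.
Proof.
move=> mf fi; rewrite /Rintegral; congr fine.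
have mf' : measurable_fun setT (EFin \o f) by exact/measurable_EFinP.
have pi_eq (A : set (R * S)) : measurable A ->
    (mu \x distribution P Y)%E A = distribution P XY A.
  move=> mA; apply: product_measure_unique => // {A mA}A B mA mB.
  rewrite -[LHS]/(P (X @^-1` A `&` Y @^-1` B)) indXY// lawX//.
rewrite -[LHS](@integral_distribution _ _ _ _ _ P XY (EFin \o f))//.
rewrite (@eq_measure_integral _ _ _ _ (mu \x distribution P Y)%E); last first.
  by move=> A mA _; first [exact: pi_eq | exact/esym/pi_eq].
rewrite -(@integral21_prod_meas1 _ _ _ _ _ mu (distribution P Y) (EFin \o f))//.
have : (distribution P XY).-integrable setT (EFin \o f).
  by apply: integrable_pushforward.
move=> /integrableP[_ h]; apply/integrableP; split => //.
apply: le_lt_trans h; rewrite le_eqVlt; apply/orP; left; apply/eqP.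
by apply: eq_measure_integral => A mA _; first [exact: pi_eq | exact/esym/pi_eq].
Qed.

End independent_pair.

Section stein_indep.
Context {R : realType}.
(** Pushing [normal_prob] forward along this identity gives the same measure, typed as a probability
    on [R] as [indep_Rintegral] expects. *)
Let idTR : measurableTypeR R -> R := idfun.
#[local] HB.instance Definition _ :=
  @isMeasurableFun.Build _ _ _ _ idTR (@measurable_id _ _ setT).

Lemma ge0_integral_normal_law d (T : measurableType d) (P : probability T R)
    (X : {mfun T >-> R}) (s : R) (f : R -> \bar R) :
  (forall A, measurable A -> P (X @^-1` A) = normal_prob 0 s A) ->
  measurable_fun setT f -> (forall x, 0 <= f x)%E ->
  (\int[P]_w f (X w) = \int[normal_prob 0 s]_x f x)%E.
Proof.
move=> law mf f0; pose N' : probability R R := distribution (normal_prob 0 s) idTR.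
transitivity (\int[distribution P X]_x f x)%E.
  by rewrite ge0_integral_distribution.
transitivity (\int[N']_x f x)%E; last by rewrite ge0_integral_distribution.
by apply: eq_measure_integral => A mA _; exact: law.
Qed.

Lemma integrable_normal_law_pow4 d (T : measurableType d) (P : probability T R)
    (X : {mfun T >-> R}) (s : R) : 0 < s ->
  (forall A, measurable A -> P (X @^-1` A) = normal_prob 0 s A) ->
  P.-integrable setT (EFin \o (fun w => X w ^+ 4)) /\
  \int[P]_w (X w ^+ 4) <= 58 * s ^+ 4.
Proof.
move=> s0 law.
have m4 : measurable_fun setT (fun x : R => x ^+ 4) by exact: exprn_measurable.
have p4 (x : R) : 0 <= x ^+ 4 by rewrite exprn_even_ge0.
have b4 (x : R) : `|x ^+ 4| <= 1 * (1 + x ^+ 4) by rewrite mul1r ger0_norm ?lerDr.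
have i4 := integrable_normal_pow4 s0 m4 b4.
have mn : measurable_fun setT (fun x : R => (x ^+ 4)%:E) by exact/measurable_EFinP.
have E : (\int[P]_w (X w ^+ 4)%:E = \int[normal_prob 0 s]_x (x ^+ 4)%:E)%E.
  by rewrite -(ge0_integral_normal_law law mn)// => x; rewrite lee_fin.
split; last by rewrite /Rintegral E; exact: Rintegral_normal_pow4.
apply/integrableP; split; first by apply/measurable_EFinP; exact: (measurableT_comp m4).
under eq_integral do rewrite /= ger0_norm//.
rewrite E ltey_eq; apply/orP; left.
by have := integrable_fin_num measurableT i4.
Qed.

(** [stein_normal] holds for each frozen [y] and is integrated over the law of [Y]. The growth
    constant may depend on [y]; integrability is asked of the composed functions instead. *)
Lemma stein_indep d d' (T : measurableType d) (S : measurableType d')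
    (P : probability T R) (X : {mfun T >-> R})
    (Y : {mfun T >-> S}) (s : R) (s0 : 0 < s) (f f' : R * S -> R) (C : S -> R) :
  (forall A, measurable A -> P (X @^-1` A) = normal_prob 0 s A) ->
  (forall A B, measurable A -> measurable B ->
    P (X @^-1` A `&` Y @^-1` B) = (P (X @^-1` A) * P (Y @^-1` B))%E) ->
  measurable_fun setT f -> measurable_fun setT f' ->
  (forall y (x : R), is_derive x (1 : R) (fun x : R => f (x, y)) (f' (x, y))) ->
  (forall y, continuous (fun x : R => f' (x, y))) ->
  (forall y x, `|f (x, y)| <= C y * (1 + `|x|)) ->
  (forall y x, `|f' (x, y)| <= C y * (1 + `|x|)) ->
  P.-integrable setT (EFin \o (fun w => X w * f (X w, Y w))) ->
  P.-integrable setT (EFin \o (fun w => f' (X w, Y w))) ->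
  \int[P]_w (X w * f (X w, Y w)) = s ^+ 2 * \int[P]_w f' (X w, Y w).
Proof.
move=> lawX ind mf mf' df cf' bf bf' if1 if2.
have mX (y : S) (g : R * S -> R) : measurable_fun setT g ->
    measurable_fun setT (fun x : R => g (x, y)).
  by move=> mg; apply: measurableT_comp => //; exact: measurable_pair2.
pose N' : probability R R := distribution (normal_prob 0 s) idTR.
have NE (g : R -> R) : measurable_fun setT g ->
    (normal_prob 0 s).-integrable setT (EFin \o g) ->
    (\int[N']_x (g x)%:E = \int[normal_prob 0 s]_x (g x)%:E)%E.
  move=> mg ig; rewrite (@integral_distribution _ _ _ _ _ (normal_prob 0 s) idTR (EFin \o g))//.
  exact/measurable_EFinP.
pose f1 (z : R * S) := z.1 * f z.
have mf1 : measurable_fun setT f1 by apply: measurable_funM.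
rewrite (@indep_Rintegral _ _ _ _ _ P X Y N' lawX ind f1)//.
rewrite -RintegralZl//.
rewrite (@indep_Rintegral _ _ _ _ _ P X Y N' lawX ind
  (fun z => s ^+ 2 * f' z)) //; last 2 first.
- exact: measurable_funM.
- exact: RintegrableZ.
congr fine; apply: eq_integral => y _.
have b4 (x : R) : (1 + `|x|) * (1 + `|x|) <= 4 * (1 + x ^+ 4).
  have : x ^+ 4 = `|x| ^+ 4 by rewrite -normrX ger0_norm// exprn_even_ge0.
  move=> ->; set a := `|x|.
  have := sqr_ge0 (a ^+ 2 - 1); have := sqr_ge0 (a - 1); nra.
have C0 : 0 <= C y by have := le_trans (normr_ge0 _) (bf y 0); rewrite normr0 addr0 mulr1.
have i1 : (normal_prob 0 s).-integrable setT (EFin \o (fun x : R => f1 (x, y))).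
  apply: (@integrable_normal_pow4 _ _ s0 (4 * C y)); first exact: mX.
  move=> x; rewrite /f1/= normrM (mulrC 4) -mulrA.
  apply: (le_trans _ (ler_wpM2l C0 (b4 x))); rewrite mulrCA.
  by apply: ler_pM => //; rewrite lerDr.
have i2 : (normal_prob 0 s).-integrable setT (EFin \o (fun x : R => f' (x, y))).
  apply: (@integrable_normal_pow4 _ _ s0 (4 * C y)); first exact: mX.
  move=> x; apply: (le_trans (bf' y x)); rewrite (mulrC 4) -mulrA ler_wpM2l//.
  apply: le_trans (b4 x); rewrite ler_peMl// ?lerDl//.
have i3 := RintegrableZ (s ^+ 2) i2.
have m3 : measurable_fun setT (fun x : R => s ^+ 2 * f' (x, y)).
  by apply: measurable_funM => //; exact: mX.
rewrite (NE _ (mX y f1 mf1) i1) (NE _ m3 i3).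
rewrite -[LHS]fineK; last exact: integrable_fin_num.
rewrite -[RHS]fineK; last exact: integrable_fin_num.
congr EFin; rewrite -!/(Rintegral _ _ _) RintegralZl//.
exact: (stein_normal s0 (df y) (cf' y) (bf y) (bf' y)).
Qed.

End stein_indep.

(** * Stein's identity for independent normal variables *)

(* the derivative of [\prod_(m <- r) f m] when [f'] lists those of [f] *)
Fixpoint dprod (R : realType) (M : Type) (f f' : M -> R) (r : seq M) : R :=
  if r is m :: r' then f' m * \prod_(k <- r') f k + f m * dprod f f' r' else 0.

Lemma is_derive_prod_seq (R : realType) (M : Type) (f f' : M -> R -> R) (r : seq M) (x : R) :
  (forall m, is_derive x (1 : R) (f m) (f' m x)) ->
  is_derive x (1 : R) (fun y : R => \prod_(m <- r) f m y)
    (dprod (f^~ x) (f'^~ x) r).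
Proof.
move=> df; elim: r => [|m r IH] /=.
  rewrite (_ : (fun _ => _) = cst 1); first exact: is_derive_cst.
  by apply/funext => y; rewrite big_nil.
rewrite (_ : (fun _ => _) = f m * (fun y => \prod_(k <- r) f k y)); last first.
  by apply/funext => y; rewrite big_cons.
have dfm := df m.
by apply: is_derive_eq; rewrite /GRing.scale/=; ring.
Qed.

Lemma continuous_prod_seq (R : realType) (M : Type) (f : M -> R -> R) r :
  (forall m, continuous (f m)) -> continuous (fun x : R => \prod_(m <- r) f m x).
Proof.
by move=> cf; apply: (continuous_big (U := R^o)) => [|m _]; [exact: mul_continuous|exact: cf].
Qed.

Lemma continuous_dprod (R : realType) (M : Type) (f f' : M -> R -> R) r :
  (forall m, continuous (f m)) -> (forall m, continuous (f' m)) ->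
  continuous (fun x : R => dprod (f^~ x) (f'^~ x) r).
Proof.
move=> cf cf'; elim: r => [|m r IH] /= x; first exact: cvg_cst.
apply: cvgD; apply: cvgM => //; [exact: cf'| |exact: cf|exact: IH].
exact: continuous_prod_seq.
Qed.

Lemma measurable_dprod d (T : measurableType d) (R : realType) (M : eqType)
    (f f' : M -> T -> R) r :
  (forall m, measurable_fun setT (f m)) ->
  (forall m, measurable_fun setT (f' m)) ->
  measurable_fun setT (fun x => dprod (f^~ x) (f'^~ x) r).
Proof.
move=> mf mf'; elim: r => [|m r IH] /=; first exact: measurable_cst.
apply: measurable_funD; apply: measurable_funM => //.
by apply: measurable_prod.
Qed.

Section dprod_bounds.
Context (R : realType) (M : Type).
Implicit Type f : M -> R.

Lemma prod_seq_le1 f r : (forall m, `|f m| <= 1) -> `|\prod_(m <- r) f m| <= 1.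
Proof.
move=> f1; elim: r => [|m r IH]; first by rewrite big_nil normr1.
by rewrite big_cons normrM mulr_ile1.
Qed.

Lemma dprod_le f (f' : M -> R) C r : (forall m, `|f m| <= 1) -> (forall m, `|f' m| <= C) ->
  `|dprod f f' r| <= C *+ size r.
Proof.
move=> f1 fC; elim: r => [|m r IH] /=; first by rewrite normr0.
rewrite mulrS; apply: (le_trans (ler_normD _ _)); rewrite !normrM; apply: lerD.
  by rewrite (le_trans (ler_piMr _ (prod_seq_le1 _ f1)))//.
by rewrite (le_trans (ler_piMl _ (f1 m)))//.
Qed.

(** Contracts a gradient with a direction [a]: the directional derivative of a product is again a
    [dprod]. *)
Lemma dprod_lin (J : finType) (a : J -> R) f (f' : J -> M -> R) r :
  \sum_j a j * dprod f (f' j) r = dprod f (fun m => \sum_j a j * f' j m) r.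
Proof.
elim: r => [|m r IH] /=; first by rewrite big1// => j _; rewrite mulr0.
rewrite mulr_suml -IH mulr_sumr -big_split/=; apply: eq_bigr => j _.
by rewrite mulrDr mulrA; congr (_ + _); rewrite mulrCA.
Qed.

Lemma dprod0 f (f' : M -> R) r : (forall m, f' m = 0) -> dprod f f' r = 0.
Proof. by move=> f0; elim: r => [//|m r /= ->]; rewrite f0 mul0r mulr0 addr0. Qed.

End dprod_bounds.

Section indep_events.
Context d (T : measurableType d) (R : realType) (P : probability T R).
Variables (A : set T) (mA : measurable A).

Lemma indep_setC (B : set T) : measurable B ->
  P (A `&` B) = (P A * P B)%E -> P (A `&` ~` B) = (P A * P (~` B))%E.
Proof.
move=> mB IH; have mI : measurable (A `&` B) by exact: measurableI.
rewrite -setDE measureD//; last by rewrite ltey_eq fin_num_measure.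
transitivity (P A - P A * P B)%E; first by congr (_ - _)%E; exact: IH.
rewrite probability_setC//.
rewrite -(fineK (fin_num_measure P _ mA)) -(fineK (fin_num_measure P _ mB)).
by rewrite -EFinM -!EFinB -EFinM; congr EFin; ring.
Qed.

Lemma indep_bigcup (F : (set T)^nat) : (forall n, measurable (F n)) ->
  trivIset setT F -> (forall n, P (A `&` F n) = (P A * P (F n))%E) ->
  P (A `&` \bigcup_n F n) = (P A * P (\bigcup_n F n))%E.
Proof.
move=> mF tF IH; rewrite setI_bigcupr !measure_semi_bigcup//.
- rewrite -(fineK (fin_num_measure P _ mA)) -nneseriesZl//.
  by apply: eq_eseriesr => n _; rewrite fineK ?fin_num_measure//; exact: IH.
- exact: bigcup_measurable.
- by move=> n; exact: measurableI.
- exact: trivIset_setIl.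
- by apply: bigcup_measurable => n _; exact: measurableI.
Qed.

End indep_events.

Section gaussian_family.
Context d (T : measurableType d) (R : realType) (P : probability T R).
Context (J : finType) (xi : J -> {mfun T >-> R}) (s : R).
Hypothesis s0 : 0 < s.
Hypothesis law : forall j A, measurable A -> P (xi j @^-1` A) = normal_prob 0 s A.
Hypothesis ind : mutually_independent P
  (fun j => preimage_set_system setT (xi j) measurable).

(** Boxes that leave coordinate [j] free, a pi-system generating the sigma-algebra of the other
    coordinates. Keeping a factor [setT] at [j] lets the product formula over all of [J] apply as it
    stands. *)
Definition others (j : J) : set (set T) :=
  [set A | exists B : J -> set R,
    [/\ forall k, measurable (B k), B j = setT & A = \bigcap_(k in [set: J]) xi k @^-1` B k]].

Lemma others_setI j : setI_closed (others j).
Proof.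
move=> A A' [B [mB Bj ->]] [B' [mB' B'j ->]]; exists (fun k => B k `&` B' k); split.
- by move=> k; exact: measurableI.
- by rewrite Bj B'j setIT.
- by rewrite -bigcapI; apply: eq_bigcapr.
Qed.

Lemma ind_prod (B : J -> set R) : (forall k, measurable (B k)) ->
  P (\bigcap_(k in [set: J]) xi k @^-1` B k) = (\prod_k P (xi k @^-1` B k))%E.
Proof.
by move=> mB; apply: ind => k; exists (B k) => //; rewrite setTI.
Qed.

Lemma measurable_others j A : <<s others j >> A -> measurable A.
Proof.
apply: smallest_sub; first exact: sigma_algebra_measurable.
move=> _ [B [mB _ ->]]; apply: fin_bigcap_measurable => // k _.
by rewrite -[X in measurable X]setTI; exact: measurable_funPT.
Qed.

(** Placing [A] in the free slot of a box gives a box again, to which the product formula applies;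
    Dynkin's theorem extends this from boxes to the sigma-algebra that they generate. *)
Lemma ind_others j (A : set R) (B : set T) : measurable A -> <<s others j >> B ->
  P (xi j @^-1` A `&` B) = (P (xi j @^-1` A) * P B)%E.
Proof.
move=> mA; have mxA : measurable (xi j @^-1` A).
  by rewrite -[X in measurable X]setTI; exact: measurable_funPT.
apply: (@dynkin_induction _ (g_sigma_algebraType (others j)) (others j)
  (fun B => P (xi j @^-1` A `&` B) = (P (xi j @^-1` A) * P B)%E)) => //.
- exact: others_setI.
- by rewrite setIT probability_setT mule1.
- move=> _ [C [mC Cj ->]].
  pose C' k := if k == j then A else C k.
  rewrite (_ : _ `&` _ = \bigcap_(k in [set: J]) xi k @^-1` C' k); last first.
    apply/seteqP; split=> [w [Aw Cw] k _|w Cw]; rewrite /C' /=.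
      by case: eqP => [->//|_]; exact: Cw.
    split; first by have := Cw j I; rewrite /C' /= eqxx.
    move=> k _; have := Cw k I; rewrite /C' /=; case: eqP => // -> _.
    by rewrite Cj.
  rewrite !ind_prod//; last by move=> k; rewrite /C'; case: ifP.
  rewrite (bigD1 j)//= [in RHS](bigD1 j)//= Cj preimage_setT probability_setT mul1e.
  rewrite {1}/C' eqxx; congr (_ * _)%E; apply: eq_bigr => k kj.
  by rewrite /C' (negbTE kj).
- by move=> S mS; apply: indep_setC => //; exact: measurable_others mS.
- move=> F mF tF IH; exact: (indep_bigcup mxA (fun n => measurable_others (mF n)) tF IH).
Qed.

Lemma integrable_xi_pow4 j : P.-integrable setT (EFin \o (fun w => xi j w ^+ 4)).
Proof. exact: (integrable_normal_law_pow4 s0 (law j)).1. Qed.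

Lemma integrable_xi2 j k : P.-integrable setT (EFin \o (fun w => xi j w * xi k w)).
Proof.
have i1 : P.-integrable setT (EFin \o (fun w => 1 + (xi j w ^+ 4 + xi k w ^+ 4))).
  apply: RintegrableD; last by apply: RintegrableD; exact: integrable_xi_pow4.
  exact: finite_measure_integrable_cst.
apply: le_Rintegrable i1; first exact: measurable_funM.
move=> w; rewrite ler_norml.
set x := xi j w; set y := xi k w.
have := sqr_ge0 (x + y); have := sqr_ge0 (x - y).
have := sqr_ge0 (x ^+ 2 - 1); have := sqr_ge0 (y ^+ 2 - 1).
by move=> *; apply/andP; split; nra.
Qed.

Lemma integrable_xi j : P.-integrable setT (EFin \o (fun w => xi j w)).
Proof.
have i1 : P.-integrable setT (EFin \o (fun w => 1 + xi j w * xi j w)).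
  apply: RintegrableD; last exact: integrable_xi2.
  exact: finite_measure_integrable_cst.
apply: le_Rintegrable i1; first by [].
move=> w; rewrite ler_norml; set x := xi j w.
have := sqr_ge0 (x + 1); have := sqr_ge0 (x - 1).
by move=> *; apply/andP; split; nra.
Qed.

Definition lin (b : J -> R) (w : T) : R := \sum_j b j * xi j w.

Lemma measurable_lin b : measurable_fun setT (lin b).
Proof. by apply: measurable_sum => j; exact: measurable_funM. Qed.

Lemma integrable_lin b : P.-integrable setT (EFin \o lin b).
Proof.
by apply: Rintegrable_sum => j _; apply: RintegrableZ; exact: integrable_xi.
Qed.

Lemma integrable_xi_lin j b :
  P.-integrable setT (EFin \o (fun w => xi j w * lin b w)).
Proof.
rewrite (_ : (fun w => _) = (fun w => \sum_k b k * (xi j w * xi k w))).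
  by apply: Rintegrable_sum => k _; apply: RintegrableZ; exact: integrable_xi2.
apply/funext => w; rewrite /lin mulr_sumr; apply: eq_bigr => k _.
by rewrite mulrCA.
Qed.

Lemma integrable_lin2 a b : P.-integrable setT (EFin \o (fun w => lin a w * lin b w)).
Proof.
rewrite (_ : (fun w => _) = (fun w => \sum_j a j * (xi j w * lin b w))).
  by apply: Rintegrable_sum => j _; apply: RintegrableZ; exact: integrable_xi_lin.
apply/funext => w; rewrite {1}/lin mulr_suml; apply: eq_bigr => j _.
by rewrite mulrA.
Qed.

Section test_product.
Context (M : finType) (phi phi' : M -> R -> R) (C : R) (v : M -> J -> R).
Hypothesis dphi : forall m (x : R), is_derive x (1 : R) (phi m) (phi' m x).
Hypothesis cphi' : forall m, continuous (phi' m).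
Hypothesis phi1 : forall m x, `|phi m x| <= 1.
Hypothesis phiC : forall m x, `|phi' m x| <= C.

Let F (w : T) : R := \prod_m phi m (lin (v m) w).
Let dF j (w : T) : R := dprod (fun m => phi m (lin (v m) w))
  (fun m => v m j * phi' m (lin (v m) w)) (index_enum M).

(** [stein_indep] with [X := xi j] and [Y] the identity of [T], where the target carries the
    sigma-algebra of the other coordinates. A linear form is thus split into [c j * z.1] and a part
    read at the point [z.2], with no need to map to a product of the remaining coordinates. *)
Lemma stein_coord j b : \int[P]_w (xi j w * (lin b w * F w)) =
  s ^+ 2 * \int[P]_w (b j * F w + lin b w * dF j w).
Proof.
pose S := g_sigma_algebraType (others j).
pose Y : T -> S := id.
have mY : measurable_fun setT Y.
  by move=> _ A mA; rewrite setTI; exact: measurable_others mA.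
pose Ym : {mfun T >-> S} := HB.pack Y (isMeasurableFun.Build _ _ _ _ Y mY).
have mxi k : k != j -> measurable_fun setT (xi k : S -> R).
  move=> kj _ A mA; rewrite setTI; apply: sub_gen_smallest.
  exists (fun l => if l == k then A else setT); split.
  - by move=> l; case: ifP.
  - by rewrite eq_sym (negbTE kj).
  - apply/seteqP; split => [w Aw l _|w /(_ k I)]; rewrite /= ?eqxx//.
    by case: eqP => // ->.
pose linx (c : J -> R) (z : R * S) := c j * z.1 + \sum_(k | k != j) c k * xi k z.2.
have linE c w : lin c w = linx c (xi j w, w).
  by rewrite /lin (bigD1 j).
have mlinx c : measurable_fun setT (linx c).
  apply: measurable_funD; first exact: measurable_funM.
  rewrite (_ : (fun _ => _) = (fun z : R * S => \sum_(k <- index_enum J) if k != j then c k * xi k z.2 else 0)).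
    apply: measurable_sum => k; case kj: (k != j) => //.
    apply: measurable_funM => //; apply: (measurableT_comp (mxi k kj)).
    exact: measurable_snd.
  by apply/funext => z; rewrite big_mkcond.
have dlinx c y (x : R) : is_derive x (1 : R) (fun x => linx c (x, y)) (c j).
  rewrite (_ : (fun x => _) = (c j \*: id) + cst (\sum_(k | k != j) c k * xi k y)).
    by apply: is_derive_eq; rewrite /GRing.scale/= mulr1 addr0.
  by apply/funext => z.
have clinx c y : continuous (fun x : R => linx c (x, y)).
  move=> x; apply: differentiable_continuous; apply/derivable1_diffP.
  by have := dlinx c y x => ?; exact: ex_derive.
have cphi m : continuous (phi m).
  by move=> x; apply: differentiable_continuous; apply/derivable1_diffP; exact: ex_derive.
pose fm m (z : R * S) := phi m (linx (v m) z).
pose fm' m (z : R * S) := v m j * phi' m (linx (v m) z).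
have mfm m : measurable_fun setT (fm m).
  by apply: measurableT_comp => //; exact: continuous_measurable_fun.
have mfm' m : measurable_fun setT (fm' m).
  apply: measurable_funM => //; apply: measurableT_comp => //.
  exact: continuous_measurable_fun.
pose f z := linx b z * \prod_m fm m z.
pose f' z := b j * \prod_m fm m z + linx b z * dprod (fm^~ z) (fm'^~ z) (index_enum M).
have mprod : measurable_fun setT (fun z => \prod_m fm m z) by apply: measurable_prod.
have mdprod : measurable_fun setT (fun z => dprod (fm^~ z) (fm'^~ z) (index_enum M)).
  exact: measurable_dprod.
have mf : measurable_fun setT f by exact: measurable_funM.
have mf' : measurable_fun setT f'.
  by apply: measurable_funD; apply: measurable_funM.
pose D := ((\sum_m `|v m j|) * `|C|) *+ size (index_enum M).
have bprod z : `|\prod_m fm m z| <= 1 by apply: prod_seq_le1 => m; exact: phi1.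
have bdprod z : `|dprod (fm^~ z) (fm'^~ z) (index_enum M)| <= D.
  apply: dprod_le => m; first exact: phi1.
  rewrite normrM ler_pM//; last by rewrite (le_trans (phiC m _))// ler_norm.
  by rewrite (bigD1 m)//= lerDl sumr_ge0.
pose K y := `|b j| + `|\sum_(k | k != j) b k * xi k y|.
have blin y x : `|linx b (x, y)| <= K y * (1 + `|x|).
  rewrite /linx /K/= (le_trans (ler_normD _ _))// normrM.
  set B := `|b j|; set B' := `|\sum_(_ | _) _|.
  have : 0 <= B by exact: normr_ge0.
  have : 0 <= B' by exact: normr_ge0.
  have := normr_ge0 x; nra.
have K0 y : 0 <= K y by rewrite addr_ge0.
have D0 : 0 <= D by rewrite mulrn_wge0// mulr_ge0// sumr_ge0.
have H1 : P.-integrable setT (EFin \o (fun w => xi j w * f (xi j w, w))).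
  rewrite (_ : (fun w => _) = (fun w => (xi j w * lin b w) * F w)).
    apply: (@RintegrableM_bounded _ _ _ _ 1); first exact: integrable_xi_lin.
      apply: measurable_prod => m _; apply: measurableT_comp; last exact: measurable_lin.
      exact: continuous_measurable_fun.
    by move=> w; apply: prod_seq_le1.
  apply/funext => w; rewrite /f -linE mulrA; congr (_ * _).
  by apply: eq_bigr => m _; rewrite /fm -linE.
have FE w : F w = \prod_m fm m (xi j w, w).
  by apply: eq_bigr => m _; rewrite /fm -linE.
have dFE w : dF j w = dprod (fm^~ (xi j w, w)) (fm'^~ (xi j w, w)) (index_enum M).
  rewrite /dF; congr dprod; apply/funext => m; first by rewrite /fm -linE.
  by rewrite /fm' -linE.
have f'E w : f' (xi j w, w) = b j * F w + lin b w * dF j w.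
  by rewrite /f' -linE FE dFE.
have mF : measurable_fun setT F.
  apply: measurable_prod => m _; apply: measurableT_comp; last exact: measurable_lin.
  exact: continuous_measurable_fun.
have mdF : measurable_fun setT (dF j).
  apply: (measurable_dprod (f := fun m w => phi m (lin (v m) w))
    (f' := fun m w => v m j * phi' m (lin (v m) w))) => m.
    apply: measurableT_comp; last exact: measurable_lin.
    exact: continuous_measurable_fun.
  apply: measurable_funM => //; apply: measurableT_comp; last exact: measurable_lin.
  exact: continuous_measurable_fun.
have H2 : P.-integrable setT (EFin \o (fun w => f' (xi j w, w))).
  rewrite (_ : (fun w => _) = (fun w => b j * F w + lin b w * dF j w)); last first.
    by apply/funext => w; exact: f'E.
  apply: RintegrableD.
    apply: (@RintegrableM_bounded _ _ _ _ 1) => //.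
      exact: finite_measure_integrable_cst.
    by move=> w; rewrite FE.
  apply: (@RintegrableM_bounded _ _ _ _ D) => //; first exact: integrable_lin.
  by move=> w; rewrite dFE.
transitivity (\int[P]_w (xi j w * f (xi j w, w))).
  by apply: eq_Rintegral => w _; rewrite /f -linE FE.
transitivity (s ^+ 2 * \int[P]_w (f' (xi j w, w))); last first.
  by congr (_ * _); apply: eq_Rintegral => w _; rewrite f'E.
(* One growth constant for both functions: [f] needs [K y], and [f'] needs [|b j| + K y * D]. *)
apply: (@stein_indep _ _ _ _ _ P (xi j) Ym s s0 f f' (fun y => `|b j| + K y * (1 + D))) => //.
- exact: law.
- by move=> A B mA mB; apply: ind_others.
- move=> y x.
  rewrite (_ : (fun x => _) = (fun x => linx b (x, y)) * (fun x => \prod_m fm m (x, y)))//.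
  have d1 := dlinx b y x.
  have d2 : is_derive x (1 : R) (fun x => \prod_m fm m (x, y))
      (dprod (fm^~ (x, y)) (fm'^~ (x, y)) (index_enum M)).
    apply: (@is_derive_prod_seq _ _ (fun m x => fm m (x, y)) (fun m x => fm' m (x, y))) => m.
    have dm := dlinx (v m) y x.
    rewrite /fm' mulrC; exact: is_derive1_comp.
  apply: is_derive_eq; rewrite /GRing.scale/= /f'; ring.
- move=> y x; apply: cvgD.
    apply: cvgM; first exact: cvg_cst.
    apply: (continuous_prod_seq (f := fun m x => fm m (x, y))) => m x'.
    by apply: continuous_comp; [exact: clinx|exact: cphi].
  apply: cvgM; first exact: clinx.
  apply: (@continuous_dprod _ _ (fun m x => fm m (x, y)) (fun m x => fm' m (x, y))) => m x'.
    apply: continuous_comp; [exact: clinx|exact: cphi].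
  apply: cvgM; first exact: cvg_cst.
  by apply: continuous_comp; [exact: clinx|exact: cphi'].
- move=> y x; rewrite /f normrM.
  apply: (@le_trans _ _ (K y * (1 + `|x|))).
    by rewrite -[leRHS]mulr1 ler_pM.
  apply: ler_wpM2r; first by rewrite addr_ge0.
  apply: (@le_trans _ _ (K y * (1 + D))); last by rewrite lerDr.
  by rewrite ler_peMr// lerDl.
- move=> y x; rewrite /f' (mulrDl `|b j|); apply: (le_trans (ler_normD _ _)).
  apply: lerD; rewrite normrM.
    by apply: ler_pM => //; apply: (le_trans (bprod _)); rewrite lerDl.
  rewrite mulrAC; apply: ler_pM => //; apply: (le_trans (bdprod _)).
  by rewrite lerDr.
Qed.

(** Summing [stein_coord] with weights [a j] produces the derivative of [F] in direction [a]. Its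
    factors are [(\sum_j a j * v m j) * phi' m], all zero by hypothesis, so only the inner product
    of [a] and [b] survives. *)
Lemma stein_lin (a b : J -> R) :
  (forall m, \sum_j a j * v m j = 0 \/ forall x, phi' m x = 0) ->
  \int[P]_w (lin a w * (lin b w * F w)) =
  s ^+ 2 * (\sum_j a j * b j) * \int[P]_w F w.
Proof.
move=> av.
have cphi m : continuous (phi m).
  by move=> x; apply: differentiable_continuous; apply/derivable1_diffP; exact: ex_derive.
have mphi m c : measurable_fun setT (fun w => phi m (lin c w)).
  apply: measurableT_comp; last exact: measurable_lin.
  exact: continuous_measurable_fun.
have mF : measurable_fun setT F by apply: measurable_prod => m _; exact: mphi.
have bF w : `|F w| <= 1 by apply: prod_seq_le1.
have mdF j : measurable_fun setT (dF j).
  apply: (measurable_dprod (f := fun m w => phi m (lin (v m) w))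
    (f' := fun m w => v m j * phi' m (lin (v m) w))) => m //.
  apply: measurable_funM => //; apply: measurableT_comp; last exact: measurable_lin.
  exact: continuous_measurable_fun.
have bdF j w : `|dF j w| <= ((\sum_m `|v m j|) * `|C|) *+ size (index_enum M).
  apply: dprod_le => m //.
  rewrite normrM ler_pM//; last by rewrite (le_trans (phiC m _))// ler_norm.
  by rewrite (bigD1 m)//= lerDl sumr_ge0.
have iF : P.-integrable setT (EFin \o F).
  rewrite (_ : F = fun w => 1 * F w); last by apply/funext => w; rewrite mul1r.
  apply: (@RintegrableM_bounded _ _ _ _ 1 (cst 1)) => //.
  exact: finite_measure_integrable_cst.
have ilF j : P.-integrable setT (EFin \o (fun w => lin b w * dF j w)).
  by apply: (RintegrableM_bounded (integrable_lin b) (mdF j) (bdF j)).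
have ix j : P.-integrable setT (EFin \o (fun w => xi j w * (lin b w * F w))).
  rewrite (_ : (fun w => _) = fun w => xi j w * lin b w * F w); last first.
    by apply/funext => w; rewrite mulrA.
  exact: (RintegrableM_bounded (integrable_xi_lin j b) mF bF).
transitivity (\int[P]_w (\sum_j a j * (xi j w * (lin b w * F w)))).
  apply: eq_Rintegral => w _; rewrite {1}/lin mulr_suml.
  by apply: eq_bigr => j _; rewrite -mulrA.
rewrite Rintegral_sum; last by move=> j _; apply: RintegrableZ.
transitivity (\sum_j a j * (s ^+ 2 * \int[P]_w (b j * F w + lin b w * dF j w))).
  by apply: eq_bigr => j _; rewrite RintegralZl// stein_coord.
have iD j : P.-integrable setT (EFin \o (fun w => b j * F w + lin b w * dF j w)).
  by apply: RintegrableD => //; exact: RintegrableZ.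
transitivity (\int[P]_w (s ^+ 2 * (\sum_j a j * (b j * F w + lin b w * dF j w)))).
  rewrite RintegralZl//; last by apply: Rintegrable_sum => j _; exact: RintegrableZ.
  rewrite Rintegral_sum; last by move=> j _; exact: RintegrableZ.
  rewrite mulr_sumr; apply: eq_bigr => j _.
  by rewrite RintegralZl// mulrCA.
rewrite -[RHS]RintegralZl//; apply: eq_Rintegral => w _.
rewrite -mulrA; congr (_ * _).
transitivity ((\sum_j a j * b j) * F w + lin b w * \sum_j a j * dF j w).
  rewrite mulr_suml mulr_sumr -big_split/=; apply: eq_bigr => j _; ring.
rewrite dprod_lin dprod0 ?mulr0 ?addr0// => m.
under eq_bigr do rewrite mulrA.
rewrite -mulr_suml; have [->|->] := av m; first by rewrite mul0r.
by rewrite mulr0.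
Qed.
End test_product.
End gaussian_family.

(** * Bounded second moments and smooth test functions *)

Lemma limn_einf_le_cst {R : realType} (u : (\bar R)^nat) (C : \bar R) :
  (forall n, u n <= C)%E -> (limn_einf u <= C)%E.
Proof.
move=> uC; rewrite limn_einf_lim; apply: lime_le; first exact: is_cvg_einfs.
apply: nearW => n; apply: (le_trans _ (uC n)).
by apply: ereal_inf_lbound; exists n => /=.
Qed.

Section bounded_L2.
Context d (T : measurableType d) (R : realType) (P : probability T R).
Variables (X_ : nat -> T -> R) (X : T -> R) (C : R).
Hypothesis mX_ : forall n, measurable_fun setT (X_ n).
Hypothesis X_X : forall w, X_ ^~ w @ \oo --> X w.
Hypothesis iX_ : forall n, P.-integrable setT (EFin \o (fun w => X_ n w ^+ 2)).
Hypothesis X_C : forall n, \int[P]_w (X_ n w ^+ 2) <= C.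

Let mX : measurable_fun setT X.
Proof. by apply: (measurable_fun_cvg _ (h := X_)) => // w _; exact: X_X. Qed.

(** Fatou's lemma carries the bound on second moments to the pointwise limit. *)
Let sqrX : P.-integrable setT (EFin \o (fun w => X w ^+ 2)) /\
  \int[P]_w (X w ^+ 2) <= C.
Proof.
have H : (\int[P]_w (X w ^+ 2)%:E <= C%:E)%E.
  have := @fatou _ _ _ P setT measurableT (fun n w => (X_ n w ^+ 2)%:E).
  move=> /(_ _ _)/le_trans; rewrite (@eq_integral _ _ _ P setT (fun w => (X w ^+ 2)%:E)); last first.
    move=> w _; apply: (cvg_limn_einf_sup _).1.
    apply: cvg_EFin; first exact: nearW.
    by rewrite expr2; under eq_fun do rewrite expr2; apply: cvgM; exact: X_X.
  apply.
  - by move=> n; apply/measurable_EFinP; exact: measurable_funX.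
  - by move=> n w _; rewrite lee_fin sqr_ge0.
  apply: limn_einf_le_cst => n.
  have fn := integrable_fin_num measurableT (iX_ n).
  by rewrite -(fineK fn) lee_fin; exact: X_C.
have H2 : P.-integrable setT (EFin \o (fun w => X w ^+ 2)).
  apply/integrableP; split; first by apply/measurable_EFinP; exact: measurable_funX.
  under eq_integral do rewrite /= ger0_norm ?sqr_ge0//.
  by rewrite (le_lt_trans H)// ltry.
split => //; rewrite -lee_fin /Rintegral fineK//.
exact: integrable_fin_num.
Qed.

Let int1 (f : T -> R) : measurable_fun setT f ->
  P.-integrable setT (EFin \o (fun w => f w ^+ 2)) -> P.-integrable setT (EFin \o f).
Proof.
move=> mf if2.
have i1 : P.-integrable setT (EFin \o (fun w => 1 + f w ^+ 2)).
  by apply: RintegrableD => //; exact: finite_measure_integrable_cst.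
apply: le_Rintegrable i1 => // w.
rewrite ler_norml; set x := f w.
have := sqr_ge0 (x + 1); have := sqr_ge0 (x - 1).
by move=> *; apply/andP; split; nra.
Qed.

(* A bounded continuous truncation: [|x - psi c x| <= x^2 / c] turns the second
   moment bound into uniform integrability. *)
Let psi (c x : R) := c * x / (c + `|x|).

Let psi_le (c x : R) : 0 < c -> `|psi c x| <= c.
Proof.
move=> c0; have h : 0 < c + `|x| by rewrite ltr_wpDr.
rewrite /psi normrM normfV (ger0_norm (ltW h)) ler_pdivrMr// normrM (ger0_norm (ltW c0)).
by rewrite ler_wpM2l ?(ltW c0)// lerDr ltW.
Qed.

Let psi_dist (c x : R) : 0 < c -> `|x - psi c x| <= x ^+ 2 / c.
Proof.
move=> c0; have h : 0 < c + `|x| by rewrite ltr_wpDr.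
rewrite (_ : x - _ = x * (`|x| / (c + `|x|))); last by rewrite /psi; field; rewrite gt_eqF.
rewrite normrM normrM normr_id normfV (ger0_norm (ltW h)) mulrA -expr2 real_normK ?num_real//.
by rewrite ler_wpM2l ?sqr_ge0// lef_pV2 ?posrE// lerDl.
Qed.

Let psi_cvg (c : R) w : 0 < c -> psi c (X_ n w) @[n --> \oo] --> psi c (X w).
Proof.
move=> c0; apply: cvgM; first by apply: cvgM; [exact: cvg_cst|exact: X_X].
apply: cvgV; first by rewrite gt_eqF// ltr_wpDr.
by apply: cvgD; [exact: cvg_cst|apply: cvg_norm; exact: X_X].
Qed.

Let mpsi (c : R) (f : T -> R) : 0 < c -> measurable_fun setT f ->
  measurable_fun setT (fun w => psi c (f w)).
Proof.
move=> c0 mf; apply: (measurableT_comp _ mf).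
apply: continuous_measurable_fun => x; apply: cvgM.
  by apply: cvgM; [exact: cvg_cst|exact: cvg_id].
apply: cvgV; first by rewrite gt_eqF// ltr_wpDr.
by apply: cvgD; [exact: cvg_cst|exact: norm_continuous].
Qed.

Let psi_int (c : R) (f : T -> R) : 0 < c -> measurable_fun setT f ->
  P.-integrable setT (EFin \o (fun w => f w ^+ 2)) -> \int[P]_w (f w ^+ 2) <= C ->
  `|\int[P]_w f w - \int[P]_w psi c (f w)| <= C / c.
Proof.
move=> c0 mf if2 fC.
have ipsi : P.-integrable setT (EFin \o (fun w => psi c (f w))).
  apply: (@le_Rintegrable _ _ _ _ _ (cst c)); first exact: mpsi.
    by move=> w; exact: psi_le.
  exact: finite_measure_integrable_cst.
have fi := int1 mf if2.
rewrite -RintegralB//.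
apply: (le_trans (le_normr_Rintegral _ _)) => //; first exact: RintegrableB.
apply: (@le_trans _ _ (\int[P]_w (f w ^+ 2 / c))).
  apply: le_Rintegral => //.
  - by apply: integrable_norm; exact: RintegrableB.
  - under eq_fun do rewrite mulrC; exact: RintegrableZ.
  - by move=> w _; exact: psi_dist.
under eq_Rintegral do rewrite mulrC.
by rewrite RintegralZl// mulrC ler_wpM2r// invr_ge0 ltW.
Qed.

Lemma bounded_L2_integrable : P.-integrable setT (EFin \o X).
Proof. exact: int1 mX (sqrX.1). Qed.

(** The truncated variables converge by dominated convergence, and truncation costs at most [C / c],
    uniformly in [n] and also for the limit. *)
Lemma bounded_L2_cvg : \int[P]_w X_ n w @[n --> \oo] --> \int[P]_w X w.
Proof.
have C0 : 0 <= C by apply: le_trans (X_C 0); apply: Rintegral_ge0 => w _; exact: sqr_ge0.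
apply/cvgrPdist_le => e e0.
(* Each of the two truncation errors is then at most [e / 4], which leaves [e / 2] for the truncated
   integrals; [C + 1] keeps [c] positive when [C = 0]. *)
pose c := 4 * (C + 1) / e.
have c0 : 0 < c by rewrite divr_gt0// mulr_gt0// ltr_wpDl.
have [_ /cvgrPdist_le/(_ (e / 2))] := @Rdominated_convergence _ _ _ P
  (fun n w => psi c (X_ n w)) (fun w => psi c (X w)) (cst c)
  (fun n => mpsi c0 (mX_ n)) (fun w => @psi_cvg c w c0)
  (finite_measure_integrable_cst _ _ measurableT) (fun n w => @psi_le c _ c0).
rewrite divr_gt0// => /(_ isT); apply: filterS => n h.
have h1 := psi_int c0 mX sqrX.1 sqrX.2.
have h2 := psi_int c0 (mX_ n) (iX_ n) (X_C n).
have Cc : C / c <= e / 4.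
  rewrite /c ler_pdivrMr// (_ : e / 4 * _ = C + 1); last by field; rewrite gt_eqF.
  by rewrite lerDl.
set a := Rintegral _ _ X in h1 *; set b := Rintegral _ _ (X_ n) in h2 *.
set a' := Rintegral _ _ _ in h h1; set b' := Rintegral _ _ _ in h h2.
rewrite (_ : a - b = (a - a') + (a' - b') - (b - b')); last by ring.
apply: (le_trans (ler_normB _ _)); apply: (le_trans (lerD (ler_normD _ _) (lexx _))).
by move: h h1 h2 Cc; lra.
Qed.

End bounded_L2.

Section smooth_step.
Context (R : realType).
Implicit Types c x : R.

(* a smooth function of [x] that tends to the indicator of [c < x] as
   [n] tends to infinity, also at [x = c] *)
Definition step (n : nat) c x : R := (1 + expR (n%:R ^+ 2 * (c - x) + n%:R))^-1.

Definition step' (n : nat) c x : R :=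
  n%:R ^+ 2 * (expR (n%:R ^+ 2 * (c - x) + n%:R) * step n c x ^+ 2).

Let den_gt0 (e : R) : 0 < 1 + expR e.
Proof. by rewrite ltr_wpDr// expR_ge0. Qed.

Lemma step_ge0 n c x : 0 <= step n c x.
Proof. by rewrite invr_ge0 ltW. Qed.

Lemma step_le1 n c x : `|step n c x| <= 1.
Proof.
rewrite ger0_norm ?step_ge0// /step invf_le1//.
by rewrite lerDl expR_ge0.
Qed.

Lemma step'_le n c x : `|step' n c x| <= n%:R ^+ 2.
Proof.
rewrite /step' normrM ger0_norm ?sqr_ge0//; apply: ler_piMr; first exact: sqr_ge0.
have s0 := step_ge0 n c x.
rewrite ger0_norm ?mulr_ge0 ?expR_ge0 ?sqr_ge0// /step.
set e := expR _; have e0 : 0 <= e by exact: expR_ge0.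
rewrite exprVn ler_pdivrMr ?mul1r; last by rewrite exprn_gt0// ltr_wpDr.
nra.
Qed.

Lemma is_derive_step n c x : is_derive x (1 : R) (step n c) (step' n c x).
Proof.
have h : is_derive x (1 : R) (fun x : R => n%:R ^+ 2 * (c - x) + n%:R) (- n%:R ^+ 2).
  rewrite (_ : (fun x => _) = (n%:R ^+ 2 \*: (cst c - id)) + cst n%:R); last by apply/funext => y.
  by apply: is_derive_eq; rewrite /GRing.scale/= addr0 sub0r mulrN1.
have h2 : is_derive x (1 : R) (cst 1 + (expR \o (fun x : R => n%:R ^+ 2 * (c - x) + n%:R)))
   (expR (n%:R ^+ 2 * (c - x) + n%:R) * - n%:R ^+ 2).
  by apply: is_derive_eq; rewrite add0r.
rewrite (_ : step n c = (fun y => ((cst 1 + (expR \o (fun x : R => n%:R ^+ 2 * (c - x) + n%:R))) y)^-1))//.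
have := is_deriveV (f := cst 1 + (expR \o (fun x : R => n%:R ^+ 2 * (c - x) + n%:R))).
move=> /(_ x _ 1 _ h2) H.
have nz : (cst 1 + (expR \o (fun x : R => n%:R ^+ 2 * (c - x) + n%:R))) x != 0 by rewrite !fctE gt_eqF// den_gt0.
move: (H nz) => {}H.
apply: (is_derive_eq H).
rewrite /GRing.scale/= /step' /step /=.
rewrite !fctE; set E := expR _.
have E0 : 1 + E != 0 by rewrite gt_eqF// den_gt0.
by field.
Qed.

Lemma continuous_step n c : continuous (step n c).
Proof.
by move=> x; apply: differentiable_continuous; apply/derivable1_diffP;
  have := is_derive_step n c x => ?; exact: ex_derive.
Qed.

Lemma continuous_step' n c : continuous (step' n c).
Proof.
move=> x; apply: cvgM; first exact: cvg_cst.
apply: cvgM; last by apply: cvgM; exact: continuous_step.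
apply: continuous_comp; last exact: continuous_expR.
apply: cvgD; last exact: cvg_cst.
by apply: cvgM; [exact: cvg_cst|apply: cvgB; [exact: cvg_cst|exact: cvg_id]].
Qed.

(** For [x <= c] the exponent is at least [n], whereas for [x > c] the negative quadratic term wins;
    [harmonic] is the comparison sequence in both cases. *)
Lemma step_cvg c x : step n c x @[n --> \oo] --> ((c < x)%R%:R : R).
Proof.
pose e n : R := expR (n%:R ^+ 2 * (c - x) + n%:R).
have [cx|xc] := ltP c x.
  have e0 : e n @[n --> \oo] --> (0 : R).
    apply: (@squeeze_cvgr _ _ _ _ (cst 0) (@harmonic R)); last 2 first.
    - exact: cvg_cst.
    - exact: cvg_harmonic.
    near=> n; rewrite expR_ge0/=.
    rewrite /e -[X in expR X]opprK expRN lef_pV2 ?posrE ?expR_gt0//.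
    apply: (le_trans _ (expR_ge1Dx _)); rewrite -(natr1 n) addrC lerD2l.
    have : 2 / (x - c) <= n%:R by near: n; exact: nbhs_infty_ger.
    rewrite ler_pdivrMr ?subr_gt0//.
    have : (0 : R) <= n%:R by []; move: cx => _.
    set N := n%:R => N0 Na.
    rewrite (_ : - _ = N * (N * (x - c)) - N); last by ring.
    by rewrite lerBrDr -mulr2n -[N *+ 2]mulr_natr ler_wpM2l.
  rewrite (_ : true%:R = (1 + 0)^-1); last by rewrite addr0 invr1.
  apply: cvgV; first by rewrite addr0.
  by apply: cvgD => //; exact: cvg_cst.
apply: (@squeeze_cvgr _ _ _ _ (cst 0) (@harmonic R)); last 2 first.
- exact: cvg_cst.
- exact: cvg_harmonic.
near=> n; rewrite step_ge0/= lef_pV2 ?posrE//.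
rewrite -(natr1 n) addrC lerD2l.
apply: (@le_trans _ _ (expR n%:R)); last first.
  by rewrite ler_expR lerDr mulr_ge0 ?sqr_ge0// subr_ge0.
by apply: (le_trans _ (expR_ge1Dx _)); rewrite lerDr.
Unshelve. all: by end_near. Qed.

End smooth_step.

Lemma cvg_prod_seq (R : realType) (M : Type) (u : nat -> M -> R) (l : M -> R) r :
  (forall m, u n m @[n --> \oo] --> l m) ->
  \prod_(m <- r) u n m @[n --> \oo] --> \prod_(m <- r) l m.
Proof.
by move=> ul; apply: (cvg_big (U := R^o)) => [|m _]; [exact: mul_continuous|exact: ul].
Qed.

(** * From smooth test functions to events of a sigma-algebra *)

Section null_integral.
Context d (T : measurableType d) (R : realType) (P : probability T R).
Variable X : T -> R.
Hypothesis iX : P.-integrable setT (EFin \o X).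

Lemma null_integral_setC A : measurable A -> (\int[P]_w (X w)%:E = 0)%E ->
  (\int[P]_(w in A) (X w)%:E = 0)%E -> (\int[P]_(w in ~` A) (X w)%:E = 0)%E.
Proof.
move=> mA XT XA.
have := @integral_setU _ _ _ P A (~` A) (fun w => (X w)%:E).
rewrite setUv XT XA add0e => <- //.
- exact: measurableC.
- exact: (measurable_int _ iX).
- by apply/disj_setPS => w [].
Qed.

Lemma null_integral_bigcup (F : (set T)^nat) : (forall n, measurable (F n)) ->
  trivIset setT F -> (forall n, \int[P]_(w in F n) (X w)%:E = 0)%E ->
  (\int[P]_(w in \bigcup_n F n) (X w)%:E = 0)%E.
Proof.
move=> mF tF F0; rewrite integral_bigcup//.
  by rewrite eseries0// => n _ _; rewrite F0.
by apply: integrableS iX => //; exact: bigcup_measurable.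
Qed.

Context (M : finType) (D : {set M}) (V : M -> T -> R).
Hypothesis mV : forall m, measurable_fun setT (V m).
(** Tests are constantly 1 outside [D], so that a product over all of [M] serves the conditioning on
    any subset of the coordinates. *)
Hypothesis X0 : forall (phi phi' : M -> R -> R) (C : R),
  (forall m (x : R), is_derive x (1 : R) (phi m) (phi' m x)) ->
  (forall m, continuous (phi' m)) ->
  (forall m x, `|phi m x| <= 1) -> (forall m x, `|phi' m x| <= C) ->
  (forall m, m \notin D -> (phi m = cst 1) /\ (forall x, phi' m x = 0)) ->
  \int[P]_w (X w * \prod_m phi m (V m w)) = 0.

(** A pi-system for the coordinates in [D]: constraints from below on some of them. With no
    constraint it contains the whole space. *)
Let orthants : set (set T) := [set A | exists (D' : {set M}) (c : M -> R),
  D' \subset D /\ A = [set w | forall m, m \in D' -> c m < V m w]].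

Let orthants_setI : setI_closed orthants.
Proof.
move=> _ _ [D1 [c1 [D1D ->]]] [D2 [c2 [D2D ->]]].
exists (D1 :|: D2)%SET, (fun m => if m \in D1 then
  (if m \in D2 then Num.max (c1 m) (c2 m) else c1 m) else c2 m).
split; first by rewrite finset.subUset D1D.
apply/seteqP; split => [w [/= H1 H2] m|w /= H].
  rewrite inE; case: ifPn => [m1 _|_ /= m2]; last exact: H2.
  by case: ifPn => m2; [rewrite gt_max H1// H2|exact: H1].
split => m mD; have := H m; rewrite inE mD ?orbT/= => /(_ isT).
  by case: ifPn => // _; rewrite gt_max => /andP[].
by case: ifPn => // _; rewrite gt_max => /andP[].
Qed.

Let orthants_measurable A : <<s orthants >> A -> measurable A.
Proof.
apply: smallest_sub; first exact: sigma_algebra_measurable.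
move=> _ [D1 [c [_ ->]]].
rewrite (_ : [set w | _] = \bigcap_(m in [set` D1]) (V m @^-1` `]c m, +oo[)); last first.
  by apply/seteqP; split => w /= H m /H; rewrite /= ?in_itv/= andbT.
apply: fin_bigcap_measurable => // m _.
by rewrite -[X in measurable X]setTI; exact: mV.
Qed.

(** With [step n (c m)] at the coordinates of [D1] and 1 elsewhere, the products tend pointwise to
    the indicator of [A], dominated by [|X|], while every integral along the way is zero. *)
Let orthants0 A : orthants A -> (\int[P]_(w in A) (X w)%:E = 0)%E.
Proof.
move=> [D1 [c [D1D AE]]].
have mA : measurable A.
  by apply: orthants_measurable; apply: sub_gen_smallest; exists D1, c.
pose phi n m := if m \in D1 then step n (c m) else cst 1.
pose phi' n m := if m \in D1 then step' n (c m) else cst 0.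
have phi_le1 n m x : `|phi n m x| <= 1.
  by rewrite /phi; case: ifPn => _; [exact: step_le1|rewrite normr1].
have cphi n m : continuous (phi n m).
  by rewrite /phi; case: ifPn => _; [exact: continuous_step|move=> x; exact: cvg_cst].
have h n : \int[P]_w (X w * \prod_m phi n m (V m w)) = 0.
  apply: (@X0 (phi n) (phi' n) (n%:R ^+ 2)).
  - move=> m x; rewrite /phi /phi'; case: ifPn => _; first exact: is_derive_step.
    exact: is_derive_cst.
  - move=> m; rewrite /phi'; case: ifPn => _; first exact: continuous_step'.
    by move=> x; exact: cvg_cst.
  - exact: phi_le1.
  - move=> m x; rewrite /phi'; case: ifPn => _; first exact: step'_le.
    by rewrite normr0 sqr_ge0.
  - move=> m mD; have /negbTE mD1 : m \notin D1.
      by apply/negP => m1; move/negP: mD; apply; exact: (fintype.subsetP D1D).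
    by rewrite /phi /phi' mD1.
have lphi m x : (phi n m x) @[n --> \oo] --> ((if m \in D1 then (c m < x)%R%:R else 1) : R).
  by rewrite /phi; case: ifPn => _; [exact: step_cvg|exact: cvg_cst].
have prodE w : \prod_m (if m \in D1 then (c m < V m w)%R%:R else 1) = \1_A w :> R.
  rewrite indicE; have [wA|wA] := boolP (w \in A).
    rewrite big1// => m _; case: ifPn => // mD1.
    by move: wA; rewrite AE inE => /(_ m mD1) ->.
  have /existsNP[m /not_implyP[mD1 /negP cV]] : ~ forall m, m \in D1 -> c m < V m w.
    by move=> Aw; move: wA; rewrite AE notin_setE; exact.
  by rewrite (bigD1 m)//= mD1 (negbTE cV) mul0r.
have mphi n m : measurable_fun setT (fun w => phi n m (V m w)).
  by apply: measurableT_comp => //; exact: continuous_measurable_fun.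
have mX : measurable_fun setT X by exact/measurable_EFinP/(measurable_int _ iX).
have [|||iA] := @Rdominated_convergence _ _ _ P
  (fun n w => X w * \prod_m phi n m (V m w)) (fun w => X w * \1_A w) (fun w => `|X w|)
  _ _ (integrable_norm iX).
- by move=> n; apply: measurable_funM => //; apply: measurable_prod => m _.
- move=> w; apply: cvgM; first exact: cvg_cst.
  rewrite -prodE; apply: (cvg_prod_seq (u := fun n m => phi n m (V m w))) => m.
  exact: lphi.
- by move=> n w; rewrite normrM ler_piMr//; exact: prod_seq_le1.
under eq_fun do rewrite h.
move=> E; have E0 : \int[P]_w (X w * \1_A w) = 0.
  by apply: (cvg_unique _ E) => //; exact: cvg_cst.
rewrite integral_mkcond -[LHS]fineK; last first.
  rewrite -integral_mkcond; apply: integrable_fin_num => //.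
  exact: integrableS iX.
congr EFin; rewrite -E0; congr fine; apply: eq_integral => w _.
by rewrite patchE indicE; case: ifPn; rewrite ?mulr1 ?mulr0.
Qed.

(** Open half-lines generate the Borel sets, so each [V m] with [m] in [D] is measurable for the
    sigma-algebra of the orthants. Dynkin's theorem applies there; its complement step uses that the
    whole space is itself an orthant. *)
Lemma null_integral_sigma A :
  <<s \bigcup_(m in [set` D]) preimage_set_system setT (V m) measurable >> A ->
  (\int[P]_(w in A) (X w)%:E = 0)%E.
Proof.
move=> sA.
have : <<s orthants >> A.
  move: sA; apply: smallest_sub; first exact: smallest_sigma_algebra.
  move=> B [m /= mD [C mC <-]].
  have mVo : measurable_fun setT (V m : g_sigma_algebraType orthants -> R).
    apply: (measurability _ (RGenOInfty.measurableE R)) => //.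
    move=> _ [_ [x ->] <-]; rewrite setTI; apply: sub_gen_smallest.
    exists [set m]%SET, (fun=> x); split; first by rewrite finset.sub1set.
    apply/seteqP; split => w /=; rewrite in_itv/= andbT.
      by move=> h k; rewrite inE => /eqP ->.
    by apply; rewrite inE.
  exact: mVo.
apply: (@dynkin_induction _ (g_sigma_algebraType orthants) orthants
  (fun B => \int[P]_(w in B) (X w)%:E = 0)%E) => //.
- apply: orthants0; exists (finset.set0 : {set M}), (fun=> 0); split; first exact: finset.sub0set.
  by apply/seteqP; split => w //= _ m; rewrite inE.
- move=> B mB; apply: null_integral_setC; first exact: orthants_measurable.
  apply: orthants0; exists (finset.set0 : {set M}), (fun=> 0); split; first exact: finset.sub0set.
  by apply/seteqP; split => w //= _ m; rewrite inE.
- move=> F mF tF F0; apply: null_integral_bigcup => // n.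
  exact: (orthants_measurable (mF n)).
Qed.

End null_integral.

(** * Riemann sums and integration by parts *)

Section riemann.
Context (R : realType) (a b : R).
Hypothesis ab : a < b.
Local Notation mu := (@lebesgue_measure R).
Implicit Type f : R -> R.

Lemma within_itv_uniform f : {within `[a, b], continuous f} -> forall e : R, 0 < e ->
  exists2 r : R, 0 < r & forall x y, a <= x <= b -> a <= y <= b ->
    `|x - y| < r -> `|f x - f y| <= e.
Proof.
move=> cf e e0.
pose Q (r : R) (x : R) := a <= x <= b -> forall y, a <= y <= b -> `|x - y| < r ->
  `|f x - f y| <= e.
have /compact_near_coveringP nc := @segment_compact _ a b.
have := nc _ (0^'+ : set_system R) Q _.
have H : forall x, `[a, b]%classic x -> \forall x' \near x & r \near 0^'+, Q r x'.
  move=> x /=; rewrite in_itv/= => xab.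
  move/subspace_continuousP : cf => /(_ x); rewrite /= in_itv/= xab => /(_ isT).
  move=> /cvgrPdist_le /(_ (e / 2)); rewrite divr_gt0// => /(_ isT).
  move=> [r /= r0 Hr].
  exists (ball x (r / 2), [set r' | r' <= r / 2]); first split => /=.
  - by exists (r / 2) => //=; rewrite divr_gt0.
  - by apply: nbhs_right_le; rewrite divr_gt0.
  move=> [x' r'] /= [xx' r'r] x'ab y yab x'y.
  have h1 : `|f x - f x'| <= e / 2.
    by apply: Hr => //=; rewrite ?in_itv//= (lt_le_trans xx')// ler_pdivrMr// ler_peMr// ?ler1n// ltW.
  have h2 : `|f x - f y| <= e / 2.
    apply: Hr => //=; rewrite ?in_itv//= (splitr r).
    rewrite (_ : x - y = (x - x') + (x' - y)); last by ring.
    by rewrite (le_lt_trans (ler_normD _ _))// ltrD// (lt_le_trans x'y).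
  rewrite (_ : f x' - f y = (f x - f y) - (f x - f x')); last by ring.
  by rewrite (le_trans (ler_normB _ _))// (splitr e) lerD.
move=> /(_ _ H) [r /= r0 Hr].
exists (r / 2); first by rewrite divr_gt0.
move=> x y xab yab xy; apply: (Hr (r / 2)) => //=.
- by rewrite sub0r normrN ger0_norm ?ltr_pdivrMr ?ltr_pMr ?ltr1n// ltW// divr_gt0.
- by rewrite divr_gt0.
Qed.

Definition grid (n k : nat) : R := a + k%:R * ((b - a) / n%:R).

Lemma grid0 n : grid n 0 = a. Proof. by rewrite /grid mul0r addr0. Qed.

Lemma gridn n : (0 < n)%N -> grid n n = b.
Proof. by move=> n0; rewrite /grid; field; rewrite pnatr_eq0 -lt0n. Qed.

Lemma gridS n k : grid n k.+1 - grid n k = (b - a) / n%:R.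
Proof. by rewrite /grid -natr1; ring. Qed.

Lemma grid_lt n k : (0 < n)%N -> grid n k < grid n k.+1.
Proof. by move=> n0; rewrite -subr_gt0 gridS divr_gt0 ?subr_gt0 ?ltr0n. Qed.

Lemma grid_itv n k : (k <= n)%N -> a <= grid n k <= b.
Proof.
case: n => [|n]; first by rewrite leqn0 => /eqP ->; rewrite grid0 lexx ltW.
move=> kn; have h : 0 <= (b - a) / n.+1%:R by rewrite divr_ge0// subr_ge0 ltW.
apply/andP; split; first by rewrite /grid lerDl mulr_ge0.
rewrite -[leRHS](@gridn n.+1)// /grid lerD2l.
by rewrite ler_wpM2r// ler_nat.
Qed.

Definition primitive f u : R := \int[mu]_(x in `[a, u]) f x.

Lemma primitive_a f : primitive f a = 0.
Proof. by rewrite /primitive set_itv1 Rintegral_set1. Qed.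

Lemma integrable_itv f : {within `[a, b], continuous f} ->
  mu.-integrable `[a, b] (EFin \o f).
Proof. by move=> cf; apply: continuous_compact_integrable => //; exact: segment_compact. Qed.

Lemma continuous_primitive f : {within `[a, b], continuous f} ->
  {within `[a, b], continuous (primitive f)}.
Proof.
move=> cf; apply: parameterized_integral_continuous; first exact: ltW.
exact: integrable_itv.
Qed.

Lemma primitive_mvt f x y : {within `[a, b], continuous f} ->
  a <= x -> x < y -> y <= b ->
  exists2 z, x <= z <= y & primitive f y - primitive f x = f z * (y - x).
Proof.
move=> cf ax xy yb.
have [||z] := @MVT _ (primitive f) f x y xy.
- move=> z; rewrite in_itv/= => /andP[xz zy].
  have az : a < z by exact: le_lt_trans xz.
  have zb : z < b by exact: lt_le_trans zy yb.
  have [] := @continuous_FTC1_closed _ f a z b zb (integrable_itv cf) az.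
    by apply: (within_continuous_continuous ab cf); rewrite in_itv/= az.
  by move=> d1 d2; apply: DeriveDef => //; rewrite -derive1E.
- apply: (continuous_subspaceW _ (continuous_primitive cf)) => z /=.
  by rewrite !in_itv/= => /andP[xz zy]; rewrite (le_trans ax xz) (le_trans zy yb).
by rewrite in_itv/= => /andP[xz zy] h; exists z => //; rewrite !ltW.
Qed.

(** The cell values need only be uniformly close to [f] at right endpoints, which covers left, mixed
    and averaged values alike. On each cell the integral is [f z] times the length, by the mean
    value theorem. *)
Lemma riemann_cvg f (c : nat -> nat -> R) : {within `[a, b], continuous f} ->
  (forall e : R, 0 < e -> \forall n \near \oo, forall k, (k < n)%N ->
    `|c n k - f (grid n k.+1)| <= e) ->
  (b - a) / n%:R * \sum_(k < n) c n k @[n --> \oo] --> primitive f b.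
Proof.
move=> cf cc; apply/cvgrPdist_le => e e0.
have ba0 : 0 < b - a by rewrite subr_gt0.
(* Each cell has two errors of size [e']: one from moving [z] to the right endpoint, one from
   [c n k]. *)
pose e' := e / (b - a) / 2.
have e'0 : 0 < e' by rewrite !divr_gt0.
have [r r0 Hr] := within_itv_uniform cf e'0.
near=> n.
have n0 : (0 < n)%N by near: n; exists 1%N.
have nr : (b - a) / n%:R < r.
  rewrite ltr_pdivrMr ?ltr0n// mulrC -ltr_pdivrMr//.
  by near: n; exact: nbhs_infty_gtr.
have cn : forall k, (k < n)%N -> `|c n k - f (grid n k.+1)| <= e'.
  by near: n; exact: cc.
have -> : primitive f b = \sum_(k < n) (primitive f (grid n k.+1) - primitive f (grid n k)).
  rewrite -(big_mkord xpredT (fun k => primitive f (grid n k.+1) - primitive f (grid n k))).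
  by rewrite telescope_sumr// gridn// grid0 primitive_a subr0.
rewrite mulr_sumr -sumrB.
apply: (le_trans (ler_norm_sum _ _ _)).
apply: (@le_trans _ _ (\sum_(k < n) ((b - a) / n%:R * (e' + e')))); last first.
  rewrite sumr_const card_ord -mulr_natl /e' le_eqVlt; apply/orP; left; apply/eqP.
  by field; rewrite pnatr_eq0 -lt0n n0 gt_eqF.
apply: ler_sum => -[k kn] _ /=.
have gk : a <= grid n k <= b by apply: grid_itv; exact: ltnW.
have gk1 : a <= grid n k.+1 <= b by exact: grid_itv.
have [||z /andP[z1 z2] ->] := @primitive_mvt f (grid n k) (grid n k.+1) cf _ (grid_lt _ n0).
- by case/andP: gk.
- by case/andP: gk1.
have D0 : 0 <= (b - a) / n%:R by rewrite divr_ge0// ltW.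
rewrite gridS [X in `|X|](_ : _ = (b - a) / n%:R * (f z - c n k)); last by ring.
rewrite normrM (ger0_norm D0); apply: ler_wpM2l => //.
rewrite (_ : f z - _ = (f z - f (grid n k.+1)) - (c n k - f (grid n k.+1))); last by ring.
apply: (le_trans (ler_normB _ _)); apply: lerD; last exact: cn.
apply: Hr => //.
  case/andP: gk => gk _; case/andP: gk1 => _ gk1.
  by rewrite (le_trans gk)// (le_trans z2).
rewrite distrC ger0_norm ?subr_ge0//; apply: le_lt_trans nr.
by rewrite -(gridS n k) lerD2l lerN2.
Unshelve. all: by end_near. Qed.

End riemann.

Section grid_approximation.
Context (R : realType) (a b : R).
Hypothesis ab : a < b.
Local Notation g := (grid a b).

(** Stable under sums, multiples and products, so that the remainder of a summation by parts is
    recognised as a Riemann sum whatever the evaluation points of its factors. *)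
Definition cell_approx (f : R -> R) (c : nat -> nat -> R) :=
  forall e : R, 0 < e -> \forall n \near \oo, forall k, (k < n)%N ->
    `|c n k - f (g n k.+1)| <= e.

Lemma cell_approx_right (f : R -> R) : cell_approx f (fun n k => f (g n k.+1)).
Proof. by move=> e e0; apply: nearW => n k _; rewrite subrr normr0 ltW. Qed.

Lemma cell_approx_near f c : {within `[a, b], continuous f} ->
  (forall n k, (k < n)%N -> exists2 z, g n k <= z <= g n k.+1 & c n k = f z) ->
  cell_approx f c.
Proof.
move=> cf cz e e0; have [r r0 Hr] := within_itv_uniform cf e0.
near=> n => k kn.
have n0 : (0 < n)%N by exact: leq_ltn_trans kn.
have nr : (b - a) / n%:R < r.
  rewrite ltr_pdivrMr ?ltr0n// mulrC -ltr_pdivrMr//.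
  by near: n; exact: nbhs_infty_gtr.
have [z /andP[z1 z2] ->] := cz n k kn.
have /andP[ag gb] : a <= g n k <= b by apply: grid_itv => //; exact: ltnW.
have /andP[ag1 gb1] : a <= g n k.+1 <= b by exact: grid_itv.
apply: Hr.
- by rewrite (le_trans ag)// (le_trans z2).
- by rewrite ag1.
- rewrite distrC ger0_norm ?subr_ge0//; apply: le_lt_trans nr.
  by rewrite -(gridS a b n k) lerD2l lerN2.
Unshelve. all: by end_near. Qed.

Lemma cell_approx_left f : {within `[a, b], continuous f} ->
  cell_approx f (fun n k => f (g n k)).
Proof.
move=> cf; apply: cell_approx_near => // n k kn; exists (g n k) => //.
by rewrite lexx/= ltW// grid_lt// (leq_ltn_trans _ kn).
Qed.

Lemma cell_approx_primitive f : {within `[a, b], continuous f} ->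
  cell_approx f (fun n k =>
    (primitive a f (g n k.+1) - primitive a f (g n k)) / ((b - a) / n%:R)).
Proof.
move=> cf; apply: cell_approx_near => // n k kn.
have n0 : (0 < n)%N by exact: leq_ltn_trans kn.
have /andP[ag gb] : a <= g n k <= b by apply: grid_itv => //; exact: ltnW.
have /andP[ag1 gb1] : a <= g n k.+1 <= b by exact: grid_itv.
have [z zg ->] := primitive_mvt ab cf ag (grid_lt ab k n0) gb1.
exists z => //; rewrite gridS mulfK// mulf_neq0// ?invr_eq0 ?pnatr_eq0 -?lt0n//.
by rewrite subr_eq0 gt_eqF.
Qed.

Lemma cell_approxD f f' c c' : cell_approx f c -> cell_approx f' c' ->
  cell_approx (fun u => f u + f' u) (fun n k => c n k + c' n k).
Proof.
move=> fc fc' e e0; have e20 : 0 < e / 2 by rewrite divr_gt0.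
near=> n => k kn.
rewrite (_ : _ - _ = (c n k - f (g n k.+1)) + (c' n k - f' (g n k.+1))); last by ring.
rewrite (le_trans (ler_normD _ _))// (splitr e) lerD//.
  by move: k kn; near: n; exact: fc.
by move: k kn; near: n; exact: fc'.
Unshelve. all: by end_near. Qed.

Lemma cell_approxZ m f c : cell_approx f c ->
  cell_approx (fun u => m * f u) (fun n k => m * c n k).
Proof.
move=> fc e e0; have m0 : 0 < `|m| + 1 by rewrite ltr_wpDl.
have e20 : 0 < e / (`|m| + 1) by rewrite divr_gt0.
apply: filterS (fc _ e20) => n H k kn.
rewrite -mulrBr normrM.
apply: (@le_trans _ _ (`|m| * (e / (`|m| + 1)))); first by rewrite ler_wpM2l// H.
rewrite mulrCA; apply: ler_piMr; first exact: ltW.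
by rewrite ler_pdivrMr// mul1r lerDl.
Qed.

Lemma within_itv_bounded (f : R -> R) : {within `[a, b], continuous f} ->
  exists M : R, forall x, a <= x <= b -> `|f x| <= M.
Proof.
move=> cf.
have cn : {within `[a, b], continuous (fun x => `|f x|)}.
  by move=> x; apply: (continuous_comp (cf x)); exact: norm_continuous.
have [c _ fc] := EVT_max (ltW ab) cn.
by exists `|f c| => x xab; apply: fc; rewrite in_itv.
Qed.

Lemma cell_approxM f f' c c' :
  {within `[a, b], continuous f} -> {within `[a, b], continuous f'} ->
  cell_approx f c -> cell_approx f' c' ->
  cell_approx (fun u => f u * f' u) (fun n k => c n k * c' n k).
Proof.
move=> cf cf' fc fc' e e0.
have [M fM] := within_itv_bounded cf; have [M' fM'] := within_itv_bounded cf'.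
pose m := `|M| + `|M'| + 1; have m0 : 0 < m by rewrite ltr_wpDl// addr_ge0.
(* The cap at 1 makes the product of the two errors at most [e']; [m] collects this term and the two
   mixed ones. *)
pose e' := Num.min 1 (e / m).
have e'0 : 0 < e' by rewrite lt_min ltr01 divr_gt0.
have e'1 : e' <= 1 by rewrite ge_min lexx.
have e'm : e' * m <= e by rewrite -ler_pdivlMr// ge_min lexx orbT.
near=> n => k kn.
have gk : a <= g n k.+1 <= b by exact: grid_itv.
have h1 : `|c n k - f (g n k.+1)| <= e' by move: k kn {gk}; near: n; exact: fc.
have h2 : `|c' n k - f' (g n k.+1)| <= e' by move: k kn {gk h1}; near: n; exact: fc'.
have h3 := le_trans (fM _ gk) (ler_norm M).
have h4 := le_trans (fM' _ gk) (ler_norm M').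
move: h1 h2 h3 h4; set u := f _; set u' := f' _; set v := c _ _; set v' := c' _ _.
move=> h1 h2 h3 h4.
rewrite (_ : v * v' - u * u' = (v - u) * (v' - u') + (v - u) * u' + u * (v' - u')); last by ring.
apply: (le_trans (ler_normD _ _)); apply: (le_trans (lerD (ler_normD _ _) (lexx _))).
rewrite !normrM; apply: le_trans e'm.
have p1 : `|v - u| * `|v' - u'| <= e' * 1 by apply: ler_pM => //; exact: le_trans h2 _.
have p2 : `|v - u| * `|u'| <= e' * `|M'| by exact: ler_pM.
have p3 : `|u| * `|v' - u'| <= `|M| * e' by exact: ler_pM.
by rewrite /m; move: p1 p2 p3; lra.
Unshelve. all: by end_near. Qed.

Lemma within_itvM (f f' : R -> R) : {within `[a, b], continuous f} ->
  {within `[a, b], continuous f'} -> {within `[a, b], continuous (fun u => f u * f' u)}.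
Proof. by move=> cf cf' u; apply: cvgM; [exact: cf|exact: cf']. Qed.

Section integration_by_parts_sums.
Variables x y : R -> R.
Hypothesis cx : {within `[a, b], continuous x}.
Hypothesis cy : {within `[a, b], continuous y}.
Local Notation X := (primitive a x).
Local Notation Y := (primitive a y).
Local Notation XY := (primitive a (fun u => x u * y u) b).

(** Subtracted from the telescoping sum of [X * y], the trapezoidal sum leaves the mean of [y] at
    the two ends of a cell times the increment of [X], which is the cell average of [x] times the
    step. No quadratic variation enters. *)
Lemma strat_primitive_cvg :
  \sum_(k < n) ((X (g n k) + X (g n k.+1)) / 2 * (y (g n k.+1) - y (g n k)))
    @[n --> \oo] --> X b * y b - XY.
Proof.
pose c n k := (2^-1 * (y (g n k) + y (g n k.+1))) *
  ((X (g n k.+1) - X (g n k)) / ((b - a) / n%:R)).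
have cc : cell_approx (fun u => (2^-1 * (y u + y u)) * x u) c.
  apply: (@cell_approxM (fun u => 2^-1 * (y u + y u)) x) => //.
  - move=> u; apply: cvgM; first exact: cvg_cst.
    by apply: cvgD; exact: cy.
  - apply: cell_approxZ; apply: cell_approxD; last exact: cell_approx_right.
    exact: cell_approx_left.
  - exact: cell_approx_primitive.
have -> : XY = primitive a (fun u => (2^-1 * (y u + y u)) * x u) b.
  by apply: eq_Rintegral => u _; field.
have cv := riemann_cvg ab _ cc.
have : X b * y b - (b - a) / n%:R * \sum_(k < n) c n k @[n --> \oo] -->
    X b * y b - primitive a (fun u => (2^-1 * (y u + y u)) * x u) b.
  apply: cvgB; first exact: cvg_cst.
  apply: cv => u; apply: cvgM; last exact: cx.
  by apply: cvgM; [exact: cvg_cst|apply: cvgD; exact: cy].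
apply: cvg_trans; apply: near_eq_cvg; near=> n.
have n0 : (0 < n)%N by near: n; exists 1%N.
have -> : X b * y b = \sum_(k < n) (X (g n k.+1) * y (g n k.+1) - X (g n k) * y (g n k)).
  rewrite -(big_mkord xpredT (fun k => X (g n k.+1) * y (g n k.+1) - X (g n k) * y (g n k))).
  by rewrite telescope_sumr// gridn// grid0 primitive_a mul0r subr0.
rewrite mulr_sumr -sumrB; apply: eq_bigr => k _.
have nn : n%:R != 0 :> R by rewrite pnatr_eq0 -lt0n.
have bab : b - a != 0 by rewrite subr_eq0 gt_eqF.
by rewrite /c; field; rewrite nn bab.
Unshelve. all: by end_near. Qed.

Lemma ito_time_cvg :
  \sum_(k < n) ((g n k - a) * (y (g n k.+1) - y (g n k)))
    @[n --> \oo] --> (b - a) * y b - Y b.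
Proof.
have cv := riemann_cvg ab cy (cell_approx_right y).
have : (b - a) * y b - (b - a) / n%:R * \sum_(k < n) y (g n k.+1) @[n --> \oo] -->
    (b - a) * y b - Y b by apply: cvgB => //; exact: cvg_cst.
apply: cvg_trans; apply: near_eq_cvg; near=> n.
have n0 : (0 < n)%N by near: n; exists 1%N.
have -> : (b - a) * y b = \sum_(k < n) ((g n k.+1 - a) * y (g n k.+1) - (g n k - a) * y (g n k)).
  rewrite -(big_mkord xpredT (fun k => (g n k.+1 - a) * y (g n k.+1) - (g n k - a) * y (g n k))).
  by rewrite telescope_sumr// gridn// grid0 subrr mul0r subr0.
rewrite mulr_sumr -sumrB; apply: eq_bigr => k _.
by rewrite -(gridS a b n k); ring.
Unshelve. all: by end_near. Qed.

(** Only the symmetric sum converges path by path: subtracted from the telescoping sum of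
    [(u - a) * x * y], it leaves half the step times the cross products of [x] and [y] at opposite
    ends of a cell. *)
Lemma strat_time_cvg :
  \sum_(k < n) (((g n k - a) * x (g n k) + (g n k.+1 - a) * x (g n k.+1)) / 2 *
       (y (g n k.+1) - y (g n k)) +
     ((g n k - a) * y (g n k) + (g n k.+1 - a) * y (g n k.+1)) / 2 *
       (x (g n k.+1) - x (g n k)))
    @[n --> \oo] --> (b - a) * x b * y b - XY.
Proof.
pose c n k := 2^-1 * (x (g n k.+1) * y (g n k) + x (g n k) * y (g n k.+1)).
have cc : cell_approx (fun u => 2^-1 * (x u * y u + x u * y u)) c.
  apply: cell_approxZ; apply: cell_approxD; apply: cell_approxM => //;
    try exact: cell_approx_right; exact: cell_approx_left.
have -> : XY = primitive a (fun u => 2^-1 * (x u * y u + x u * y u)) b.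
  by apply: eq_Rintegral => u _; field.
have cv := riemann_cvg ab _ cc.
have : (b - a) * x b * y b - (b - a) / n%:R * \sum_(k < n) c n k @[n --> \oo] -->
    (b - a) * x b * y b - primitive a (fun u => 2^-1 * (x u * y u + x u * y u)) b.
  apply: cvgB; first exact: cvg_cst.
  apply: cv => u; apply: cvgM; first exact: cvg_cst.
  by apply: cvgD; exact: within_itvM.
apply: cvg_trans; apply: near_eq_cvg; near=> n.
have n0 : (0 < n)%N by near: n; exists 1%N.
have -> : (b - a) * x b * y b = \sum_(k < n) ((g n k.+1 - a) * x (g n k.+1) * y (g n k.+1)
    - (g n k - a) * x (g n k) * y (g n k)).
  rewrite -(big_mkord xpredT (fun k => (g n k.+1 - a) * x (g n k.+1) * y (g n k.+1)
    - (g n k - a) * x (g n k) * y (g n k))).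
  by rewrite telescope_sumr// gridn// grid0 subrr !mul0r subr0.
rewrite mulr_sumr -sumrB; apply: eq_bigr => k _.
by rewrite -(gridS a b n k) /c; field.
Unshelve. all: by end_near. Qed.

End integration_by_parts_sums.

End grid_approximation.

(** * The space-space-time area as a functional of the path *)

Section limits_in_probability.
Context d (T : measurableType d) (R : realType) (P : probability T R).
Implicit Types (S : nat -> T -> R) (Z : T -> R).

Definition cvg_in_prob S Z := forall e eta : R, 0 < e -> 0 < eta ->
  \forall n \near \oo, (P [set w | (e <= `|S n w - Z w|)%R] <= eta%:E)%E.

Lemma measurable_dist_ge (f : T -> R) e : measurable_fun setT f ->
  measurable [set w | e <= `|f w|].
Proof.
move=> mf; rewrite (_ : [set w | _] = (fun w => `|f w|) @^-1` `[e, +oo[).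
  by rewrite -[X in measurable X]setTI; apply: measurableT_comp.
by apply/seteqP; split => w /=; rewrite in_itv/= andbT.
Qed.

Lemma cvg_in_probD S S' Z Z' :
  (forall n, measurable_fun setT (S n)) -> (forall n, measurable_fun setT (S' n)) ->
  measurable_fun setT Z -> measurable_fun setT Z' ->
  cvg_in_prob S Z -> cvg_in_prob S' Z' ->
  cvg_in_prob (fun n w => S n w + S' n w) (fun w => Z w + Z' w).
Proof.
move=> mS mS' mZ mZ' SZ SZ' e eta e0 eta0.
have e20 : 0 < e / 2 by rewrite divr_gt0.
have eta20 : 0 < eta / 2 by rewrite divr_gt0.
apply: filterS2 (SZ _ _ e20 eta20) (SZ' _ _ e20 eta20) => n h1 h2.
have m1 : measurable [set w | e / 2 <= `|S n w - Z w|].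
  by apply: measurable_dist_ge; exact: measurable_funB.
have m2 : measurable [set w | e / 2 <= `|S' n w - Z' w|].
  by apply: measurable_dist_ge; exact: measurable_funB.
rewrite (splitr eta) EFinD; apply: le_trans (leeD h1 h2).
apply: le_trans (measureU2 P m1 m2).
apply: le_measure; rewrite ?inE.
- apply: (measurable_dist_ge (f := fun w => S n w + S' n w - (Z w + Z' w))).
  by apply: measurable_funB; exact: measurable_funD.
- exact: measurableU.
- move=> w /= ew; apply: contrapT => /not_orP[/negP + /negP]; rewrite -!ltNge => w1 w2.
  suff : `|S n w + S' n w - (Z w + Z' w)| < e by rewrite ltNge ew.
  rewrite (_ : _ - _ = (S n w - Z w) + (S' n w - Z' w)); last by ring.
  by rewrite (le_lt_trans (ler_normD _ _))// (splitr e) ltrD.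
Qed.

(** If the two limits differ at [w], then [|S n w - Z w|] is eventually bounded below by some
    [1 / j.+1]. For fixed [j] and [m] the event that this holds from rank [m] on is null, as it lies
    in events of arbitrarily small probability; no subsequence is extracted. *)
Lemma cvg_in_prob_ae_unique S Z Z' :
  (forall n, measurable_fun setT (S n)) -> measurable_fun setT Z ->
  cvg_in_prob S Z -> {ae P, forall w, S n w @[n --> \oo] --> Z' w} ->
  {ae P, forall w, Z w = Z' w}.
Proof.
move=> mS mZ SZ.
pose A (j n : nat) := [set w | j.+1%:R^-1 <= `|S n w - Z w|].
have mA j n : measurable (A j n).
  by apply: (measurable_dist_ge (f := fun w => S n w - Z w)); exact: measurable_funB.
pose B j m := \bigcap_(n in [set n | (m <= n)%N]) A j n.
have mB j m : measurable (B j m) by apply: bigcap_measurable => //; exists m => /=.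
have PB j m : P (B j m) = 0.
  apply/eqP; rewrite eq_le measure_ge0 andbT.
  apply/lee_addgt0Pr => e e0; rewrite add0e.
  have j0 : 0 < j.+1%:R^-1 :> R by [].
  have [n0 _ Hn] := SZ _ _ j0 e0.
  apply: le_trans (Hn (maxn n0 m) (leq_maxl _ _)).
  apply: le_measure; rewrite ?inE//; first exact: mA.
  by move=> w; apply; exact: leq_maxr.
have N : P.-negligible (\bigcup_j \bigcup_m B j m).
  apply: negligible_bigcup => j; apply: negligible_bigcup => m.
  apply/negligibleP; [exact: mB|exact: PB].
have : {ae P, forall w, ~ (\bigcup_j \bigcup_m B j m) w}.
  by apply: negligibleS N => w /=; apply: contrapT.
apply: filterS2 => w wB SZ'.
apply/eqP; rewrite -subr_eq0 -normr_eq0; apply/eqP.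
apply: contrapT => /eqP ne0.
have p0 : 0 < `|Z w - Z' w| / 2 by rewrite divr_gt0// lt_neqAle eq_sym ne0 normr_ge0.
(* The index [j] comes from the Archimedean property: [1 / j.+1] is below half the distance of the
   two limits. *)
apply: wB; exists (Num.bound (`|Z w - Z' w| / 2)^-1) => //.
move/cvgrPdist_lt : SZ' => /(_ _ p0)[m _ Hm].
exists m => //= n /= mn; rewrite /A/=.
have h := Hm n mn.
apply: (@le_trans _ _ (`|Z w - Z' w| / 2)).
  rewrite -[leRHS]invrK lef_pV2 ?posrE ?invr_gt0//.
  apply: ltW; apply: (lt_le_trans (archi_boundP _)); last by rewrite ler_nat.
  by rewrite invr_ge0 ltW.
rewrite (distrC (S n w)); have := ler_normB (Z w - S n w) (Z' w - S n w).
rewrite (_ : _ - _ - _ = Z w - Z' w); last by ring.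
by move: h; lra.
Qed.

End limits_in_probability.

Section grid_partition.
Context d (T : measurableType d) (R : realType) (P : probability T R) (a b : R).

Definition grid_part (n : nat) : seq R := mkseq (fun k => grid a b n k.+1) n.

Lemma size_grid_part n : size (grid_part n) = n.
Proof. exact: size_mkseq. Qed.

Lemma nth_grid_part n k : (k <= n)%N -> nth b (a :: grid_part n) k = grid a b n k.
Proof.
by case: k => [|k] kn; [rewrite grid0|rewrite /= nth_mkseq].
Qed.

Lemma itv_partition_grid n : a < b -> (0 < n)%N -> itv_partition a b (grid_part n).
Proof.
move=> ab n0; split.
  apply/(pathP b) => i; rewrite size_grid_part => iN.
  rewrite nth_grid_part; last exact: ltnW.
  by rewrite nth_mkseq//; exact: grid_lt.
by rewrite (last_nth b) size_grid_part nth_grid_part// gridn.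
Qed.

Lemma lim_partitions_grid (S : seq R -> T -> R) (Z : T -> R) : a < b ->
  lim_partitions P a b S Z -> cvg_in_prob P (fun n => S (grid_part n)) Z.
Proof.
move=> ab lim e eta e0 eta0; have [r r0 Hr] := lim e eta e0 eta0.
near=> n.
have n0 : (0 < n)%N by near: n; exists 1%N.
apply: Hr; first exact: itv_partition_grid.
move=> k; rewrite size_grid_part => kn.
rewrite !nth_grid_part//; last exact: ltnW.
rewrite gridS ltr_pdivrMr ?ltr0n// mulrC -ltr_pdivrMr//.
by near: n; exact: nbhs_infty_gtr.
Unshelve. all: by end_near. Qed.

(** The integral processes also have to be evaluated at [u = s], where the only partition is
    empty. *)
Lemma lim_partitions_refl (S : seq R -> T -> R) (Z : T -> R) :
  lim_partitions P a a S Z -> cvg_in_prob P (fun n => S [::]) Z.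
Proof.
move=> lim e eta e0 eta0; have [r r0 Hr] := lim e eta e0 eta0.
by apply: nearW => n; apply: Hr => //; split.
Qed.

Lemma ito_sum_grid (X Y : R -> T -> R) n : ito_sum X Y a b (grid_part n) =
  fun w => \sum_(k < n) X (grid a b n k) w * (Y (grid a b n k.+1) w - Y (grid a b n k) w).
Proof.
apply/funext => w; rewrite /ito_sum size_grid_part big_mkord; apply: eq_bigr => k _.
by rewrite !nth_grid_part// ltnW.
Qed.

Lemma stratonovich_sum_grid (X Y : R -> T -> R) n :
  stratonovich_sum X Y a b (grid_part n) =
  fun w => \sum_(k < n) (X (grid a b n k) w + X (grid a b n k.+1) w) / 2 *
    (Y (grid a b n k.+1) w - Y (grid a b n k) w).
Proof.
apply/funext => w; rewrite /stratonovich_sum size_grid_part big_mkord; apply: eq_bigr => k _.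
by rewrite !nth_grid_part// ltnW.
Qed.

End grid_partition.

Lemma measurable_primitive d (T : measurableType d) (R : realType) (a b : R)
    (f : R -> T -> R) : a <= b ->
  (forall w, {within `[a, b], continuous (fun u => f u w)}) ->
  (forall u, a <= u <= b -> measurable_fun setT (f u)) ->
  measurable_fun setT (fun w => primitive a (f^~ w) b).
Proof.
rewrite le_eqVlt => /predU1P[<- _ _|ab cf mf].
  by rewrite (_ : (fun w => _) = cst 0)//; apply/funext => w; exact: primitive_a.
apply: (measurable_fun_cvg (h := fun n w =>
  (b - a) / n%:R * \sum_(k < n) f (grid a b n k.+1) w)).
  move=> n; apply: measurable_funM => //.
  rewrite (_ : (fun w => _) = fun w => \sum_(k <- index_enum 'I_n) f (grid a b n k.+1) w)//.
  by apply: measurable_sum => k; apply: mf; exact: grid_itv.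
move=> w _; exact: (riemann_cvg ab (cf w) (cell_approx_right _ _ (f^~ w))).
Qed.

Section sst_area.
Context d (T : measurableType d) (R : realType) (P : probability T R) (n : nat).
Context (W : 'I_n -> R -> {RV P >-> R}) (s t : R).
Hypothesis st : s < t.
Hypothesis cW : forall i w, {within `[s, t], continuous ((fun u => W i u w) : R -> R)}.

Let x (i : 'I_n) (w : T) (u : R) : R := increment W s u i w.

Let cx i w : {within `[s, t], continuous (x i w)}.
Proof. by move=> u; apply: cvgB; [exact: cW|exact: cvg_cst]. Qed.

Let xs i w : x i w s = 0. Proof. exact: subrr. Qed.

Let mx i u : measurable_fun setT (fun w => x i w u).
Proof. exact: measurable_funB. Qed.

Let sub_itv u : u <= t -> `[s, u] `<=` `[s, t].
Proof. by move=> ut z /=; rewrite !in_itv/= => /andP[-> zu]; exact: le_trans ut. Qed.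

Let cxu i w u : u <= t -> {within `[s, u], continuous (x i w)}.
Proof. by move=> ut; exact: (continuous_subspaceW (sub_itv ut) (@cx i w)). Qed.

Let mX i u : s <= u <= t -> measurable_fun setT (fun w => primitive s (x i w) u).
Proof.
move=> /andP[su ut]; apply: (measurable_primitive (f := fun u w => x i w u)) => //.
by move=> w; exact: cxu.
Qed.

Let dW i u v w : W i u w - W i v w = x i w u - x i w v.
Proof. by rewrite /x /increment; ring. Qed.

Lemma ito_time_ae (C : 'I_n -> R -> {RV P >-> R}) i u : s <= u <= t ->
  is_ito P (fun v _ => v - s) (fun v w => W i v w) s u (C i u) ->
  {ae P, forall w, C i u w = (u - s) * x i w u - primitive s (x i w) u}.
Proof.
move=> /andP[]; rewrite le_eqVlt => /predU1P[<- _ /lim_partitions_refl h|su ut h].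
  apply: cvg_in_prob_ae_unique h _ => //.
    by move=> m; rewrite (_ : ito_sum _ _ _ _ _ = cst 0)//; apply/funext => w; rewrite /ito_sum big_geq.
  apply: aeW => w; rewrite subrr mul0r primitive_a subrr.
  by rewrite /ito_sum big_geq//; exact: cvg_cst.
apply: (cvg_in_prob_ae_unique _ _ (lim_partitions_grid su h)) => //.
  move=> m; rewrite ito_sum_grid.
  by apply: measurable_sum => k; apply: measurable_funM => //; exact: measurable_funB.
apply: aeW => w; under eq_fun do rewrite ito_sum_grid.
have := ito_time_cvg su (@cxu i w u ut).
by under eq_fun do under eq_bigr do rewrite -dW.
Qed.

(** The Stratonovich product rule: the two trapezoidal sums add up to a sum that telescopes exactly,
    on every grid. *)
Lemma strat_sym_ae (A : 'I_n -> 'I_n -> R -> {RV P >-> R}) i j u : s <= u <= t ->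
  (forall i j, is_stratonovich P (fun v w => increment W s v i w)
    (fun v w => W j v w) s u (A i j u)) ->
  {ae P, forall w, A i j u w + A j i u w = x i w u * x j w u}.
Proof.
move=> /andP[]; rewrite le_eqVlt => /predU1P[<- _|su ut] h.
  have S0 i' j' : stratonovich_sum (fun v w => increment W s v i' w)
      (fun v w => W j' v w) s s [::] = cst 0 :> (T -> R).
    by apply/funext => w; rewrite /stratonovich_sum big_geq.
  have mS i' j' : measurable_fun setT (stratonovich_sum (fun v w => increment W s v i' w)
      (fun v w => W j' v w) s s [::]) by rewrite S0.
  apply: (cvg_in_prob_ae_unique _ _ (cvg_in_probD _ _ _ _
    (lim_partitions_refl (h i j)) (lim_partitions_refl (h j i)))) => //.
  - by move=> m; exact: measurable_funD.
  - exact: measurable_funD.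
  - by apply: aeW => w; rewrite xs mul0r !S0 add0r; exact: cvg_cst.
have mS i' j' m : measurable_fun setT (stratonovich_sum (fun v w => increment W s v i' w)
      (fun v w => W j' v w) s u (grid_part s u m)).
  rewrite stratonovich_sum_grid.
  apply: measurable_sum => k; apply: measurable_funM; last exact: measurable_funB.
  by apply: measurable_funM => //; apply: measurable_funD; exact: mx.
apply: (cvg_in_prob_ae_unique _ _ (cvg_in_probD _ _ _ _
    (lim_partitions_grid su (h i j)) (lim_partitions_grid su (h j i)))) => //.
- by move=> m; exact: measurable_funD.
- exact: measurable_funD.
- apply: aeW => w; apply: cvg_near_cst; near=> m.
  have m0 : (0 < m)%N by near: m; exists 1%N.
  rewrite !stratonovich_sum_grid/= -big_split/=.
  have -> : x i w u * x j w u = \sum_(k < m)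
      (x i w (grid s u m k.+1) * x j w (grid s u m k.+1) - x i w (grid s u m k) * x j w (grid s u m k)).
    rewrite -(big_mkord xpredT (fun k => x i w (grid s u m k.+1) * x j w (grid s u m k.+1)
      - x i w (grid s u m k) * x j w (grid s u m k))).
    by rewrite telescope_sumr// gridn// grid0 xs mul0r subr0.
  by apply: eq_bigr => k _; rewrite !dW /x; field.
Unshelve. all: by end_near. Qed.

Lemma strat_primitive_ae (B : 'I_n -> 'I_n -> {RV P >-> R}) i j :
  is_stratonovich P (fun u w => \int[@lebesgue_measure R]_(v in `[s, u]) increment W s v i w)
    (fun u w => W j u w) s t (B i j) ->
  {ae P, forall w, B i j w = primitive s (x i w) t * x j w t -
     primitive s (fun u => x i w u * x j w u) t}.
Proof.
move=> h.
apply: (cvg_in_prob_ae_unique _ _ (lim_partitions_grid st h)) => //.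
  move=> m; rewrite stratonovich_sum_grid.
  apply: measurable_sum => k; apply: measurable_funM; last exact: measurable_funB.
  apply: measurable_funM => //; apply: measurable_funD; apply: mX; apply: grid_itv => //.
  exact: ltnW.
apply: aeW => w; under eq_fun do rewrite stratonovich_sum_grid.
have := strat_primitive_cvg st (@cx i w) (@cx j w).
by under eq_fun do under eq_bigr do rewrite -dW.
Qed.

(** Replacing [C] by [(u - s) * x - primitive s x] splits the sums into those of [strat_time_cvg]
    and two of the form of [strat_primitive_cvg], whose limits are known path by path. *)
Lemma strat_time_ae (C : 'I_n -> R -> {RV P >-> R}) (D : 'I_n -> 'I_n -> {RV P >-> R}) i j :
  (forall i u, s <= u <= t ->
    {ae P, forall w, C i u w = (u - s) * x i w u - primitive s (x i w) u}) ->
  (forall i j, is_stratonovich P (fun u w => C i u w) (fun u w => W j u w) s t (D i j)) ->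
  {ae P, forall w, D i j w + D j i w = (t - s) * x i w t * x j w t
    - primitive s (x i w) t * x j w t - primitive s (x j w) t * x i w t
    + primitive s (fun u => x i w u * x j w u) t}.
Proof.
move=> CE h.
have mS i' j' m : measurable_fun setT (stratonovich_sum (fun v w => C i' v w)
      (fun v w => W j' v w) s t (grid_part s t m)).
  rewrite stratonovich_sum_grid.
  apply: measurable_sum => k; apply: measurable_funM; last exact: measurable_funB.
  by apply: measurable_funM => //; apply: measurable_funD.
(* Each identity for [C] has its own null set; the points of all grids are countably many, so one
   null set suffices for them. *)
have Cgrid i' : {ae P, forall w, forall m k, (k <= m)%N -> C i' (grid s t m k) w =
    (grid s t m k - s) * x i' w (grid s t m k) - primitive s (x i' w) (grid s t m k)}.
  apply: ae_foralln => m; apply: ae_foralln => k.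
  have [km|mk] := leqP k m; last by apply: aeW.
  by apply: filterS (CE i' _ (grid_itv st km)) => w.
apply: (cvg_in_prob_ae_unique _ _ (cvg_in_probD _ _ _ _
    (lim_partitions_grid st (h i j)) (lim_partitions_grid st (h j i)))) => //.
- by move=> m; exact: measurable_funD.
- exact: measurable_funD.
apply: filterS2 (Cgrid i) (Cgrid j) => w Ci Cj.
have := cvgB (cvgB (strat_time_cvg st (@cx i w) (@cx j w))
  (strat_primitive_cvg st (@cx i w) (@cx j w))) (strat_primitive_cvg st (@cx j w) (@cx i w)).
have -> : primitive s (fun u => x j w u * x i w u) t = primitive s (fun u => x i w u * x j w u) t.
  by apply: eq_Rintegral => u _; rewrite mulrC.
set I := primitive s (fun u => x i w u * x j w u) t.
rewrite (_ : _ + I = (t - s) * x i w t * x j w t - I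
  - (primitive s (x i w) t * x j w t - I) - (primitive s (x j w) t * x i w t - I)); last by ring.
move=> /(_ _ _); apply: cvg_trans; apply: near_eq_cvg; apply: nearW => m.
rewrite !stratonovich_sum_grid/= -big_split/= !fctE -!sumrB; apply: eq_bigr => -[k km] _ /=.
by rewrite !dW !Ci ?Cj ?(ltnW km)//; field.
Qed.

(* Uniform partitions suffice, since limits in probability are unique; along
   them all the sums telescope to Riemann sums, which converge path by path. *)
Lemma sst_levy_area_ae (L : 'I_n -> 'I_n -> {RV P >-> R}) i j :
  is_sst_levy_area W s t L ->
  {ae P, forall w, 12 * L i j w = (t - s) * x i w t * x j w t
    - 3 * (primitive s (x i w) t * x j w t + primitive s (x j w) t * x i w t)
    + 6 * primitive s (fun u => x i w u * x j w u) t}.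
Proof.
move=> [A [B [C [D [hA hB hC hD hL]]]]].
have CE i' u : s <= u <= t ->
    {ae P, forall w, C i' u w = (u - s) * x i' w u - primitive s (x i' w) u}.
  by move=> su; apply: ito_time_ae => //; exact: (hC i').1.
have DE := strat_time_ae i j CE hD.
have BE := strat_primitive_ae (hB i j).
have BE' := strat_primitive_ae (hB j i).
(* Grid points are enough: [A] has continuous paths, so its integral over [[s, t]] is a limit of
   sums over these points. *)
have AE : {ae P, forall w, forall m k, (k <= m)%N ->
    A i j (grid s t m k) w + A j i (grid s t m k) w =
    x i w (grid s t m k) * x j w (grid s t m k)}.
  apply: ae_foralln => m; apply: ae_foralln => k.
  have [km|mk] := leqP k m; last by apply: aeW.
  have sk := grid_itv st km.
  have hAk i' j' : is_stratonovich P (fun v w => increment W s v i' w)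
    (fun v w => W j' v w) s (grid s t m k) (A i' j' (grid s t m k)) by exact: (hA i' j').1.
  by apply: filterS (strat_sym_ae i j sk hAk) => w.
apply: filterS2 (filterI (filterI AE DE) (filterI BE BE')) (hL i j) => w [[Aw Dw] [Bw Bw']] Lw.
have cA i' j' : {within `[s, t], continuous (fun u => A i' j' u w)} := (hA i' j').2 w.
have AI : primitive s (fun u => A i j u w) t + primitive s (fun u => A j i u w) t =
    primitive s (fun u => x i w u * x j w u) t.
  have h1 := riemann_cvg st (cA i j) (cell_approx_right _ _ (fun u => A i j u w)).
  have h2 := riemann_cvg st (cA j i) (cell_approx_right _ _ (fun u => A j i u w)).
  have h3 := riemann_cvg st (within_itvM (@cx i w) (@cx j w))
    (cell_approx_right _ _ (fun u => x i w u * x j w u)).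
  have h12 := cvgD h1 h2.
  apply: (cvg_unique _ (h12 _)) => //; apply: cvg_trans h3.
  apply: near_eq_cvg; apply: nearW => m; rewrite !fctE -mulrDr -big_split/=; congr (_ * _).
  by apply: eq_bigr => -[k km] _ /=; rewrite Aw.
have xC : primitive s (fun u => x j w u * x i w u) t = primitive s (fun u => x i w u * x j w u) t.
  by apply: eq_Rintegral => u _; rewrite mulrC.
rewrite xC in Bw'.
rewrite Lw -/(primitive s (fun u => A i j u w) t) -/(primitive s (fun u => A j i u w) t) AI.
rewrite Bw Bw' -[X in 12^-1 * X]addrA Dw.
by field.
Qed.

End sst_area.

(** * Brownian increments on a uniform grid *)

Section brownian_grid.
Context (disp : measure_display) (T : measurableType disp) (R : realType)
  (P : probability T R) (d : nat) (W : 'I_d -> R -> {RV P >-> R}).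
Hypothesis hW : brownian_motion W.
Context (s t : R).
Hypothesis hs : 0 <= s.
Hypothesis st : s < t.
Context (n : nat).
Hypothesis n0 : (0 < n)%N.
Local Notation g := (grid s t n).
Local Notation J := ('I_d * 'I_n)%type.

Definition grid_incr (j : J) : {RV P >-> R} := (W j.1 (g j.2.+1) \- W j.1 (g j.2))%R.

Local Notation sigma := (Num.sqrt ((t - s) / n%:R)).

Lemma grid_step_gt0 : 0 < (t - s) / n%:R.
Proof. by rewrite divr_gt0 ?subr_gt0 ?ltr0n. Qed.

Lemma grid_ge0 k : 0 <= g k.
Proof. by rewrite /grid addr_ge0// mulr_ge0// ltW// grid_step_gt0. Qed.

Lemma grid_incr_law j A : measurable A ->
  P (grid_incr j @^-1` A) = normal_prob 0 sigma A.
Proof.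
move=> mA; have [_ _ _] := hW.1 j.1.
move=> /(_ (g j.2) (g j.2.+1) (grid_ge0 _) (grid_lt st _ n0) A mA).
by rewrite gridS.
Qed.

(** Independence of the components of [W] is stated for the sigma-algebras of their whole paths, so
    the increments have to be located there. *)
Lemma grid_incr_sigma_family (j : J) (B : set R) : measurable B ->
  sigma_family `[0, +oo[ (fun u w => W j.1 u w) (grid_incr j @^-1` B).
Proof.
move=> mB.
pose G := \bigcup_(u in `[0, +oo[) preimage_set_system setT
  ((fun u w => W j.1 u w) u : T -> R) (@measurable _ R).
have mu u : 0 <= u -> measurable_fun setT ((fun w => W j.1 u w) : g_sigma_algebraType G -> R).
  move=> u0 _ A mA; apply: sub_gen_smallest; exists u; first by rewrite /= in_itv/= u0.
  by exists A.
have : measurable_fun setT ((fun w => W j.1 (g j.2.+1) w - W j.1 (g j.2) w) : g_sigma_algebraType G -> R).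
  by apply: measurable_funB; apply: mu; exact: grid_ge0.
by move=> /(_ measurableT B mB); rewrite setTI.
Qed.

(** Two levels: the components are independent of one another, and within a component the increments
    over disjoint cells are. The product over pairs is regrouped accordingly. *)
Lemma grid_incr_indep : mutually_independent P
  (fun j : J => preimage_set_system setT (grid_incr j) measurable).
Proof.
move=> E mE.
pose E' (i : 'I_d) := \bigcap_(k in [set: 'I_n]) E (i, k).
have -> : \bigcap_(j in [set: J]) E j = \bigcap_(i in [set: 'I_d]) E' i.
  apply/seteqP; split => w Ew; first by move=> i _ k _; exact: Ew.
  by move=> [i k] _; exact: (Ew i I k I).
rewrite hW.2; last first.
  move=> i; rewrite /E'.
  pose G := \bigcup_(u in `[0, +oo[) preimage_set_system setT
    ((fun u w => W i u w) u : T -> R) (@measurable _ R).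
  have mEk k : (measurable : set (set (g_sigma_algebraType G))) (E (i, k)).
    have [B mB <-] := mE (i, k); rewrite setTI.
    exact: (@grid_incr_sigma_family (i, k) B mB).
  by apply: (@fin_bigcap_measurable _ (g_sigma_algebraType G)) => // k _; exact: mEk.
transitivity (\prod_i \prod_k P (E (i, k)))%E; last first.
  by rewrite pair_bigA; apply: eq_bigr => -[].
apply: eq_bigr => i _; rewrite /E'.
have [_ _ indW _] := hW.1 i.
have := indW n g; rewrite grid0 => /(_ hs (fun k _ => grid_lt st k n0) (fun k => E (i, k))).
apply => k; exact: (mE (i, k)).
Qed.

(** The Wiener integral, against [W i], of the step function equal to [p k] on cell [k]. *)
Definition grid_sum (i : 'I_d) (p : nat -> R) (w : T) : R :=
  \sum_(k < n) p k * (W i (g k.+1) w - W i (g k) w).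

Let coef (i : 'I_d) (p : nat -> R) (j : J) : R := if j.1 == i then p j.2 else 0.

Let grid_sumE i p : grid_sum i p = lin grid_incr (coef i p).
Proof.
apply/funext => w; rewrite /grid_sum /lin -(pair_bigA _ (fun i' k => coef i p (i', k) * grid_incr (i', k) w))/=.
rewrite (bigD1 i)//= [X in _ = _ + X]big1 ?addr0.
  by apply: eq_bigr => k _; rewrite /coef/= eqxx.
move=> i' /negbTE ii'; apply: big1 => k _.
by rewrite /coef/= ii' mul0r.
Qed.

Let coef_mul i j p q :
  \sum_l coef i p l * coef j q l = (i == j)%:R * \sum_(k < n) p k * q k.
Proof.
rewrite -(pair_bigA _ (fun i' k => coef i p (i', k) * coef j q (i', k)))/=.
rewrite (bigD1 i)//= [X in _ + X]big1 ?addr0; last first.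
  move=> i' /negbTE ii'; apply: big1 => k _.
  by rewrite /coef/= ii' mul0r.
have [->|ij] := eqVneq i j.
  by rewrite mul1r; apply: eq_bigr => k _; rewrite /coef/= eqxx.
by rewrite mul0r; apply: big1 => k _; rewrite /coef/= (negbTE ij) mulr0.
Qed.

Lemma measurable_grid_sum i p : measurable_fun setT (grid_sum i p).
Proof. by rewrite grid_sumE; exact: measurable_lin. Qed.

Lemma integrable_grid_sum2 i j p q (F : T -> R) : measurable_fun setT F ->
  (forall w, `|F w| <= 1) ->
  P.-integrable setT (EFin \o (fun w => grid_sum i p w * grid_sum j q w * F w)).
Proof.
move=> mF F1; rewrite !grid_sumE.
have sigma0 : 0 < sigma by rewrite sqrtr_gt0 grid_step_gt0.
exact: (RintegrableM_bounded (integrable_lin2 sigma0 grid_incr_law _ _) mF F1).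
Qed.

Section grid_stein.
Context (M : finType) (phi phi' : 'I_d * M -> R -> R) (C : R) (v : M -> nat -> R).
Hypothesis dphi : forall m (x : R), is_derive x (1 : R) (phi m) (phi' m x).
Hypothesis cphi' : forall m, continuous (phi' m).
Hypothesis phi1 : forall m x, `|phi m x| <= 1.
Hypothesis phiC : forall m x, `|phi' m x| <= C.

Definition grid_test (w : T) : R := \prod_m phi m (grid_sum m.1 (v m.2) w).

Lemma grid_test_le1 w : `|grid_test w| <= 1.
Proof. exact: prod_seq_le1. Qed.

Lemma measurable_grid_test : measurable_fun setT grid_test.
Proof.
apply: measurable_prod => m _; apply: measurableT_comp; last exact: measurable_grid_sum.
apply: continuous_measurable_fun => x.
by apply: differentiable_continuous; apply/derivable1_diffP; exact: ex_derive.
Qed.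

(** [stein_lin] for Wiener integrals of step functions, the first of which must be orthogonal to
    every integrand that the test function really depends on. The factor in front is the Ito
    isometry. *)
Lemma grid_stein i j (p q : nat -> R) :
  (forall r, \sum_(k < n) p k * v r k = 0 \/ forall i x, phi' (i, r) x = 0) ->
  \int[P]_w (grid_sum i p w * grid_sum j q w * grid_test w) =
  (i == j)%:R * ((t - s) / n%:R * \sum_(k < n) p k * q k) * \int[P]_w grid_test w.
Proof.
move=> pv.
have := @stein_lin _ _ _ P _ grid_incr sigma _ grid_incr_law grid_incr_indep _ phi phi' C
  (fun m => coef m.1 (v m.2)) dphi cphi' phi1 phiC (coef i p) (coef j q).
rewrite sqrtr_gt0 => /(_ grid_step_gt0).
rewrite sqr_sqrtr ?ltW ?grid_step_gt0// coef_mul => H.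
transitivity (\int[P]_w (lin grid_incr (coef i p) w * (lin grid_incr (coef j q) w *
    \prod_m phi m (lin grid_incr (coef m.1 (v m.2)) w)))).
  apply: eq_Rintegral => w _; rewrite !grid_sumE mulrA; congr (_ * _).
  by apply: eq_bigr => m _; rewrite grid_sumE.
rewrite H; last first.
  move=> [i' r]; have [h|h] := pv r; last by right=> x; exact: h.
  by left; rewrite coef_mul h mulr0.
rewrite mulrCA mulrA; congr (_ * _).
by apply: eq_Rintegral => w _; apply: eq_bigr => m _; rewrite grid_sumE.
Qed.

End grid_stein.
End brownian_grid.

(** * Discrete Legendre polynomials *)

Section mean_poly.
Context (R : realType).
Local Notation tau n k := (k.+1%:R / n%:R : R).

(* the integral over [0, 1] of [x ^+ m * horner_rec c x] *)
Fixpoint integ01 (c : seq R) (m : nat) : R :=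
  if c is a :: c' then a / m.+1%:R + integ01 c' m.+1 else 0.

Lemma primitive01_exp m : primitive 0 (fun x : R => x ^+ m) 1 = m.+1%:R^-1.
Proof.
pose F (x : R) := m.+1%:R^-1 * x ^+ m.+1.
have dF (x : R) : is_derive x (1 : R) F (x ^+ m).
  rewrite (_ : F = m.+1%:R^-1 \*: (@id R ^+ m.+1)); last by apply/funext => y; rewrite !fctE.
  apply: is_derive_eq; rewrite /GRing.scale/= mulr1.
  by rewrite !mulrA mulVf ?pnatr_eq0// mul1r.
have cF : continuous F.
  by move=> x; apply: differentiable_continuous; apply/derivable1_diffP; exact: ex_derive.
rewrite /primitive /Rintegral (@continuous_FTC2 _ _ F)//.
- by rewrite /F expr1n expr0n/= mulr0 subr0 mulr1.
- by apply: continuous_subspaceT; exact: exprn_continuous.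
- split; first by move=> x _; exact: ex_derive.
  + by apply: cvg_at_right_filter; exact: cF.
  + by apply: cvg_at_left_filter; exact: cF.
- by move=> x _; rewrite derive1E derive_val.
Qed.

Lemma mean_exp_cvg m :
  n%:R^-1 * \sum_(k < n) tau n k ^+ m @[n --> \oo] --> (m.+1%:R^-1 : R).
Proof.
have cf : {within `[0 : R, 1], continuous (fun x : R => x ^+ m)}.
  by apply: continuous_subspaceT; exact: exprn_continuous.
have := riemann_cvg ltr01 cf (cell_approx_right _ _ (fun x : R => x ^+ m)).
rewrite primitive01_exp; apply: cvg_trans; apply: near_eq_cvg; apply: nearW => n.
rewrite subr0 mul1r; congr (_ * _); apply: eq_bigr => k _.
by rewrite /grid add0r subr0 mul1r.
Qed.

(** The list [c] holds coefficients by increasing degree, and the offset [m] serves the induction.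
    As [f] is given only up to pointwise equality, later limits reduce to two polynomial identities
    closed by [field]. *)
Lemma mean_poly_cvg c m (f : R -> R) :
  (forall x, f x = x ^+ m * horner_rec c x) ->
  n%:R^-1 * \sum_(k < n) f (tau n k) @[n --> \oo] --> integ01 c m.
Proof.
elim: c m f => [|a c IH] m f fE /=.
  rewrite (_ : (fun n => _) = cst 0); first exact: cvg_cst.
  by apply/funext => n; rewrite big1 ?mulr0// => k _; rewrite fE mulr0.
have h1 : a * (n%:R^-1 * \sum_(k < n) tau n k ^+ m) @[n --> \oo] --> a / m.+1%:R.
  by apply: cvgM; [exact: cvg_cst|exact: mean_exp_cvg].
have h2 := IH m.+1 (fun x => x ^+ m.+1 * horner_rec c x) (fun=> erefl).
have := cvgD h1 h2 => /(_ _); apply: cvg_trans; apply: near_eq_cvg; apply: nearW => n.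
rewrite fctE mulrCA -mulrDr mulr_sumr -big_split/=; congr (_ * _); apply: eq_bigr => k _.
by rewrite fE /= exprS; ring.
Qed.

End mean_poly.

Section legendre.
Context (R : realType) (n : nat).
Hypothesis n3 : (2 < n)%N.
Local Notation N := (n%:R : R).
Local Notation tau k := (k%:R / N).

(* discrete Legendre polynomials, evaluated at the midpoints of the cells of
   the uniform grid of [0, 1]; the paths W, H, K pair with 1, 1/2 - u and
   (u^2 - u + 1/6) / 2 *)
Definition legendre (r : nat) (k : nat) : R :=
  match r with
  | 0 => 1
  | 1 => 2^-1 - (k%:R + 2^-1) / N
  | _ => 2^-1 * (((k%:R + 2^-1) / N - 2^-1) ^+ 2 - (1 - N ^- 2) / 12)
  end.

(** The mean of [legendre r] squared over the cells. It vanishes for one cell if [r] is 1 or 2, and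
    for two cells if [r] is 2, whence the hypothesis of at least three cells. *)
Definition legendre_sqnorm (r : nat) : R :=
  match r with
  | 0 => 1
  | 1 => (1 - N ^- 2) / 12
  | _ => (1 - N ^- 2) * (1 - 4 * N ^- 2) / 720
  end.

(** The integrals from 0 to [x] of the limiting polynomials 1, 1/2 - u and (u^2 - u + 1/6) / 2; the
    last two vanish at both ends. *)
Definition legendre_primitive (r : nat) (x : R) : R :=
  match r with
  | 0 => x
  | 1 => x * (1 - x) / 2
  | _ => x * (1 - x) * (1 - 2 * x) / 12
  end.

Let N0 : N != 0. Proof. by rewrite pnatr_eq0; case: n n3. Qed.

(** Evaluation at midpoints and the correction [N ^- 2] in degree two make the partial sums agree
    with the primitives of the limiting polynomials without any error term. *)
Lemma sum_legendre r k : \sum_(l < k) legendre r l = N * legendre_primitive r (tau k).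
Proof.
case: r => [|[|r]]; elim: k => [|k IH]; rewrite ?big_ord0 ?big_ord_recr/=.
- by rewrite mul0r mulr0.
- by rewrite IH /= -natr1; field.
- by rewrite !mul0r mulr0.
- by rewrite IH /= -natr1; field.
- by rewrite !mul0r mulr0.
- by rewrite IH /= -natr1; field.
Qed.

Lemma sum_pow4 (c0 c1 c2 c3 c4 : R) k :
  \sum_(l < k) (c0 + c1 * l%:R + c2 * l%:R ^+ 2 + c3 * l%:R ^+ 3 + c4 * l%:R ^+ 4) =
  k%:R * (c0 + c1 * (k%:R - 1) / 2 + c2 * (k%:R - 1) * (2 * k%:R - 1) / 6
    + c3 * k%:R * (k%:R - 1) ^+ 2 / 4
    + c4 * (k%:R - 1) * (2 * k%:R - 1) * (3 * k%:R ^+ 2 - 3 * k%:R - 1) / 30).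
Proof.
elim: k => [|k IH]; first by rewrite big_ord0 mul0r.
by rewrite big_ord_recr/= IH -natr1; field.
Qed.

Lemma legendre_orthogonal r r' : (r < 3)%N -> (r' < 3)%N ->
  \sum_(l < n) legendre r l * legendre r' l = (r == r')%:R * (N * legendre_sqnorm r).
Proof.
(* [A] and [B] are the values of [legendre 1] and [legendre 2] at cell 0, from which the products
   are expanded in powers of [l]. *)
pose A := 2^-1 - (2 * N)^-1.
pose B := 2^-1 * (A ^+ 2 - (1 - N ^- 2) / 12).
have H12 : \sum_(l < n) legendre 1 l * legendre 2 l = 0.
  transitivity (\sum_(l < n) (A * B + (- A ^+ 2 / N - B / N) * l%:R
      + (3 / 2 * A / N ^+ 2) * l%:R ^+ 2 + (- (2 * N ^+ 3)^-1) * l%:R ^+ 3 + 0 * l%:R ^+ 4)).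
    by apply: eq_bigr => l _; rewrite /legendre /B /A; field.
  by rewrite sum_pow4 /B /A; field.
have H11 : \sum_(l < n) legendre 1 l * legendre 1 l = N * legendre_sqnorm 1.
  transitivity (\sum_(l < n) (A ^+ 2 + (- 2 * A / N) * l%:R
      + (N ^- 2) * l%:R ^+ 2 + 0 * l%:R ^+ 3 + 0 * l%:R ^+ 4)).
    by apply: eq_bigr => l _; rewrite /legendre /A; field.
  by rewrite sum_pow4 /legendre_sqnorm /A; field.
have H22 : \sum_(l < n) legendre 2 l * legendre 2 l = N * legendre_sqnorm 2.
  transitivity (\sum_(l < n) (B ^+ 2 + (- 2 * A * B / N) * l%:R
      + (A ^+ 2 / N ^+ 2 + B / N ^+ 2) * l%:R ^+ 2 + (- A / N ^+ 3) * l%:R ^+ 3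
      + (4 * N ^+ 4)^-1 * l%:R ^+ 4)).
    by apply: eq_bigr => l _; rewrite /legendre /B /A; field.
  by rewrite sum_pow4 /legendre_sqnorm /B /A; field.
have NN : tau n = 1 by rewrite divff.
have H0 q : (0 < q)%N -> \sum_(l < n) legendre q l = 0.
  by move=> q0; rewrite sum_legendre NN; case: q q0 => // -[|q] _ /=; field.
have H00 : \sum_(l < n) legendre 0 l = N * legendre_sqnorm 0.
  by rewrite sum_legendre NN.
move: r r' => [|[|[|//]]] [|[|[|//]]] _ _ /=; rewrite ?mul1r ?mul0r.
- exact: H00.
- by under eq_bigr do rewrite mul1r; exact: (H0 1%N).
- by under eq_bigr do rewrite mul1r; exact: (H0 2%N).
- by under eq_bigr do rewrite mulr1; exact: (H0 1%N).
- exact: H11.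
- exact: H12.
- by under eq_bigr do rewrite mulr1; exact: (H0 2%N).
- by under eq_bigr do rewrite mulrC; exact: H12.
- exact: H22.
Qed.

Lemma legendre_sqnorm_neq0 r : legendre_sqnorm r != 0.
Proof.
have N2 : N ^+ 2 != 0 by rewrite expf_neq0.
have N9 : 9 <= N ^+ 2.
  have : 3 <= N by rewrite ler_nat.
  nra.
have h1 : 1 - N ^- 2 != 0.
  rewrite (_ : 1 - N ^- 2 = (N ^+ 2 - 1) / N ^+ 2); last by field.
  by rewrite mulf_neq0 ?invr_eq0// gt_eqF//; lra.
have h2 : 1 - 4 * N ^- 2 != 0.
  rewrite (_ : 1 - 4 * N ^- 2 = (N ^+ 2 - 4) / N ^+ 2); last by field.
  by rewrite mulf_neq0 ?invr_eq0// gt_eqF//; lra.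
have k12 : 12^-1 != 0 :> R by rewrite invr_eq0 pnatr_eq0.
have k720 : 720^-1 != 0 :> R by rewrite invr_eq0 pnatr_eq0.
case: r => [|[|r]] /=; first exact: oner_neq0.
  exact: mulf_neq0 h1 k12.
exact: mulf_neq0 (mulf_neq0 h1 h2) k720.
Qed.

Lemma sum_below (f : nat -> R) k : (k <= n)%N ->
  \sum_(l < n) (l < k)%N%:R * f l = \sum_(l < k) f l.
Proof.
move=> kn; rewrite (big_ord_widen n f kn) [RHS]big_mkcond/=.
by apply: eq_bigr => l _; case: ltnP => _; rewrite ?mul1r ?mul0r.
Qed.

(** The coefficient of the indicator of the first [k] cells along [legendre r]: by [sum_legendre]
    their mean product is the primitive at [k / n]. *)
Definition legendre_coef r k := legendre_primitive r (tau k) / legendre_sqnorm r.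

Definition legendre_rest k (l : nat) : R :=
  (l < k)%N%:R - \sum_(r < 3) legendre_coef r k * legendre r l.

Lemma legendre_rest_orthogonal k r : (k <= n)%N -> (r < 3)%N ->
  \sum_(l < n) legendre_rest k l * legendre r l = 0.
Proof.
move=> kn r3; rewrite /legendre_rest.
under eq_bigr do rewrite mulrBl mulr_suml.
rewrite sumrB sum_below// sum_legendre exchange_big/=.
rewrite (bigD1 (Ordinal r3))//= [X in _ - (_ + X)]big1 ?addr0.
  under eq_bigr do rewrite -mulrA.
  rewrite -mulr_sumr legendre_orthogonal// eqxx mul1r /legendre_coef.
  by have := legendre_sqnorm_neq0 r; set q := legendre_sqnorm r => q0; field.
move=> r' r'r; under eq_bigr do rewrite -mulrA.
rewrite -mulr_sumr legendre_orthogonal//.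
by rewrite -(inj_eq val_inj)/= in r'r; rewrite (negbTE r'r) mul0r mulr0.
Qed.

(** The rest is orthogonal to the three polynomials, so its product with the indicator is also its
    squared norm; up to the step size this is the variance of the Gaussian rest at time [k]. *)
Lemma legendre_rest_below k : (k <= n)%N ->
  \sum_(l < n) legendre_rest k l * (l < k)%N%:R =
  N * (tau k - \sum_(r < 3) legendre_primitive r (tau k) ^+ 2 / legendre_sqnorm r).
Proof.
move=> kn; under eq_bigr do rewrite mulrC.
rewrite sum_below// /legendre_rest sumrB exchange_big/= mulrBr mulr_sumr.
congr (_ - _).
  rewrite -[LHS]/(\sum_(l < k) (l < k)%N%:R).
  rewrite (eq_bigr (fun=> 1)); last by move=> l _; rewrite ltn_ord.
  by rewrite sumr_const card_ord -mulr_natr mul1r mulrC divfK.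
apply: eq_bigr => r _; rewrite -mulr_sumr sum_legendre /legendre_coef expr2.
by have := legendre_sqnorm_neq0 r; set q := legendre_sqnorm r => q0; field.
Qed.

End legendre.

Section legendre_limits.
Context (R : realType).
Local Notation tau n k := (k.+1%:R / n%:R : R).

Lemma invn_cvg0 : (n%:R^-1 : R) @[n --> \oo] --> 0.
Proof. by rewrite -cvg_shiftS; exact: cvg_harmonic. Qed.

Lemma invn2_cvg0 : (n%:R ^- 2 : R) @[n --> \oo] --> 0.
Proof.
rewrite (_ : (fun n => _) = fun n => n%:R^-1 * n%:R^-1); last first.
  by apply/funext => n; rewrite -exprVn expr2.
by rewrite -[X in _ --> X](mul0r (0 : R)); apply: (cvgM invn_cvg0 invn_cvg0).
Qed.

Definition legendre_sqnorm_lim (r : nat) : R :=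
  match r with 0 => 1 | 1 => 12^-1 | _ => 720^-1 end.

Lemma legendre_sqnorm_cvg r :
  legendre_sqnorm R n r @[n --> \oo] --> legendre_sqnorm_lim r.
Proof.
case: r => [|[|r]] /=; first exact: cvg_cst.
  rewrite [X in _ --> X](_ : _ = (1 - 0) / 12); last by rewrite subr0 mul1r.
  by apply: cvgM; [apply: cvgB; [exact: cvg_cst|exact: invn2_cvg0]|exact: cvg_cst].
rewrite [X in _ --> X](_ : _ = (1 - 0) * (1 - 4 * 0) / 720); last by rewrite mulr0 subr0 !mul1r.
apply: cvgM; last exact: cvg_cst.
apply: cvgM; first by apply: cvgB; [exact: cvg_cst|exact: invn2_cvg0].
by apply: cvgB; [exact: cvg_cst|apply: cvgM; [exact: cvg_cst|exact: invn2_cvg0]].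
Qed.

(* Entry [(r, r')] is the integral over [0, 1] of [p r * p r'], where [p r] is the
   limit of [legendre_primitive r / legendre_sqnorm r]. *)
Definition gram_lim (r r' : nat) : R :=
  match r, r' with
  | 0, 0 => 3^-1
  | 0, 1 => 2^-1
  | 1, 0 => 2^-1
  | 0, 2 => -1
  | 2, 0 => -1
  | 1, 1 => 6 / 5
  | 2, 2 => 120 / 7
  | _, _ => 0
  end.

Definition gram n (r r' : nat) : R :=
  n%:R^-1 * \sum_(k < n) legendre_coef R n r k.+1 * legendre_coef R n r' k.+1.

Lemma mean_primitive2_cvg r r' : (r < 3)%N -> (r' < 3)%N ->
  n%:R^-1 * \sum_(k < n) legendre_primitive r (tau n k) * legendre_primitive r' (tau n k)
    @[n --> \oo] --> gram_lim r r' * (legendre_sqnorm_lim r * legendre_sqnorm_lim r').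
Proof.
have H01 := @mean_poly_cvg R [:: 0; 0; 2^-1; - 2^-1] 0
  (fun x => legendre_primitive 0 x * legendre_primitive 1 x).
have H02 := @mean_poly_cvg R [:: 0; 0; 12^-1; - 3 / 12; 2 / 12] 0
  (fun x => legendre_primitive 0 x * legendre_primitive 2 x).
have H12 := @mean_poly_cvg R [:: 0; 0; 24^-1; - 4 / 24; 5 / 24; - 2 / 24] 0
  (fun x => legendre_primitive 1 x * legendre_primitive 2 x).
move: r r' => [|[|[|//]]] [|[|[|//]]] _ _ /=.
- rewrite [X in _ --> X](_ : _ = integ01 [:: 0; 0; 1] 0); last by rewrite /=; field.
  by apply: (@mean_poly_cvg R _ 0 (fun x => legendre_primitive 0 x * legendre_primitive 0 x))
    => x /=; field.
- rewrite [X in _ --> X](_ : _ = integ01 [:: 0; 0; 2^-1; - 2^-1] 0); last by rewrite /=; field.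
  by apply: H01 => x /=; field.
- rewrite [X in _ --> X](_ : _ = integ01 [:: 0; 0; 12^-1; - 3 / 12; 2 / 12] 0); last by rewrite /=; field.
  by apply: H02 => x /=; field.
- rewrite [X in _ --> X](_ : _ = integ01 [:: 0; 0; 2^-1; - 2^-1] 0); last by rewrite /=; field.
  by under eq_fun do under eq_bigr do rewrite mulrC; apply: H01 => x /=; field.
- rewrite [X in _ --> X](_ : _ = integ01 [:: 0; 0; 4^-1; - 2 / 4; 4^-1] 0); last by rewrite /=; field.
  by apply: (@mean_poly_cvg R _ 0 (fun x => legendre_primitive 1 x * legendre_primitive 1 x))
    => x /=; field.
- rewrite [X in _ --> X](_ : _ = integ01 [:: 0; 0; 24^-1; - 4 / 24; 5 / 24; - 2 / 24] 0); last by rewrite /=; field.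
  by apply: H12 => x /=; field.
- rewrite [X in _ --> X](_ : _ = integ01 [:: 0; 0; 12^-1; - 3 / 12; 2 / 12] 0); last by rewrite /=; field.
  by under eq_fun do under eq_bigr do rewrite mulrC; apply: H02 => x /=; field.
- rewrite [X in _ --> X](_ : _ = integ01 [:: 0; 0; 24^-1; - 4 / 24; 5 / 24; - 2 / 24] 0); last by rewrite /=; field.
  by under eq_fun do under eq_bigr do rewrite mulrC; apply: H12 => x /=; field.
- rewrite [X in _ --> X](_ : _ = integ01
    [:: 0; 0; 144^-1; - 6 / 144; 13 / 144; - 12 / 144; 4 / 144] 0); last by rewrite /=; field.
  by apply: (@mean_poly_cvg R _ 0 (fun x => legendre_primitive 2 x * legendre_primitive 2 x))
    => x /=; field.
Qed.

Lemma legendre_sqnorm_lim_neq0 r : legendre_sqnorm_lim r != 0.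
Proof.
have k12 : 12^-1 != 0 :> R by rewrite invr_eq0 pnatr_eq0.
have k720 : 720^-1 != 0 :> R by rewrite invr_eq0 pnatr_eq0.
by case: r => [|[|r]] /=; [exact: oner_neq0|exact: k12|exact: k720].
Qed.

Lemma gram_cvg r r' : (r < 3)%N -> (r' < 3)%N ->
  gram n r r' @[n --> \oo] --> gram_lim r r'.
Proof.
move=> r3 r'3.
have h := mean_primitive2_cvg r3 r'3.
have nz : legendre_sqnorm_lim r * legendre_sqnorm_lim r' != 0.
  by rewrite mulf_neq0// legendre_sqnorm_lim_neq0.
have hs : (legendre_sqnorm R n r * legendre_sqnorm R n r')^-1 @[n --> \oo] -->
    (legendre_sqnorm_lim r * legendre_sqnorm_lim r')^-1.
  by apply: (cvgV nz); apply: cvgM; exact: legendre_sqnorm_cvg.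
rewrite -[X in _ --> X](mulfK nz).
rewrite (_ : (fun n => _) = fun n => n%:R^-1 * (\sum_(k < n) legendre_primitive r (tau n k)
    * legendre_primitive r' (tau n k)) * (legendre_sqnorm R n r * legendre_sqnorm R n r')^-1).
  exact: (cvgM h hs).
apply/funext => n; rewrite /gram -mulrA; congr (_ * _).
rewrite mulr_suml; apply: eq_bigr => k _.
by rewrite /legendre_coef invfM; ring.
Qed.

(** The time average of the variance of the rest: 1/2 - 1/3 - (6/5) / 12 - (120/7) / 720. *)
Lemma rest_cvg : n%:R^-1 * \sum_(k < n) (tau n k -
    \sum_(r < 3) legendre_primitive r (tau n k) ^+ 2 / legendre_sqnorm R n r)
  @[n --> \oo] --> (3 / 70 : R).
Proof.
have h0 : n%:R^-1 * \sum_(k < n) tau n k @[n --> \oo] --> (2^-1 : R).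
  rewrite [X in _ --> X](_ : _ = integ01 [:: 0; 1] 0); last by rewrite /=; field.
  by apply: (@mean_poly_cvg R _ 0 (fun x => x)) => x /=; field.
have h r : (r < 3)%N -> n%:R^-1 * \sum_(k < n) legendre_primitive r (tau n k) * legendre_primitive r (tau n k)
   * (legendre_sqnorm R n r)^-1 @[n --> \oo] --> gram_lim r r * legendre_sqnorm_lim r.
  move=> r3; have nz := legendre_sqnorm_lim_neq0 r.
  rewrite -[X in _ --> X](mulfK nz) -[X in X / _]mulrA.
  rewrite (_ : (fun n => _) = fun n => n%:R^-1 * (\sum_(k < n) legendre_primitive r (tau n k)
    * legendre_primitive r (tau n k)) * (legendre_sqnorm R n r)^-1).
    apply: cvgM; first exact: mean_primitive2_cvg.
    by apply: (cvgV nz); exact: legendre_sqnorm_cvg.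
  by apply/funext => n; rewrite -mulrA mulr_suml.
rewrite [X in _ --> X](_ : _ = 2^-1 - gram_lim 0 0 * legendre_sqnorm_lim 0
  - gram_lim 1 1 * legendre_sqnorm_lim 1 - gram_lim 2 2 * legendre_sqnorm_lim 2); last first.
  by rewrite /=; field.
pose m r n := n%:R^-1 * \sum_(k < n) legendre_primitive r (tau n k) *
  legendre_primitive r (tau n k) * (legendre_sqnorm R n r)^-1.
rewrite (_ : (fun n => _) = fun n =>
    n%:R^-1 * (\sum_(k < n) tau n k) - m 0%N n - m 1%N n - m 2%N n); last first.
  apply/funext => n; rewrite /m -!mulrBr -!sumrB; congr (_ * _); apply: eq_bigr => k _.
  by rewrite !big_ord_recr/= big_ord0 /= !expr2; ring.
by apply: cvgB; [apply: cvgB; [apply: cvgB|]|]; [exact: h0|exact: h..].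
Qed.

End legendre_limits.

(** * Legendre coefficients of a path *)

(** Nonnegativity of the empirical variance. *)
Lemma sqr_mean_le (R : realType) n (y : nat -> R) :
  (n%:R^-1 * \sum_(k < n) y k) ^+ 2 <= n%:R^-1 * \sum_(k < n) y k ^+ 2.
Proof.
case: n => [|n]; first by rewrite !big_ord0 !mulr0 expr0n.
set N := n.+1%:R; have N0 : 0 < N by rewrite ltr0n.
set S := \sum_(k < n.+1) y k; set S2 := \sum_(k < n.+1) _.
have : 0 <= \sum_(k < n.+1) (y k - N^-1 * S) ^+ 2.
  by apply: sumr_ge0 => k _; exact: sqr_ge0.
rewrite (_ : \sum_(k < n.+1) (y k - N^-1 * S) ^+ 2 =
    S2 - 2 * (N^-1 * S) * S + N * (N^-1 * S) ^+ 2); last first.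
  have -> : 2 * (N^-1 * S) * S = \sum_(k < n.+1) 2 * (N^-1 * S) * y k by rewrite -mulr_sumr.
  rewrite /S2 -sumrB.
  have -> : N * (N^-1 * S) ^+ 2 = \sum_(k < n.+1) (N^-1 * S) ^+ 2.
    by rewrite sumr_const card_ord mulr_natl.
  by rewrite -big_split/=; apply: eq_bigr => k _; ring.
rewrite (_ : S2 - _ + _ = N * (N^-1 * S2 - (N^-1 * S) ^+ 2)); last first.
  by field; rewrite gt_eqF.
by rewrite pmulr_rge0// subr_ge0.
Qed.

Section path_legendre.
Context (R : realType) (a b : R).
Hypothesis ab : a < b.
Variable x : R -> R.
Hypothesis cx : {within `[a, b], continuous x}.
Hypothesis xa : x a = 0.
Local Notation g := (grid a b).
Local Notation h := (b - a).

Definition path_legendre n r : R :=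
  \sum_(k < n) legendre R n r k * (x (g n k.+1) - x (g n k)).

Let bridge u := x u - (u - a) / h * x b.

Lemma path_legendreE n r : (0 < n)%N -> path_legendre n r =
  legendre R n r n * x b -
  \sum_(k < n) (legendre R n r k.+1 - legendre R n r k) * x (g n k.+1).
Proof.
move=> n0.
have -> : legendre R n r n * x b = \sum_(k < n)
    (legendre R n r k.+1 * x (g n k.+1) - legendre R n r k * x (g n k)).
  rewrite -(big_mkord xpredT (fun k => legendre R n r k.+1 * x (g n k.+1) - legendre R n r k * x (g n k))).
  by rewrite telescope_sumr// gridn// grid0 xa mulr0 subr0.
by rewrite -sumrB; apply: eq_bigr => k _; ring.
Qed.

Let h0 : h != 0. Proof. by rewrite subr_eq0 gt_eqF. Qed.

Let cbridge : {within `[a, b], continuous bridge}.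
Proof.
move=> u; apply: cvgB; first exact: cx.
apply: cvgM; last exact: cvg_cst.
apply: cvgM; last exact: cvg_cst.
apply: cvgB; last exact: cvg_cst.
exact: (@continuous_subspaceT _ _ _ _ (fun y => @cvg_id _ (nbhs y))).
Qed.

Let tauE n k : (0 < n)%N -> (g n k.+1 - a) / h = k.+1%:R / n%:R.
Proof.
move=> n0; have nn : n%:R != 0 :> R by rewrite pnatr_eq0 -lt0n.
by rewrite /grid; field; rewrite nn h0.
Qed.

Lemma path_legendre0 n : (0 < n)%N -> path_legendre n 0 = x b.
Proof.
move=> n0; rewrite path_legendreE//= mul1r big1 ?subr0// => k _.
by rewrite subrr mul0r.
Qed.

(** Summation by parts turns the coefficient into a mean of [x] over the grid plus a boundary term.
    Passing from [x] to the bridge costs a multiple of [x b], whose factor tends to 1/2 and is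
    cancelled by the boundary value tending to -1/2. *)
Lemma path_legendre1_cvg : path_legendre n 1 @[n --> \oo] -->
  h^-1 * primitive a bridge b.
Proof.
have c1 : h^-1 * (h / n%:R * \sum_(k < n) bridge (g n k.+1)) @[n --> \oo] -->
    h^-1 * primitive a bridge b.
  apply: cvgM; first exact: cvg_cst.
  exact: (riemann_cvg ab cbridge (cell_approx_right a b bridge)).
have c2 : (n%:R^-1 * \sum_(k < n) (k.+1%:R / n%:R) + legendre R n 1 n) * x b
    @[n --> \oo] --> (2^-1 + - 2^-1) * x b.
  apply: cvgM; last exact: cvg_cst.
  apply: cvgD.
    rewrite [X in _ --> X](_ : _ = integ01 [:: 0; 1] 0); last by rewrite /=; field.
    by apply: (@mean_poly_cvg R _ 0 (fun x => x)) => y /=; field.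
  have : - 2^-1 - 2^-1 * n%:R^-1 @[n --> \oo] --> - 2^-1 - 2^-1 * (0 : R).
    apply: cvgB; first exact: cvg_cst.
    by apply: cvgM; [exact: cvg_cst|exact: invn_cvg0].
  rewrite mulr0 subr0; apply: cvg_trans; apply: near_eq_cvg; near=> n.
  have n0 : (0 < n)%N by near: n; exists 1%N.
  by rewrite /=; field; rewrite pnatr_eq0 -lt0n.
rewrite -[X in _ --> X]addr0 -[X in _ --> _ + X](mul0r (x b)) -(subrr (2^-1 : R)).
have := cvgD c1 c2 => /(_ _); apply: cvg_trans; apply: near_eq_cvg; near=> n.
have n0 : (0 < n)%N by near: n; exists 1%N.
have nn : n%:R != 0 :> R by rewrite pnatr_eq0 -lt0n.
rewrite fctE path_legendreE//.
have -> : \sum_(k < n) (legendre R n 1 k.+1 - legendre R n 1 k) * x (g n k.+1) =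
    - n%:R^-1 * \sum_(k < n) x (g n k.+1).
  rewrite mulr_sumr; apply: eq_bigr => k _; rewrite /legendre -natr1; by field.
have -> : \sum_(k < n) bridge (g n k.+1) =
    \sum_(k < n) x (g n k.+1) - (\sum_(k < n) k.+1%:R / n%:R) * x b.
  by rewrite mulr_suml -sumrB; apply: eq_bigr => k _; rewrite /bridge tauE.
by field; rewrite nn h0.
Unshelve. all: by end_near. Qed.

Lemma path_legendre2_cvg : path_legendre n 2 @[n --> \oo] -->
  (h ^+ 2)^-1 * primitive a (fun u => bridge u * (h / 2 - (u - a))) b.
Proof.
have cf : {within `[a, b], continuous (fun u => bridge u * (h / 2 - (u - a)))}.
  move=> u; apply: cvgM; first exact: cbridge.
  apply: cvgB; first exact: cvg_cst.
  apply: cvgB; last exact: cvg_cst.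
  exact: (@continuous_subspaceT _ _ _ _ (fun y => @cvg_id _ (nbhs y))).
have c1 : (h ^+ 2)^-1 * (h / n%:R * \sum_(k < n) (bridge (g n k.+1) * (h / 2 - (g n k.+1 - a))))
    @[n --> \oo] --> (h ^+ 2)^-1 * primitive a (fun u => bridge u * (h / 2 - (u - a))) b.
  apply: cvgM; first exact: cvg_cst.
  exact: (riemann_cvg ab cf (cell_approx_right a b _)).
(* Here the linear part of the bridge contributes the integral of x (1/2 - x), that is -1/12,
   against the boundary value 1/12. *)
have c2 : (n%:R^-1 * \sum_(k < n) (k.+1%:R / n%:R * (2^-1 - k.+1%:R / n%:R))
    + legendre R n 2 n) * x b @[n --> \oo] --> (- 12^-1 + 12^-1) * x b.
  apply: cvgM; last exact: cvg_cst.
  apply: cvgD.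
    rewrite [X in _ --> X](_ : _ = integ01 [:: 0; 2^-1; -1] 0); last by rewrite /=; field.
    by apply: (@mean_poly_cvg R _ 0 (fun x => x * (2^-1 - x))) => y /=; field.
  have : 2^-1 * ((2^-1 + 2^-1 * n%:R^-1) * (2^-1 + 2^-1 * n%:R^-1) - (1 - n%:R ^- 2) / 12)
      @[n --> \oo] -->
      2^-1 * ((2^-1 + 2^-1 * 0) * (2^-1 + 2^-1 * 0) - (1 - 0) / 12 : R).
    apply: cvgM; first exact: cvg_cst.
    have c3 : 2^-1 + 2^-1 * n%:R^-1 @[n --> \oo] --> 2^-1 + 2^-1 * (0 : R).
      apply: cvgD; first exact: cvg_cst.
      by apply: cvgM; [exact: cvg_cst|exact: invn_cvg0].
    apply: cvgB; first exact: (cvgM c3 c3).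
    apply: cvgM; last exact: cvg_cst.
    by apply: cvgB; [exact: cvg_cst|exact: invn2_cvg0].
  rewrite [X in _ --> X -> _](_ : _ = 12^-1); last by field.
  apply: cvg_trans; apply: near_eq_cvg; near=> n.
  have n0 : (0 < n)%N by near: n; exists 1%N.
  by rewrite /=; field; rewrite pnatr_eq0 -lt0n.
rewrite -[X in _ --> X]addr0 -[X in _ --> _ + X](mul0r (x b)) -(addNr (12^-1 : R)).
have := cvgD c1 c2 => /(_ _); apply: cvg_trans; apply: near_eq_cvg; near=> n.
have n0 : (0 < n)%N by near: n; exists 1%N.
have nn : n%:R != 0 :> R by rewrite pnatr_eq0 -lt0n.
rewrite fctE path_legendreE//.
have -> : \sum_(k < n) (legendre R n 2 k.+1 - legendre R n 2 k) * x (g n k.+1) =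
    - n%:R^-1 * \sum_(k < n) x (g n k.+1) * (2^-1 - k.+1%:R / n%:R).
  rewrite mulr_sumr; apply: eq_bigr => k _; rewrite /legendre -natr1; by field.
have -> : \sum_(k < n) bridge (g n k.+1) * (h / 2 - (g n k.+1 - a)) =
    h * (\sum_(k < n) x (g n k.+1) * (2^-1 - k.+1%:R / n%:R)
      - (\sum_(k < n) k.+1%:R / n%:R * (2^-1 - k.+1%:R / n%:R)) * x b).
  rewrite mulr_suml -sumrB mulr_sumr; apply: eq_bigr => k _.
  have -> : g n k.+1 - a = k.+1%:R / n%:R * h by rewrite -(tauE _ n0) divfK.
  by rewrite /bridge tauE//; field.
by field; rewrite nn h0.
Unshelve. all: by end_near. Qed.

Lemma path_legendre1_primitive :
  h^-1 * primitive a bridge b = h^-1 * primitive a x b - x b / 2.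
Proof.
have c1 : h^-1 * (h / n%:R * \sum_(k < n) x (g n k.+1)) - (n%:R^-1 * \sum_(k < n) (k.+1%:R / n%:R)) * x b
    @[n --> \oo] --> h^-1 * primitive a x b - 2^-1 * x b.
  apply: cvgB.
    apply: cvgM; first exact: cvg_cst.
    exact: (riemann_cvg ab cx (cell_approx_right a b x)).
  apply: cvgM; last exact: cvg_cst.
  rewrite [X in _ --> X](_ : _ = integ01 [:: 0; 1] 0); last by rewrite /=; field.
  by apply: (@mean_poly_cvg R _ 0 (fun x => x)) => y /=; field.
have c2 : h^-1 * (h / n%:R * \sum_(k < n) bridge (g n k.+1)) @[n --> \oo] -->
    h^-1 * primitive a bridge b.
  apply: cvgM; first exact: cvg_cst.
  exact: (riemann_cvg ab cbridge (cell_approx_right a b bridge)).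
rewrite [x b / 2]mulrC; apply: (cvg_unique _ c2) => //.
apply: cvg_trans c1; apply: near_eq_cvg; near=> n.
have n0 : (0 < n)%N by near: n; exists 1%N.
rewrite !mulrA (_ : h^-1 * h = 1) ?mulVf// mul1r -mulrA -mulrBr; congr (_ * _).
rewrite mulr_suml -sumrB; apply: eq_bigr => k _.
by rewrite /bridge tauE.
Unshelve. all: by end_near. Qed.

(** A common bound for the fourth powers of the three coefficients, with expectation bounded
    uniformly in [n]. *)
Definition path_moment n : R := x b ^+ 4 + n%:R^-1 * \sum_(k < n) x (g n k.+1) ^+ 4.

Lemma path_moment_ge0 n : 0 <= path_moment n.
Proof.
rewrite /path_moment addr_ge0 ?exprn_even_ge0// mulr_ge0//.
by apply: sumr_ge0 => k _; rewrite exprn_even_ge0.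
Qed.

(** After summation by parts the boundary value is at most 1 and the jumps at most [1 / n], so the
    coefficient is at most [|x b|] plus the mean of [|x|]. Two uses of [sqr_mean_le] bound the
    fourth power of that mean, and 8 comes from (A + m)^4 <= 8 (A^4 + m^4). *)
Lemma path_legendre_pow4 n r : (2 < n)%N -> (r < 3)%N ->
  path_legendre n r ^+ 4 <= 8 * path_moment n.
Proof.
move=> n3 r3; have n0 : (0 < n)%N by exact: ltn_trans n3.
pose N : R := n%:R; have N3 : 3 <= N by rewrite ler_nat.
have N0 : 0 < N by rewrite ltr0n.
have Ni : 0 < N^-1 by rewrite invr_gt0.
have Ni3 : N^-1 <= 3^-1 by rewrite lef_pV2 ?posrE.
have nn : N != 0 by rewrite gt_eqF.
have b1 : `|legendre R n r n| <= 1.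
  case: r r3 => [|[|[|//]]] _ /=; first by rewrite normr1.
    rewrite (_ : _ - _ = - (2^-1 + 2^-1 * N^-1)); last by rewrite /N; field.
    by rewrite ler_norml; apply/andP; split; lra.
  rewrite (_ : 2^-1 * _ = 12^-1 + 4^-1 * N^-1 + 6^-1 * N^-1 * N^-1); last by rewrite /N; field.
  by rewrite ler_norml; apply/andP; split; nra.
have b2 k : (k < n)%N -> `|legendre R n r k.+1 - legendre R n r k| <= N^-1.
  move=> kn; case: r r3 {b1} => [|[|[|//]]] _ /=; first by rewrite subrr normr0 ltW.
    rewrite (_ : _ - _ = - N^-1); last by rewrite /N -natr1; field.
    by rewrite normrN ger0_norm// ltW.
  rewrite (_ : _ - _ = N^-1 * (k.+1%:R / N - 2^-1)); last by rewrite /N -natr1; field.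
  rewrite normrM (ger0_norm (ltW Ni)); apply: ler_piMr; first exact: ltW.
  have h1 : k.+1%:R / N <= 1 by rewrite ler_pdivrMr// mul1r ler_nat.
  have h2 : 0 <= k.+1%:R / N by rewrite divr_ge0// ltW.
  by rewrite ler_norml; apply/andP; split; lra.
pose m := N^-1 * \sum_(k < n) `|x (g n k.+1)|.
have m0 : 0 <= m by rewrite mulr_ge0 ?(ltW Ni)// sumr_ge0.
have b3 : `|path_legendre n r| <= `|x b| + m.
  rewrite path_legendreE//; apply: (le_trans (ler_normB _ _)); apply: lerD.
    by rewrite normrM ler_piMl.
  apply: (le_trans (ler_norm_sum _ _ _)); rewrite /m mulr_sumr.
  by apply: ler_sum => -[k kn] _ /=; rewrite normrM ler_wpM2r// b2.
have m4 : m ^+ 4 <= n%:R^-1 * \sum_(k < n) x (g n k.+1) ^+ 4.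
  rewrite (_ : m ^+ 4 = (m ^+ 2) ^+ 2); last by rewrite -exprM.
  have h1 := sqr_mean_le n (fun k => `|x (g n k.+1)|).
  have h2 := sqr_mean_le n (fun k => `|x (g n k.+1)| ^+ 2).
  apply: le_trans (le_trans h2 _).
    by rewrite ler_sqr ?nnegrE ?sqr_ge0// mulr_ge0 ?(ltW Ni)// sumr_ge0// => k _; exact: sqr_ge0.
  apply: ler_wpM2l; first exact: ltW.
  by apply: ler_sum => k _; rewrite -exprM -normrX ger0_norm// exprn_even_ge0.
rewrite (_ : path_legendre n r ^+ 4 = `|path_legendre n r| ^+ 4); last first.
  by rewrite -normrX ger0_norm// exprn_even_ge0.
apply: (@le_trans _ _ ((`|x b| + m) ^+ 4)).
  by rewrite lerXn2r ?nnegrE// addr_ge0.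
rewrite /path_moment (_ : x b ^+ 4 = `|x b| ^+ 4); last first.
  by rewrite -normrX ger0_norm// exprn_even_ge0.
move: m4 m0 (normr_ge0 (x b)); set A := `|x b|; set Q := n%:R^-1 * _ => m4 m0 A0.
apply: (@le_trans _ _ (8 * (A ^+ 4 + m ^+ 4))); last by rewrite ler_wpM2l// lerD2l.
have := sqr_ge0 (A ^+ 2 - m ^+ 2); have := sqr_ge0 (A - m).
have e1 : (A + m) ^+ 2 <= 2 * (A ^+ 2 + m ^+ 2).
  by have := sqr_ge0 (A - m); nra.
move=> _ e2; have : ((A + m) ^+ 2) ^+ 2 <= (2 * (A ^+ 2 + m ^+ 2)) ^+ 2.
  by rewrite ler_sqr ?nnegrE ?sqr_ge0// mulr_ge0// addr_ge0// sqr_ge0.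
rewrite (_ : (A + m) ^+ 4 = ((A + m) ^+ 2) ^+ 2); last by rewrite -exprM.
rewrite (_ : A ^+ 4 = (A ^+ 2) ^+ 2); last by rewrite -exprM.
rewrite (_ : m ^+ 4 = (m ^+ 2) ^+ 2); last by rewrite -exprM.
move: e2; set U := A ^+ 2; set V := m ^+ 2; set Z := (A + m) ^+ 2; nra.
Qed.

End path_legendre.

(** * Second moments against test functions *)

Section brownian_moments.
Context (disp : measure_display) (T : measurableType disp) (R : realType)
  (P : probability T R) (d : nat) (W : 'I_d -> R -> {RV P >-> R}).
Hypothesis hW : brownian_motion W.
Context (s t : R).
Hypothesis hs : 0 <= s.
Hypothesis st : s < t.
Let x (i : 'I_d) (w : T) (u : R) : R := increment W s u i w.
Local Notation g := (grid s t).
Local Notation h := (t - s).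

Lemma increment_continuous i w : {within `[s, t], continuous (x i w)}.
Proof.
have [_ cW _ _] := hW.1 i.
have cWi : {within `[s, t], continuous ((fun u => W i u w) : R -> R)}.
  apply: (continuous_subspaceW _ (cW w)) => u /=.
  by rewrite !in_itv/= andbT => /andP[su _]; exact: le_trans su.
by move=> u; apply: cvgB; [exact: cWi|exact: cvg_cst].
Qed.

Let x0 i w : x i w s = 0. Proof. exact: subrr. Qed.

Let mx i u : measurable_fun setT (fun w => x i w u).
Proof. exact: measurable_funB. Qed.

Let dx i w u v : W i u w - W i v w = x i w u - x i w v.
Proof. by rewrite /x /increment; ring. Qed.

Lemma increment_pow4 i u : s < u <= t ->
  P.-integrable setT (EFin \o (fun w => x i w u ^+ 4)) /\
  \int[P]_w (x i w u ^+ 4) <= 58 * h ^+ 2.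
Proof.
move=> /andP[su ut]; have [_ _ _ law] := hW.1 i.
have us0 : 0 < u - s by rewrite subr_gt0.
have sg : 0 < Num.sqrt (u - s) by rewrite sqrtr_gt0.
pose X : {mfun T >-> R} := (W i u \- W i s)%R.
have lawX A : measurable A -> P (X @^-1` A) = normal_prob 0 (Num.sqrt (u - s)) A.
  by move=> mA; exact: (law s u hs su A mA).
have [i4 h4] := integrable_normal_law_pow4 sg lawX.
split; first exact: i4.
apply: (le_trans h4); rewrite ler_wpM2l//.
rewrite (_ : Num.sqrt (u - s) ^+ 4 = (u - s) ^+ 2); last first.
  by rewrite (exprM _ 2 2) sqr_sqrtr// ltW.
by rewrite ler_sqr ?nnegrE ?subr_ge0 ?lerD2r// ltW.
Qed.

Lemma path_moment_int i n : (0 < n)%N ->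
  P.-integrable setT (EFin \o (fun w => path_moment s t (x i w) n)) /\
  \int[P]_w path_moment s t (x i w) n <= 116 * h ^+ 2.
Proof.
move=> n0.
have stt : s < t <= t by rewrite st lexx.
have sg (k : 'I_n) : s < g n k.+1 <= t.
  have /andP[_ ->] := grid_itv st (ltn_ord k); rewrite andbT.
  by rewrite (le_lt_trans _ (grid_lt st k n0))//; case/andP: (grid_itv st (ltnW (ltn_ord k))).
have it := (increment_pow4 i stt).1.
have ig (k : 'I_n) := (increment_pow4 i (sg k)).1.
have isum : P.-integrable setT (EFin \o (fun w => n%:R^-1 * \sum_(k < n) x i w (g n k.+1) ^+ 4)).
  by apply: RintegrableZ; apply: Rintegrable_sum => k _; exact: ig.
split; first exact: RintegrableD.
rewrite RintegralD// RintegralZl//; last by apply: Rintegrable_sum => k _; exact: ig.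
rewrite Rintegral_sum; last by move=> k _; exact: ig.
rewrite (_ : 116 * _ = 58 * h ^+ 2 + 58 * h ^+ 2); last by ring.
apply: lerD; first exact: (increment_pow4 i stt).2.
rewrite ler_pdivrMl ?ltr0n//.
apply: (@le_trans _ _ (\sum_(k < n) 58 * h ^+ 2)).
  by apply: ler_sum => k _; exact: (increment_pow4 i (sg k)).2.
by rewrite sumr_const card_ord [leRHS]mulr_natl.
Qed.

Section fixed_grid.
Context (n : nat).
Hypothesis n3 : (2 < n)%N.
Let n0 : (0 < n)%N. Proof. exact: ltn_trans n3. Qed.
Local Notation ell := (grid_sum W s t n).
Local Notation leg := (legendre R n).

Lemma grid_sum_path i r w : ell i (leg r) w = path_legendre s t (x i w) n r.
Proof. by apply: eq_bigr => k _; rewrite dx. Qed.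

Lemma grid_sum_below i k w : (k <= n)%N ->
  x i w (g n k) = ell i (fun l => (l < k)%N%:R) w.
Proof.
move=> kn; rewrite /grid_sum (sum_below (fun l => W i (g n l.+1) w - W i (g n l) w) kn).
have -> : \sum_(l < k) (W i (g n l.+1) w - W i (g n l) w) =
    \sum_(0 <= l < k) (x i w (g n l.+1) - x i w (g n l)).
  by rewrite big_mkord; apply: eq_bigr => l _; rewrite dx.
by rewrite telescope_sumr// grid0 x0 subr0.
Qed.

(** The increment is the Wiener integral of the indicator of the first [k] cells; projecting that
    indicator splits it into the rest and the three coordinates. *)
Lemma increment_decomp i k w : (k <= n)%N -> x i w (g n k) =
  ell i (legendre_rest R n k) w +
  \sum_(r < 3) legendre_coef R n r k * ell i (leg r) w.
Proof.
move=> kn; rewrite grid_sum_below// /grid_sum.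
under [X in _ + X]eq_bigr do rewrite mulr_sumr.
rewrite exchange_big -big_split/=; apply: eq_bigr => l _.
rewrite /legendre_rest mulrBl mulr_suml -addrA -[LHS]addr0; congr (_ + _).
rewrite -sumrN -big_split/= big1// => r _; ring.
Qed.

Context (phi phi' : 'I_d * 'I_3 -> R -> R) (C : R).
Hypothesis dphi : forall m (y : R), is_derive y (1 : R) (phi m) (phi' m y).
Hypothesis cphi' : forall m, continuous (phi' m).
Hypothesis phi1 : forall m y, `|phi m y| <= 1.
Hypothesis phiC : forall m y, `|phi' m y| <= C.
Local Notation F := (grid_test W s t n phi leg).

Let mF : measurable_fun setT F.
Proof. exact: measurable_grid_test. Qed.

Let F1 w : `|F w| <= 1. Proof. exact: grid_test_le1. Qed.

Let iF2 (i j : 'I_d) (p q : nat -> R) : P.-integrable setT (EFin \o (fun w => ell i p w * ell j q w * F w)).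
Proof. exact: (integrable_grid_sum2 hW hs st n0 i j p q mF F1). Qed.

Let steinF (i j : 'I_d) (p q : nat -> R) :
  (forall r : 'I_3, \sum_(k < n) p k * leg r k = 0 \/ forall i x, phi' (i, r) x = 0) ->
  \int[P]_w (ell i p w * ell j q w * F w) =
  (i == j)%:R * (h / n%:R * \sum_(k < n) p k * q k) * \int[P]_w F w.
Proof. by move=> pv; exact: (grid_stein (v := fun r : 'I_3 => leg r) hW hs st n0 dphi cphi' phi1 phiC i j q pv). Qed.

(** If the tests ignore the last coordinate, then [legendre 2] is orthogonal to every integrand they
    depend on, and only the pairing with itself remains. *)
Lemma legendre_last_moment (i j : 'I_d) (r : 'I_3) : (forall i x, phi' (i, ord_max) x = 0) ->
  \int[P]_w (ell i (leg 2) w * ell j (leg r) w * F w) =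
  (i == j)%:R * (r == ord_max)%:R * (h * legendre_sqnorm R n 2) * \int[P]_w F w.
Proof.
move=> phi0; rewrite steinF; last first.
  move=> r'; have [->|r'2] := eqVneq r' ord_max; first by right => *; exact: phi0.
  left; rewrite legendre_orthogonal// -(inj_eq val_inj)/= in r'2 *.
  by rewrite eq_sym (negbTE r'2) mul0r.
rewrite legendre_orthogonal//; have nn : n%:R != 0 :> R by rewrite pnatr_eq0 -lt0n.
have -> : (2%N == r) = (r == ord_max) by rewrite eq_sym -(inj_eq val_inj).
by field.
Qed.

Let moment (i j : 'I_d) (r r' : nat) := \int[P]_w (ell i (leg r) w * ell j (leg r') w * F w).

(** The rest is orthogonal to all three polynomials, so integration by parts in it needs nothing of
    the test functions. Paired with the undecomposed increment it gives its variance, paired with a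
    coordinate it gives 0; the products of coordinates are left as they are. *)
Lemma grid_moment (i j : 'I_d) k : (k <= n)%N ->
  P.-integrable setT (EFin \o (fun w => x i w (g n k) * x j w (g n k) * F w)) /\
  \int[P]_w (x i w (g n k) * x j w (g n k) * F w) =
  \sum_(r < 3) \sum_(r' < 3) legendre_coef R n r k * legendre_coef R n r' k * moment i j r r' +
  (i == j)%:R * h * (k%:R / n%:R -
    \sum_(r < 3) legendre_primitive r (k%:R / n%:R) ^+ 2 / legendre_sqnorm R n r) *
  \int[P]_w F w.
Proof.
move=> kn; pose e l : R := (l < k)%N%:R; pose z := legendre_rest R n k.
have orth (r : 'I_3) : \sum_(l < n) z l * leg r l = 0.
  exact: legendre_rest_orthogonal.
have nn : n%:R != 0 :> R by rewrite pnatr_eq0 -lt0n.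
have ie : P.-integrable setT (EFin \o (fun w => x i w (g n k) * x j w (g n k) * F w)).
  rewrite (_ : (fun w => _) = fun w => ell i e w * ell j e w * F w) ?iF2//.
  by apply/funext => w; rewrite !grid_sum_below.
split => //.
have E1 : \int[P]_w (ell i z w * ell j e w * F w) = (i == j)%:R * h * (k%:R / n%:R -
    \sum_(r < 3) legendre_primitive r (k%:R / n%:R) ^+ 2 / legendre_sqnorm R n r) *
  \int[P]_w F w.
  rewrite steinF; last by move=> r; left; exact: orth.
  rewrite legendre_rest_below//; set S := (_ - \sum_(_ < 3) _ in RHS).
  by rewrite -/S; field.
have E2 (r : 'I_3) : \int[P]_w (ell j z w * ell i (leg r) w * F w) = 0.
  rewrite steinF; last by move=> r'; left; exact: orth.
  by rewrite orth mulr0 mulr0 mul0r.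
(* The increment of component [i] is decomposed everywhere, that of [j] only next to a coordinate of
   [i], so that no product of two rests appears. *)
transitivity (\int[P]_w (ell i z w * ell j e w * F w +
    \sum_(r < 3) (legendre_coef R n r k * (ell j z w * ell i (leg r) w * F w) +
      \sum_(r' < 3) (legendre_coef R n r k * legendre_coef R n r' k) *
        (ell i (leg r) w * ell j (leg r') w * F w)))).
  apply: eq_Rintegral => w _; rewrite {1}increment_decomp// !mulrDl.
  rewrite -grid_sum_below//; congr (_ + _).
  rewrite !mulr_suml; apply: eq_bigr => r _.
  rewrite increment_decomp// mulrDr mulrDl; congr (_ + _); first by ring.
  by rewrite mulr_sumr mulr_suml; apply: eq_bigr => r' _; ring.
rewrite RintegralD//; last first.
  apply: Rintegrable_sum => r _; apply: RintegrableD; first by apply: RintegrableZ; exact: iF2.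
  by apply: Rintegrable_sum => r' _; apply: RintegrableZ; exact: iF2.
rewrite E1 addrC; congr (_ + _).
rewrite Rintegral_sum; last first.
  move=> r _; apply: RintegrableD; first by apply: RintegrableZ; exact: iF2.
  by apply: Rintegrable_sum => r' _; apply: RintegrableZ; exact: iF2.
apply: eq_bigr => r _; rewrite RintegralD//; last 2 first.
- by apply: RintegrableZ; exact: iF2.
- by apply: Rintegrable_sum => r' _; apply: RintegrableZ; exact: iF2.
rewrite (RintegralZl (legendre_coef R n r k) measurableT (iF2 j i z (leg r))) E2 mulr0 add0r.
rewrite Rintegral_sum; last by move=> r' _; apply: RintegrableZ; exact: iF2.
by apply: eq_bigr => r' _; rewrite RintegralZl//; exact: iF2.
Qed.

Lemma grid_mean_moment (i j : 'I_d) :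
  \int[P]_w (n%:R^-1 * (\sum_(k < n) x i w (g n k.+1) * x j w (g n k.+1)) * F w) =
  \sum_(r < 3) \sum_(r' < 3) gram R n r r' * moment i j r r' +
  (i == j)%:R * h * (n%:R^-1 * \sum_(k < n) (k.+1%:R / n%:R -
    \sum_(r < 3) legendre_primitive r (k.+1%:R / n%:R) ^+ 2 / legendre_sqnorm R n r)) *
  \int[P]_w F w.
Proof.
transitivity (n%:R^-1 * \int[P]_w (\sum_(k < n) x i w (g n k.+1) * x j w (g n k.+1) * F w)).
  rewrite -RintegralZl//; last by apply: Rintegrable_sum => k _; exact: (grid_moment _ _ _).1.
  by apply: eq_Rintegral => w _; rewrite -mulrA mulr_suml.
rewrite Rintegral_sum; last by move=> k _; exact: (grid_moment _ _ _).1.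
under eq_bigr => k _ do rewrite (grid_moment i j (ltn_ord k)).2.
rewrite big_split/= mulrDr; congr (_ + _).
  rewrite exchange_big/= mulr_sumr; apply: eq_bigr => r _.
  rewrite exchange_big/= mulr_sumr; apply: eq_bigr => r' _.
  by rewrite -mulr_suml mulrA.
rewrite -mulr_suml -mulr_sumr; set S := \sum_(k < n) _; ring.
Qed.

End fixed_grid.
End brownian_moments.

(** * Passage to the limit over the grids *)

Section brownian_limits.
Context disp (T : measurableType disp) (R : realType) (P : probability T R) (d : nat).
Variable W : 'I_d -> R -> {RV P >-> R}.
Hypothesis hW : brownian_motion W.
Context (s t : R).
Hypothesis hs : 0 <= s.
Hypothesis st : s < t.
Let x (i : 'I_d) (w : T) (u : R) : R := increment W s u i w.
Local Notation g := (grid s t).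
Local Notation h := (t - s).
Local Notation ell := (grid_sum W s t).
Local Notation leg := (legendre R).

Let x0 i w : x i w s = 0. Proof. exact: subrr. Qed.

Let mx i u : measurable_fun setT (fun w => x i w u).
Proof. exact: measurable_funB. Qed.

Let cx i w : {within `[s, t], continuous (x i w)}.
Proof. exact: increment_continuous. Qed.

(* The discrete Legendre polynomials are linearly independent only on grids of
   at least three cells, so limits are taken along [n.+3]. *)
Lemma cvg_shift3 (u : nat -> R) (l : R) :
  u n @[n --> \oo] --> l -> u n.+3 @[n --> \oo] --> l.
Proof.
move=> ul; rewrite (cvg_shiftS (fun n => u n.+2)) (cvg_shiftS (fun n => u n.+1)).
by rewrite (cvg_shiftS u).
Qed.

(** One family for W, H and K, numbered by the degree of the polynomial they pair with. *)
Definition levy_coord (r : nat) (i : 'I_d) : T -> R :=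
  match r with
  | 0 => increment W s t i
  | 1 => st_levy_area W s t i
  | _ => stt_levy_area W s t i
  end.

Lemma levy_coord_cvg i (r : 'I_3) w :
  ell n.+3 i (leg n.+3 r) w @[n --> \oo] --> levy_coord r i w.
Proof.
apply: (@cvg_shift3 (fun n => ell n i (leg n r) w)).
under eq_fun do rewrite grid_sum_path.
case: r => -[|[|[|//]]] /= _.
- apply: cvg_near_cst.
  by exists 1%N => // n /= n0; exact: (@path_legendre0 R s t (x i w) (x0 i w) n n0).
- exact: (@path_legendre1_cvg R s t st (x i w) (@cx i w) (x0 i w)).
- exact: (@path_legendre2_cvg R s t st (x i w) (@cx i w) (x0 i w)).
Qed.

Lemma measurable_levy_coord (r : 'I_3) i : measurable_fun setT (levy_coord r i).
Proof.
apply: (measurable_fun_cvg (h := fun n => ell n.+3 i (leg n.+3 r))).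
- by move=> n; exact: measurable_grid_sum.
- by move=> w _; exact: levy_coord_cvg.
Qed.

Let q i n w := path_moment s t (x i w) n.

(** Half the sum of the fourth powers bounds the squared product, hence the constant 4 = 8 / 2. *)
Lemma grid_sum_mul_sqr i j (r r' : 'I_3) n w : (2 < n)%N ->
  (ell n i (leg n r) w * ell n j (leg n r') w) ^+ 2 <= 4 * (q i n w + q j n w).
Proof.
move=> n3; rewrite !grid_sum_path.
have := @path_legendre_pow4 R s t (x i w) (x0 i w) n r n3 (ltn_ord r).
have := @path_legendre_pow4 R s t (x j w) (x0 j w) n r' n3 (ltn_ord r').
rewrite -/(q i n w) -/(q j n w) -/(x i w) -/(x j w).
move: (path_legendre _ _ _ _ _) (path_legendre _ _ _ _ _) => a b ha hb.
have := sqr_ge0 (a ^+ 2 - b ^+ 2); lra.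
Qed.

Definition mean_product (i j : 'I_d) (w : T) : R :=
  h^-1 * primitive s (fun u => x i w u * x j w u) t.

Let Qn i j n w := n%:R^-1 * \sum_(k < n) x i w (g n k.+1) * x j w (g n k.+1).

Lemma mean_product_cvg i j w : Qn i j n.+3 w @[n --> \oo] --> mean_product i j w.
Proof.
apply: (@cvg_shift3 (fun n => Qn i j n w)).
have c0 := riemann_cvg st (within_itvM (@cx i w) (@cx j w))
    (cell_approx_right _ _ (fun u => x i w u * x j w u)).
have h0 : h != 0 by rewrite gt_eqF// subr_gt0.
rewrite (_ : (fun n => _) = fun n => h^-1 * (h / n%:R *
    \sum_(k < n) x i w (g n k.+1) * x j w (g n k.+1))); last first.
  by apply/funext => n; rewrite /Qn mulrA mulrA mulVf// mul1r.
by apply: cvgM; [exact: cvg_cst|exact: c0].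
Qed.

Lemma mean_product_sqr i j n w : (2 < n)%N ->
  Qn i j n w ^+ 2 <= 4 * (q i n w + q j n w).
Proof.
move=> n3; apply: (le_trans (sqr_mean_le n (fun k => x i w (g n k.+1) * x j w (g n k.+1)))).
have nn : 0 <= n%:R^-1 :> R by [].
have : n%:R^-1 * \sum_(k < n) (x i w (g n k.+1) * x j w (g n k.+1)) ^+ 2 <=
    n%:R^-1 * \sum_(k < n) (x i w (g n k.+1) ^+ 4 + x j w (g n k.+1) ^+ 4).
  apply: ler_wpM2l => //; apply: ler_sum => k _.
  move: (x i w _) (x j w _) => a b.
  have := sqr_ge0 (a ^+ 2 - b ^+ 2); have := sqr_ge0 (a ^+ 2); have := sqr_ge0 (b ^+ 2).
  lra.
rewrite big_split/= mulrDr => /le_trans; apply.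
have Qi := path_moment_ge0 s t (x i w) n; have Qj := path_moment_ge0 s t (x j w) n.
rewrite -/(q i n w) -/(q j n w) in Qi Qj.
have : n%:R^-1 * (\sum_(k < n) x i w (g n k.+1) ^+ 4) <= q i n w.
  by rewrite /q /path_moment lerDr exprn_even_ge0.
have : n%:R^-1 * (\sum_(k < n) x j w (g n k.+1) ^+ 4) <= q j n w.
  by rewrite /q /path_moment lerDr exprn_even_ge0.
lra.
Qed.

Section weighted_limit.
Context (F_ : nat -> T -> R) (F : T -> R).
Hypothesis mF : forall n, measurable_fun setT (F_ n).
Hypothesis F1 : forall n w, `|F_ n w| <= 1.
Hypothesis FF : forall w, F_ n w @[n --> \oo] --> F w.

(** The weights are at most 1, so the second moments of the products stay below 928 h^2, with 928 =
    4 (116 + 116), and [bounded_L2_cvg] applies. The weight 1 yields plain integrability. *)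
Lemma moment_bounded_cvg i j (X_ : nat -> T -> R) (X : T -> R) :
  (forall n, measurable_fun setT (X_ n)) ->
  (forall w, X_ n w @[n --> \oo] --> X w) ->
  (forall n w, X_ n w ^+ 2 <= 4 * (q i n.+3 w + q j n.+3 w)) ->
  P.-integrable setT (EFin \o (fun w => X w * F w)) /\
  \int[P]_w (X_ n w * F_ n w) @[n --> \oo] --> \int[P]_w (X w * F w).
Proof.
move=> mX XX Xq.
have mXF n : measurable_fun setT (fun w => X_ n w * F_ n w) by exact: measurable_funM.
have XF w : X_ n w * F_ n w @[n --> \oo] --> X w * F w by apply: cvgM; [exact: XX|exact: FF].
have iq n : P.-integrable setT (EFin \o (fun w => 4 * (q i n.+3 w + q j n.+3 w))).
  by apply: RintegrableZ; apply: RintegrableD; exact: (path_moment_int hW hs st _ _).1.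
have qX n w : (X_ n w * F_ n w) ^+ 2 <= 4 * (q i n.+3 w + q j n.+3 w).
  apply: (le_trans _ (Xq n w)); rewrite exprMn ler_piMr ?sqr_ge0//.
  by rewrite -real_normK ?num_real// exprn_ile1.
have iXF n : P.-integrable setT (EFin \o (fun w => (X_ n w * F_ n w) ^+ 2)).
  apply: (le_Rintegrable _ _ (iq n)); first exact: measurable_funX.
  by move=> w; rewrite ger0_norm ?sqr_ge0.
have C n : \int[P]_w (X_ n w * F_ n w) ^+ 2 <= 928 * h ^+ 2.
  have [ii bi] := path_moment_int hW hs st i (isT : 0 < n.+3)%N.
  have [ij bj] := path_moment_int hW hs st j (isT : 0 < n.+3)%N.
  apply: (@le_trans _ _ (\int[P]_w (4 * (q i n.+3 w + q j n.+3 w)))).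
    by apply: le_Rintegral => //; exact: iq.
  rewrite RintegralZl//; last exact: RintegrableD.
  rewrite RintegralD//.
  by move: bi bj; rewrite /q; lra.
by split; [exact: bounded_L2_integrable C|exact: bounded_L2_cvg C].
Qed.

End weighted_limit.

Lemma integrable_mean_product i j : P.-integrable setT (EFin \o mean_product i j).
Proof.
have [] := @moment_bounded_cvg (fun _ _ => 1) (fun _ => 1) _ _ _ i j
  (fun n => Qn i j n.+3) (mean_product i j) _ _ _.
- by move=> n; exact: measurable_cst.
- by move=> n w; rewrite normr1.
- by move=> w; exact: cvg_cst.
- by move=> n; apply: measurable_funM => //; apply: measurable_sum => k; exact: measurable_funM.
- by move=> w; exact: mean_product_cvg.
- by move=> n w; exact: mean_product_sqr.
by under eq_fun do rewrite mulr1.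
Qed.

Lemma integrable_levy_coord_mul i j (r r' : 'I_3) :
  P.-integrable setT (EFin \o (fun w => levy_coord r i w * levy_coord r' j w)).
Proof.
have [] := @moment_bounded_cvg (fun _ _ => 1) (fun _ => 1) _ _ _ i j
  (fun n w => ell n.+3 i (leg n.+3 r) w * ell n.+3 j (leg n.+3 r') w)
  (fun w => levy_coord r i w * levy_coord r' j w) _ _ _.
- by move=> n; exact: measurable_cst.
- by move=> n w; rewrite normr1.
- by move=> w; exact: cvg_cst.
- by move=> n; apply: measurable_funM; exact: measurable_grid_sum.
- by move=> w; apply: cvgM; exact: levy_coord_cvg.
- by move=> n w; exact: grid_sum_mul_sqr.
by under eq_fun do rewrite mulr1.
Qed.

Section tests.
Context (phi phi' : 'I_d * 'I_3 -> R -> R) (C : R).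
Hypothesis dphi : forall m (y : R), is_derive y (1 : R) (phi m) (phi' m y).
Hypothesis cphi' : forall m, continuous (phi' m).
Hypothesis phi1 : forall m y, `|phi m y| <= 1.
Hypothesis phiC : forall m y, `|phi' m y| <= C.

Definition levy_test (w : T) : R := \prod_m phi m (levy_coord m.2 m.1 w).

Let Fn n := grid_test W s t n.+3 phi (fun r : 'I_3 => leg n.+3 r).

Let mF n : measurable_fun setT (Fn n).
Proof. exact: measurable_grid_test. Qed.

Let F1 n w : `|Fn n w| <= 1.
Proof. exact: grid_test_le1. Qed.

Let FF w : Fn n w @[n --> \oo] --> levy_test w.
Proof.
apply: (cvg_prod_seq (u := fun n m => phi m (ell n.+3 m.1 (leg n.+3 m.2) w))) => m.
have : {for levy_coord m.2 m.1 w, continuous (phi m)}.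
  by apply: differentiable_continuous; apply/derivable1_diffP; exact: ex_derive.
by move=> c; apply: (continuous_cvg _ c); exact: levy_coord_cvg.
Qed.

Let cvgF : \int[P]_w Fn n w @[n --> \oo] --> \int[P]_w levy_test w.
Proof.
apply: (@Rdominated_convergence _ _ _ P Fn levy_test (cst 1) mF FF _ F1).2.
exact: finite_measure_integrable_cst.
Qed.

Let moment_cvg i j (r r' : 'I_3) :
  \int[P]_w (ell n.+3 i (leg n.+3 r) w * ell n.+3 j (leg n.+3 r') w * Fn n w) @[n --> \oo] -->
  \int[P]_w (levy_coord r i w * levy_coord r' j w * levy_test w).
Proof.
apply: (moment_bounded_cvg (i := i) (j := j) mF F1 FF
  (X_ := fun n w => ell n.+3 i (leg n.+3 r) w * ell n.+3 j (leg n.+3 r') w)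
  (X := fun w => levy_coord r i w * levy_coord r' j w) _ _ _).2.
- by move=> n; apply: measurable_funM; exact: measurable_grid_sum.
- by move=> w; apply: cvgM; exact: levy_coord_cvg.
- by move=> n w; exact: grid_sum_mul_sqr.
Qed.

Lemma levy_last_moment i j (r : 'I_3) : (forall i x, phi' (i, ord_max) x = 0) ->
  \int[P]_w (levy_coord 2 i w * levy_coord r j w * levy_test w) =
  (i == j)%:R * (r == ord_max)%:R * (h / 720) * \int[P]_w levy_test w.
Proof.
move=> phi0.
have H : \int[P]_w (ell n.+3 i (leg n.+3 2) w * ell n.+3 j (leg n.+3 r) w * Fn n w) @[n --> \oo] -->
    \int[P]_w (levy_coord 2 i w * levy_coord r j w * levy_test w) := @moment_cvg i j ord_max r.
apply: (cvg_unique (@norm_hausdorff _ R^o) H); rewrite /mkset.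
under eq_cvg => n do rewrite (legendre_last_moment hW hs st (isT : 2 < n.+3)%N dphi cphi' phi1 phiC i j r phi0).
apply: cvgM; last exact: cvgF.
apply: cvgM; first exact: cvg_cst.
apply: cvgM; first exact: cvg_cst.
exact: (@cvg_shift3 (fun n => legendre_sqnorm R n 2) _ (@legendre_sqnorm_cvg R 2)).
Qed.

(** The limit of [grid_mean_moment]: the coefficients converge by [gram_cvg] and [rest_cvg], the
    moments by uniform integrability. *)
Lemma mean_product_moment i j :
  \int[P]_w (mean_product i j w * levy_test w) =
  \sum_(r < 3) \sum_(r' < 3) gram_lim R r r' *
    \int[P]_w (levy_coord r i w * levy_coord r' j w * levy_test w) +
  (i == j)%:R * h * (3 / 70) * \int[P]_w levy_test w.
Proof.
have H : \int[P]_w (Qn i j n.+3 w * Fn n w) @[n --> \oo] -->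
    \int[P]_w (mean_product i j w * levy_test w).
  apply: (moment_bounded_cvg (i := i) (j := j) mF F1 FF (X_ := fun n => Qn i j n.+3)
    (X := mean_product i j) _ _ _).2.
  - by move=> n; apply: measurable_funM => //; apply: measurable_sum => k; exact: measurable_funM.
  - by move=> w; exact: mean_product_cvg.
  - by move=> n w; exact: mean_product_sqr.
apply: (cvg_unique (@norm_hausdorff _ R^o) H); rewrite /mkset.
under eq_cvg => n do rewrite (grid_mean_moment hW hs st (isT : 2 < n.+3)%N dphi cphi' phi1 phiC i j).
apply: cvgD.
  apply: (cvg_big (U := R^o)) => [|r _]; first exact: add_continuous.
  apply: (cvg_big (U := R^o)) => [|r' _]; first exact: add_continuous.
  apply: cvgM; last exact: moment_cvg.
  exact: (cvg_shift3 (gram_cvg (ltn_ord r) (ltn_ord r'))).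
apply: cvgM; last exact: cvgF.
apply: cvgM; first exact: cvg_cst.
exact: (@cvg_shift3 (fun n => n%:R^-1 * \sum_(k < n) (k.+1%:R / n%:R -
  \sum_(r < 3) legendre_primitive r (k.+1%:R / n%:R) ^+ 2 / legendre_sqnorm R n r)) _ (@rest_cvg R)).
Qed.

End tests.
End brownian_limits.

(** * Conditional expectation of the area *)

Section ae_Rintegral.
Context d (T : measurableType d) (R : realType) (mu : {measure set T -> \bar R}).
Variables f g : T -> R.
Hypothesis fg : {ae mu, forall w, f w = g w}.
Hypothesis mf : measurable_fun setT f.
Hypothesis ig : mu.-integrable setT (EFin \o g).

Let mEg : measurable_fun setT (EFin \o g). Proof. exact: measurable_int ig. Qed.

Lemma ae_Rintegrable : mu.-integrable setT (EFin \o f).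
Proof.
have mEf : measurable_fun setT (EFin \o f) by exact/measurable_EFinP.
apply/integrableP; split => //.
have /integrableP[_] := ig; congr (_ < _)%E.
apply: ae_eq_integral => //; [exact: measurableT_comp|exact: measurableT_comp|].
by apply: filterS fg => w E _ /=; rewrite E.
Qed.

Lemma ae_Rintegral : \int[mu]_w f w = \int[mu]_w g w.
Proof.
congr fine; apply: ae_eq_integral => //; first exact/measurable_EFinP.
by apply: filterS fg => w E _; rewrite E.
Qed.

End ae_Rintegral.

(** [G] has only to lie inside the sigma-algebra on whose events the integrals of [X - Y] vanish;
    that [Y] is measurable for [G] is asked separately. *)
Lemma cond_expectation_of_tests d (T : measurableType d) (R : realType)
    (P : probability T R) (X Y : T -> R) (M : finType) (D : {set M})
    (V : M -> T -> R) (G : set (set T)) :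
  P.-integrable setT (EFin \o X) -> P.-integrable setT (EFin \o Y) ->
  (forall m, measurable_fun setT (V m)) ->
  G `<=` <<s \bigcup_(m in [set` D]) preimage_set_system setT (V m) measurable >> ->
  (forall B, measurable B -> G (Y @^-1` B)) ->
  (forall (phi phi' : M -> R -> R) C,
    (forall m x, is_derive x (1 : R) (phi m) (phi' m x)) ->
    (forall m, continuous (phi' m)) ->
    (forall m x, `|phi m x| <= 1) -> (forall m x, `|phi' m x| <= C) ->
    (forall m, m \notin D -> phi m = cst 1 /\ (forall x, phi' m x = 0)) ->
    \int[P]_w ((X w - Y w) * \prod_m phi m (V m w)) = 0) ->
  is_cond_expectation P G X Y.
Proof.
move=> iX iY mV GV YG XY.
have Gm : G `<=` measurable.
  apply: (subset_trans GV); apply: smallest_sub; first exact: sigma_algebra_measurable.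
  by move=> B [m _ [C mC <-]]; exact: mV.
split => // A GA.
have iXA : P.-integrable A (EFin \o X) by apply: integrableS iX => //; exact: Gm.
have iYA : P.-integrable A (EFin \o Y) by apply: integrableS iY => //; exact: Gm.
have := null_integral_sigma (RintegrableB iX iY) mV XY (GV _ GA).
under eq_integral do rewrite EFinB.
rewrite (integralB_EFin (Gm _ GA) iXA iYA).
have := integrable_fin_num (Gm _ GA) iXA; have := integrable_fin_num (Gm _ GA) iYA.
rewrite /comp; move: (integral _ _ _) (integral _ _ _) => a b.
case: a => // a _; case: b => // b _.
by rewrite -EFinB => -[/eqP]; rewrite subr_eq0 => /eqP ->.
Qed.

Section brownian_area.
Context disp (T : measurableType disp) (R : realType) (P : probability T R) (d : nat).
Variable W : 'I_d -> R -> {RV P >-> R}.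
Hypothesis hW : brownian_motion W.
Context (s t : R).
Hypothesis hs : 0 <= s.
Hypothesis st : s < t.
Local Notation h := (t - s).
Local Notation V := (levy_coord W s t).
Local Notation Q := (mean_product W s t).

(** Inserts h H + h W / 2 for the integral of the path. The products W W collect h - 3 h = -2 h,
    which division by 12 turns into - h / 6. *)
Lemma sst_levy_area_coord (L : 'I_d -> 'I_d -> {RV P >-> R}) i j :
  is_sst_levy_area W s t L ->
  {ae P, forall w, L i j w = h / 2 * Q i j w
    - h / 4 * (V 1 i w * V 0 j w + V 0 i w * V 1 j w) - h / 6 * (V 0 i w * V 0 j w)}.
Proof.
move=> hL.
have cW k w : {within `[s, t], continuous ((fun u => W k u w) : R -> R)}.
  have [_ cW _ _] := hW.1 k.
  apply: (continuous_subspaceW _ (cW w)) => u /=.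
  by rewrite !in_itv/= andbT => /andP[su _]; exact: le_trans su.
apply: filterS (sst_levy_area_ae st cW i j hL) => w.
have h0 : h != 0 by rewrite gt_eqF// subr_gt0.
have prim k : primitive s (fun u => increment W s u k w) t = h * V 1 k w + h / 2 * V 0 k w.
  have -> : V 1 k w = h^-1 * primitive s (fun u => increment W s u k w) t - V 0 k w / 2.
    exact: (@path_legendre1_primitive R s t st (fun u => increment W s u k w)
      (@increment_continuous _ _ _ P _ W hW s t hs k w)).
  by field.
have -> : primitive s (fun u => increment W s u i w * increment W s u j w) t = h * Q i j w.
  by rewrite /mean_product mulrA mulfV// mul1r.
rewrite !prim /= => E; apply: (mulfI (_ : 12 != 0 :> R)); first by rewrite pnatr_eq0.
by rewrite E; field.
Qed.

Definition area_mean3 i j w : R :=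
  3 / 5 * h * V 1 i w * V 1 j w - 1 / 2 * h * (V 0 i w * V 2 j w + V 2 i w * V 0 j w)
  + 60 / 7 * h * V 2 i w * V 2 j w + 3 / 140 * h ^+ 2 * (i == j)%:R.

Definition area_mean2 i j w : R :=
  3 / 5 * h * V 1 i w * V 1 j w + 1 / 30 * h ^+ 2 * (i == j)%:R.

Let iV i j r r' : (r < 3)%N -> (r' < 3)%N ->
  P.-integrable setT (EFin \o (fun w => V r i w * V r' j w)).
Proof.
by move=> r3 r'3; exact: (integrable_levy_coord_mul hW hs st i j (Ordinal r3) (Ordinal r'3)).
Qed.

Let icst (c : R) : P.-integrable setT (EFin \o (fun=> c)).
Proof. exact: finite_measure_integrable_cst. Qed.

Lemma integrable_area_mean3 i j : P.-integrable setT (EFin \o area_mean3 i j).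
Proof.
rewrite (_ : area_mean3 i j = fun w => 3 / 5 * h * (V 1 i w * V 1 j w)
    + (- (1 / 2) * h) * (V 0 i w * V 2 j w + V 2 i w * V 0 j w)
    + 60 / 7 * h * (V 2 i w * V 2 j w) + 3 / 140 * h ^+ 2 * (i == j)%:R); last first.
  by apply/funext => w; rewrite /area_mean3; ring.
apply: RintegrableD; last exact: icst.
apply: RintegrableD; last by apply: RintegrableZ; exact: iV.
apply: RintegrableD; first by apply: RintegrableZ; exact: iV.
by apply: RintegrableZ; apply: RintegrableD; exact: iV.
Qed.

Lemma integrable_area_mean2 i j : P.-integrable setT (EFin \o area_mean2 i j).
Proof.
rewrite (_ : area_mean2 i j = fun w => 3 / 5 * h * (V 1 i w * V 1 j w)
    + 1 / 30 * h ^+ 2 * (i == j)%:R); last by apply/funext => w; rewrite /area_mean2; ring.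
by apply: RintegrableD; [apply: RintegrableZ; exact: iV|exact: icst].
Qed.

Let mV (m : 'I_d * 'I_3) : measurable_fun setT (V m.2 m.1).
Proof. exact: measurable_levy_coord. Qed.

Lemma integrable_sst_levy_area (L : 'I_d -> 'I_d -> {RV P >-> R}) i j : is_sst_levy_area W s t L ->
  P.-integrable setT (EFin \o L i j).
Proof.
move=> hL; apply: (ae_Rintegrable (sst_levy_area_coord i j hL)) => //.
apply: RintegrableB; last by apply: RintegrableZ; exact: iV.
apply: RintegrableB; first by apply: RintegrableZ; exact: (integrable_mean_product hW hs st i j).
by apply: RintegrableZ; apply: RintegrableD; exact: iV.
Qed.

Section tests.
Context (phi phi' : 'I_d * 'I_3 -> R -> R) (C : R).
Hypothesis dphi : forall m (y : R), is_derive y (1 : R) (phi m) (phi' m y).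
Hypothesis cphi' : forall m, continuous (phi' m).
Hypothesis phi1 : forall m y, `|phi m y| <= 1.
Hypothesis phiC : forall m y, `|phi' m y| <= C.
Local Notation F := (levy_test W s t phi).

Let F1 w : `|F w| <= 1. Proof. exact: prod_seq_le1. Qed.

Let mF : measurable_fun setT F.
Proof.
apply: measurable_prod => m _; apply: measurableT_comp; last exact: mV.
apply: continuous_measurable_fun => x.
by apply: differentiable_continuous; apply/derivable1_diffP; exact: ex_derive.
Qed.

Let iF : P.-integrable setT (EFin \o F).
Proof. by apply: (le_Rintegrable mF F1); exact: icst. Qed.

Let iFM f : P.-integrable setT (EFin \o f) -> P.-integrable setT (EFin \o (fun w => f w * F w)).
Proof. by move=> fi; exact: (RintegrableM_bounded fi mF F1). Qed.

(** Almost surely [L i j - area_mean3 i j] is [h / 2] times [Q i j] minus its predicted mean: the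
    products W W and W H in the area cancel those weighted by 1/3 and 1/2 in [gram_lim]. Then
    [mean_product_moment] applies. *)
Lemma area_mean3_test (L : 'I_d -> 'I_d -> {RV P >-> R}) i j :
  is_sst_levy_area W s t L -> \int[P]_w ((L i j w - area_mean3 i j w) * F w) = 0.
Proof.
move=> hL; pose S w := \sum_(r < 3) \sum_(r' < 3) gram_lim R r r' * (V r i w * V r' j w * F w).
have iS : P.-integrable setT (EFin \o S).
  apply: Rintegrable_sum => r _; apply: Rintegrable_sum => r' _.
  by apply: RintegrableZ; apply: iFM; exact: iV.
have iQ : P.-integrable setT (EFin \o (fun w => Q i j w * F w)).
  by apply: iFM; exact: (integrable_mean_product hW hs st i j).
pose c : R := (i == j)%:R * h * (3 / 70).
have icF : P.-integrable setT (EFin \o (fun w => c * F w)) by exact: RintegrableZ.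
have iQS : P.-integrable setT (EFin \o (fun w => Q i j w * F w - S w - c * F w)).
  by apply: RintegrableB => //; exact: RintegrableB.
transitivity (\int[P]_w (h / 2 * (Q i j w * F w - S w - c * F w))).
  apply: ae_Rintegral.
  - apply: filterS (sst_levy_area_coord i j hL) => w ->.
    rewrite /S /c /area_mean3 !big_ord_recr !big_ord0 /=.
    by field.
  - apply: measurable_funM => //; apply: measurable_funB => //.
    by have /measurable_int/measurable_EFinP := integrable_area_mean3 i j.
  - exact: RintegrableZ.
have SE : \int[P]_w S w = \sum_(r < 3) \sum_(r' < 3) gram_lim R r r' *
    \int[P]_w (V r i w * V r' j w * F w).
  rewrite Rintegral_sum; last first.
    move=> r _; apply: Rintegrable_sum => r' _.
    by apply: RintegrableZ; apply: iFM; exact: iV.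
  apply: eq_bigr => r _; rewrite Rintegral_sum; last first.
    by move=> r' _; apply: RintegrableZ; apply: iFM; exact: iV.
  by apply: eq_bigr => r' _; rewrite RintegralZl//; apply: iFM; exact: iV.
rewrite RintegralZl// RintegralB//; last exact: RintegrableB.
rewrite RintegralB// RintegralZl// SE.
rewrite (mean_product_moment hW hs st dphi cphi' phi1 phiC).
by rewrite -/c [_ + _ - _]addrAC addrK subrr mulr0.
Qed.

(** The two candidates differ by products containing K and a constant. For tests that ignore K,
    [levy_last_moment] evaluates these products. *)
Lemma area_mean2_test (L : 'I_d -> 'I_d -> {RV P >-> R}) i j :
  (forall i x, phi' (i, ord_max) x = 0) ->
  is_sst_levy_area W s t L -> \int[P]_w ((L i j w - area_mean2 i j w) * F w) = 0.
Proof.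
move=> phi0 hL.
have lm i' j' (r : 'I_3) := levy_last_moment hW hs st dphi cphi' phi1 phiC i' j' r phi0.
have iVF i' j' r r' : (r < 3)%N -> (r' < 3)%N ->
    P.-integrable setT (EFin \o (fun w => V r i' w * V r' j' w * F w)).
  by move=> r3 r'3; apply: iFM; exact: iV.
(* Here 1/84 is 1/30 - 3/140; it is cancelled by the mean of the product of K^i and K^j, as 60/7
   times 1/720 is 1/84. *)
transitivity (\int[P]_w ((L i j w - area_mean3 i j w) * F w +
    (- (h / 2) * (V 2 j w * V 0 i w * F w) + - (h / 2) * (V 2 i w * V 0 j w * F w) +
    60 / 7 * h * (V 2 i w * V 2 j w * F w) + - (h ^+ 2 / 84 * (i == j)%:R) * F w))).
  by apply: eq_Rintegral => w _; rewrite /area_mean3 /area_mean2; field.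
rewrite RintegralD//; last 2 first.
- by apply: iFM; apply: RintegrableB; [exact: integrable_sst_levy_area|exact: integrable_area_mean3].
- apply: RintegrableD; last exact: RintegrableZ.
  apply: RintegrableD; last by apply: RintegrableZ; exact: iVF.
  by apply: RintegrableD; apply: RintegrableZ; exact: iVF.
rewrite area_mean3_test// add0r.
rewrite RintegralD//; last 2 first.
- apply: RintegrableD; last by apply: RintegrableZ; exact: iVF.
  by apply: RintegrableD; apply: RintegrableZ; exact: iVF.
- exact: RintegrableZ.
rewrite RintegralD//; last 2 first.
- by apply: RintegrableD; apply: RintegrableZ; exact: iVF.
- by apply: RintegrableZ; exact: iVF.
rewrite RintegralD//; last 2 first.
- by apply: RintegrableZ; exact: iVF.
- by apply: RintegrableZ; exact: iVF.
rewrite !RintegralZl//; try exact: iVF.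
rewrite (lm j i ord0) (lm i j ord0) (lm i j ord_max) eqxx.
have -> : (ord0 == ord_max :> 'I_3) = false by [].
rewrite mulr0n mulr1n.
by field.
Qed.

End tests.
End brownian_area.

Section sigma_family.
Context d (T : measurableType d) (R : realType) (I : Type).
Implicit Types (X : I -> T -> R) (G : set (set T)).

Lemma measurable_sigma_family X G i : sigma_family setT X `<=` G ->
  measurable_fun setT (X i : g_sigma_algebraType G -> R).
Proof.
move=> XG _ B mB; rewrite setTI; apply: sub_sigma_algebra; apply: XG.
by apply: sub_sigma_algebra; exists i => //; exists B => //; rewrite setTI.
Qed.

Lemma sigma_family_sub J X (D : set J) (V : J -> T -> R) (f : I -> J) :
  (forall i, D (f i)) -> (forall i, V (f i) = X i) ->
  sigma_family setT X `<=` sigma_family D V.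
Proof.
move=> Df Vf; apply: smallest_sub; first exact: smallest_sigma_algebra.
move=> A [i _ hA]; apply: sub_sigma_algebra.
by exists (f i); [exact: Df|rewrite Vf].
Qed.

End sigma_family.

Theorem theorem14 (disp : measure_display) (T : measurableType disp)
    (R : realType) (P : probability T R) (d : nat)
    (W : 'I_d -> R -> {RV P >-> R}) (hW : brownian_motion W)
    (s t : R) (hs : 0 <= s) (hst : s < t)
    (L : 'I_d -> 'I_d -> {RV P >-> R}) (hL : is_sst_levy_area W s t L) :
  let h := t - s in
  let Wst := increment W s t in
  let H := st_levy_area W s t in
  let K := stt_levy_area W s t in
  let sW := sigma_family setT Wst in
  let sH := sigma_family setT H in
  let sK := sigma_family setT K in
  forall i j : 'I_d,
    is_cond_expectation P <<s sW `|` sH >> (L i j)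
      (fun w => 3 / 5 * h * H i w * H j w
                + 1 / 30 * h ^+ 2 * (i == j)%:R)
    /\
    is_cond_expectation P <<s sW `|` sH `|` sK >> (L i j)
      (fun w => 3 / 5 * h * H i w * H j w
                - 1 / 2 * h * (Wst i w * K j w + K i w * Wst j w)
                + 60 / 7 * h * K i w * K j w
                + 3 / 140 * h ^+ 2 * (i == j)%:R).
Proof.
move=> h Wst H K sW sH sK i j.
pose V (m : 'I_d * 'I_3) := levy_coord W s t m.2 m.1.
have mV m : measurable_fun setT (V m) by exact: measurable_levy_coord.
have iL : P.-integrable setT (EFin \o L i j) by exact: integrable_sst_levy_area hL.
split.
(* In ['I_3], [ord0], [lift ord0 ord0] and [ord_max] number W, H and K; tests trivial outside [D] do
   not see K. *)
- pose D : {set 'I_d * 'I_3} := [set m | m.2 != ord_max]%SET.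
  apply: (cond_expectation_of_tests (D := D) iL (integrable_area_mean2 hW hs hst i j) mV).
  + apply: smallest_sub; first exact: smallest_sigma_algebra.
    rewrite subUset; split.
      by apply: (sigma_family_sub (f := fun k => (k, ord0))) => k //=; rewrite inE.
    by apply: (sigma_family_sub (f := fun k => (k, lift ord0 ord0))) => k //=; rewrite inE.
  + move=> B mB; rewrite -[_ @^-1` _]setTI.
    have mH k : measurable_fun setT (H k : g_sigma_algebraType (sW `|` sH) -> R).
      by apply: measurable_sigma_family => A; right.
    suff : measurable_fun setT (area_mean2 W s t i j : g_sigma_algebraType (sW `|` sH) -> R).
      by apply.
    apply: measurable_funD => //; apply: measurable_funM => //.
    exact: measurable_funM.
  + move=> phi phi' C dphi cphi' phi1 phiC phiD.
    apply: (area_mean2_test hW hs hst dphi cphi' phi1 phiC i j _ hL) => k y.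
    by apply: (phiD _ _).2; rewrite inE.
- apply: (cond_expectation_of_tests (D := [set: _]%SET) iL (integrable_area_mean3 hW hs hst i j) mV).
  + apply: smallest_sub; first exact: smallest_sigma_algebra.
    rewrite !subUset; do ?split.
    * by apply: (sigma_family_sub (f := fun k => (k, ord0))) => k //=; rewrite inE.
    * by apply: (sigma_family_sub (f := fun k => (k, lift ord0 ord0))) => k //=; rewrite inE.
    * by apply: (sigma_family_sub (f := fun k => (k, ord_max))) => k //=; rewrite inE.
  + move=> B mB; rewrite -[_ @^-1` _]setTI.
    pose G := sW `|` sH `|` sK.
    have mW k : measurable_fun setT (Wst k : g_sigma_algebraType G -> R).
      by apply: measurable_sigma_family => A; left; left.
    have mH k : measurable_fun setT (H k : g_sigma_algebraType G -> R).
      by apply: measurable_sigma_family => A; left; right.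
    have mK k : measurable_fun setT (K k : g_sigma_algebraType G -> R).
      by apply: measurable_sigma_family => A; right.
    suff : measurable_fun setT (area_mean3 W s t i j : g_sigma_algebraType G -> R).
      by apply.
    apply: measurable_funD => //; apply: measurable_funD; last first.
      by apply: measurable_funM => //; exact: measurable_funM.
    apply: measurable_funB; first by apply: measurable_funM => //; exact: measurable_funM.
    by apply: measurable_funM => //; apply: measurable_funD; exact: measurable_funM.
  + move=> phi phi' C dphi cphi' phi1 phiC _.
    exact: (area_mean3_test hW hs hst dphi cphi' phi1 phiC i j hL).
Qed.
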